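(* Let $\lambda\in P^+$ and let $V\in\mathcal I_A^\lambda$. Then $V\cong \mathbf W_A^\lambda\mathbf R_A^\lambda V$ if and only if for all $U\in\mathcal I_A^\lambda$ with $U_\lambda=0$ we have $$\operatorname{Hom}_{\mathcal I_A^\lambda}(V,U)=0,\qquad \operatorname{Ext}^1_{\mathcal I_A^\lambda}(V,U)=0.$$
   Context: $\mathfrak g$ is a finite-dimensional simple Lie algebra over $\mathbb C$ of rank $n$, $I=\{1,\dots,n\}$, $\mathfrak h$ a Cartan subalgebra, $R$ the root system, $\alpha_i,\omega_i$ ($i\in I$) the simple roots and fundamental weights, $Q^+$ and $P^+$ the $\mathbb Z_{\ge 0}$-spans of the $\alpha_i$ and of the $\omega_i$; $\mu\le\lambda$ iff $\lambda-\mu\in Q^+$. $x^\pm_\alpha$ ($\alpha\in R^+$), $h_i$ is a Chevalley basis, $x_i^\pm=x^\pm_{\alpha_i}$, $\mathfrak n^\pm=\bigoplus_{\alpha\in R^+}\mathbb C x^\pm_\alpha$. $\mathbf U(-)$ denotes universal enveloping algebra. $A$ is a commutative associative unital $\mathbb C$-algebra (containing $\mathbb C=\mathbb C\cdot 1$); $\mathfrak g\otimes A$ is the Lie algebra with $[x\otimes a,y\otimes b]=[x,y]\otimes ab$, and $\mathfrak g$ is identified with $\mathfrak g\otimes 1$. A $\mathfrak g$-module is locally finite-dimensional if each element lies in a finite-dimensional $\mathfrak g$-submodule; then $V=\bigoplus_\mu V_\mu$ (weight spaces) and $\operatorname{wt}(V)=\{\mu: V_\mu\neq 0\}$. $V(\lambda)$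 is the irreducible finite-dimensional $\mathfrak g$-module of highest weight $\lambda\in P^+$ with highest weight vector $v_\lambda$. $\mathcal I_A$ is the category of $\mathfrak g\otimes A$-modules that are locally finite-dimensional as $\mathfrak g$-modules, with all $\mathfrak g\otimes A$-module maps. For $\nu\in P^+$ and $V\in\mathcal I_A$, $V^\nu=V/\sum_{\mu\not\le\nu}\mathbf U(\mathfrak g\otimes A)V_\mu$, the maximal quotient with $\operatorname{wt}(V^\nu)\subset\nu-Q^+$; $\mathcal I_A^\nu$ is the full subcategory of $V$ with $V=V^\nu$. Global Weyl module: $P_A(V(\lambda))=\mathbf U(\mathfrak g\otimes A)\otimes_{\mathbf U(\mathfrak g)}V(\lambda)$, $W_A(\lambda)=P_A(V(\lambda))^\lambda$, and $w_\lambda$ is the image of $1\otimes v_\lambda$. $\operatorname{Ann}_{\mathfrak h\otimes A}(w_\lambda)=\{u\in\mathbf U(\mathfrak h\otimes A):uw_\lambda=0\}$ and $\mathbf A_\lambda=\mathbf U(\mathfrak h\otimes A)/\operatorname{Ann}_{\mathfrak h\otimes A}(w_\lambda)$, a commutative algebra. $W_A(\lambda)$ is a $(\mathfrak g\otimes A,\mathbf A_\lambda)$-bimodule, with right action $(uw_\lambda)(h\otimes a)=u(h\otimes a)w_\lambda$ for $u\in\mathbf U(\mathfrak g\otimes A)$, $h\in\mathfrak h$, $a\in A$. $\operatorname{mod}\mathbf A_\lambda$ is the category of left $\mathbf A_\lambda$-modules. The Weyl functor is $\mathbf W_A^\lambda:\operatorname{mod}\mathbf A_\lambda\to\mathcal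 I_A^\lambda$, $\mathbf W_A^\lambda M=W_A(\lambda)\otimes_{\mathbf A_\lambda}M$, $\mathbf W_A^\lambda f=1\otimes f$. For $V\in\mathcal I_A^\lambda$ the ideal $\operatorname{Ann}_{\mathfrak h\otimes A}(w_\lambda)$ kills $V_\lambda$, so $V_\lambda$ is a left $\mathbf A_\lambda$-module, denoted $\mathbf R_A^\lambda V$; $\mathbf R_A^\lambda\pi=\pi|_{V_\lambda}$ on morphisms. *)

(* Defs.v *)
From HB Require Import structures.
From mathcomp Require Import all_boot all_order all_algebra.
From mathcomp Require Import generic_quotient.
From mathcomp Require Import boolp reals.
From mathcomp Require Import complex.

Set Implicit Arguments.
Unset Strict Implicit.
Unset Printing Implicit Defensive.

Import GRing.Theory.

Local Open Scope ring_scope.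
Local Open Scope quotient_scope.

HB.mixin Record isLie (K : fieldType) L of GRing.Lmodule K L := {
  lie : L -> L -> L;
  lie_linl : forall c x y z, lie (c *: x + y) z = c *: lie x z + lie y z;
  lie_linr : forall c x y z, lie z (c *: x + y) = c *: lie z x + lie z y;
  lie_xx : forall x, lie x x = 0;
  lie_jacobi : forall x y z,
    lie x (lie y z) + lie y (lie z x) + lie z (lie x y) = 0
}.

#[short(type="lieAlgType")]
HB.structure Definition LieAlgebra (K : fieldType) :=
  {L of isLie K L & GRing.Lmodule K L}.

#[short(type="finLieAlgType")]
HB.structure Definition FinLieAlgebra (K : fieldType) :=
  {L of Vector K L & isLie K L}.

Section LieTheory.
Context {K : fieldType} {L : lieAlgType K}.
Implicit Types x y z : L.

Lemma lieDl x y z : lie (x + y) z = lie x z + lie y z.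
Proof. by have := lie_linl 1 x y z; rewrite !scale1r. Qed.
Lemma lieDr x y z : lie z (x + y) = lie z x + lie z y.
Proof. by have := lie_linr 1 x y z; rewrite !scale1r. Qed.
Lemma lie0l z : lie 0 z = 0.
Proof. by apply: (@addrI _ (lie 0 z)); rewrite -lieDl !addr0. Qed.
Lemma lie0r z : lie z 0 = 0.
Proof. by apply: (@addrI _ (lie z 0)); rewrite -lieDr !addr0. Qed.
Lemma lieZl c x z : lie (c *: x) z = c *: lie x z.
Proof. by have := lie_linl c x 0 z; rewrite lie0l !addr0. Qed.
Lemma lieZr c x z : lie z (c *: x) = c *: lie z x.
Proof. by have := lie_linr c x 0 z; rewrite lie0r !addr0. Qed.
Lemma lieNl x z : lie (- x) z = - lie x z.
Proof. by rewrite -scaleN1r lieZl scaleN1r. Qed.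
Lemma lieNr x z : lie z (- x) = - lie z x.
Proof. by rewrite -scaleN1r lieZr scaleN1r. Qed.
Lemma lieC x y : lie x y = - lie y x.
Proof.
have := lie_xx (x + y); rewrite lieDl !lieDr !lie_xx add0r addr0 => /eqP.
by rewrite addr_eq0 => /eqP.
Qed.

End LieTheory.

Record lieHom (K : fieldType) (L L' : lieAlgType K) := LieHom {
  lh_fun :> L -> L';
  lh_lin : forall c x y, lh_fun (c *: x + y) = c *: lh_fun x + lh_fun y;
  lh_lie : forall x y, lh_fun (lie x y) = lie (lh_fun x) (lh_fun y)
}.

Section LieHomTheory.
Context {K : fieldType} {L L' : lieAlgType K} (f : lieHom L L').

Lemma lhD x y : f (x + y) = f x + f y.
Proof. by have := lh_lin f 1 x y; rewrite !scale1r. Qed.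
Lemma lhZ c x : f (c *: x) = c *: f x.
Proof.
have f0 : f 0 = 0 by apply: (@addrI _ (f 0)); rewrite -lhD !addr0.
by have := lh_lin f c x 0; rewrite f0 !addr0.
Qed.

End LieHomTheory.

(* Tensor products over a possibly noncommutative ring, by generators (the pure
   tensors) and relations. *)

(* K-linear right S-module structures on M. *)
Record rightMod (K : fieldType) (S : pzRingType) (M : lmodType K) := RightMod {
  ract : M -> S -> M;
  ractDl : forall m m' s, ract (m + m') s = ract m s + ract m' s;
  ractDr : forall m s s', ract m (s + s') = ract m s + ract m s';
  ractA : forall m s s', ract (ract m s) s' = ract m (s * s');
  ract1 : forall m, ract m 1 = m;
  ractZ : forall c m s, ract (c *: m) s = c *: ract m s
}.

Section Tensor.
Context {K : fieldType} {S : pzRingType} {M : lmodType K}.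
Variables (r : rightMod S M) (N : lmodType S).

Inductive tterm : Type :=
  | TZero
  | TOpp of tterm
  | TAdd of tterm & tterm
  | TPure of M & N.

Inductive teq : tterm -> tterm -> Prop :=
  | teq_refl t : teq t t
  | teq_sym t t' : teq t t' -> teq t' t
  | teq_trans t t' t'' : teq t t' -> teq t' t'' -> teq t t''
  | teq_opp t t' : teq t t' -> teq (TOpp t) (TOpp t')
  | teq_add t t' u u' : teq t t' -> teq u u' -> teq (TAdd t u) (TAdd t' u')
  | teq_addA t u v : teq (TAdd t (TAdd u v)) (TAdd (TAdd t u) v)
  | teq_addC t u : teq (TAdd t u) (TAdd u t)
  | teq_add0 t : teq (TAdd TZero t) t
  | teq_addN t : teq (TAdd (TOpp t) t) TZero
  | teq_Dl m m' n : teq (TPure (m + m') n) (TAdd (TPure m n) (TPure m' n))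
  | teq_Dr m n n' : teq (TPure m (n + n')) (TAdd (TPure m n) (TPure m n'))
  | teq_bal m s n : teq (TPure (ract r m s) n) (TPure m (s *: n)).

HB.instance Definition _ := gen_eqMixin tterm.
HB.instance Definition _ := gen_choiceMixin tterm.

Definition teqb (t t' : tterm) : bool := `[< teq t t' >].

Lemma teqb_refl : reflexive teqb.
Proof. by move=> t; apply/asboolP; apply: teq_refl. Qed.
Lemma teqb_sym : symmetric teqb.
Proof.
by move=> t t'; apply/idP/idP => /asboolP h; apply/asboolP; apply: teq_sym.
Qed.
Lemma teqb_trans : transitive teqb.
Proof.
move=> t u v /asboolP h /asboolP h'; apply/asboolP.
exact: teq_trans h h'.
Qed.

Canonical teqb_equiv := EquivRel teqb teqb_refl teqb_sym teqb_trans.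

Definition tensor := {eq_quot teqb}.
HB.instance Definition _ := Choice.on tensor.

Definition tcls (t : tterm) : tensor := \pi_({eq_quot teqb}) t.

Lemma tclsP t t' : tcls t = tcls t' <-> teq t t'.
Proof.
split; first by move=> /eqmodP /asboolP.
by move=> h; apply/eqmodP/asboolP.
Qed.

Lemma tclsK (x : tensor) : tcls (repr x) = x.
Proof. exact: reprK. Qed.

Lemma trepr t : teq (repr (tcls t)) t.
Proof. by apply/tclsP; rewrite tclsK. Qed.

Definition tzero : tensor := tcls TZero.
Definition topp (x : tensor) : tensor := tcls (TOpp (repr x)).
Definition tadd (x y : tensor) : tensor := tcls (TAdd (repr x) (repr y)).

Lemma toppE t : topp (tcls t) = tcls (TOpp t).
Proof. by apply/tclsP; apply: teq_opp; apply: trepr. Qed.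
Lemma taddE t u : tadd (tcls t) (tcls u) = tcls (TAdd t u).
Proof. by apply/tclsP; apply: teq_add; apply: trepr. Qed.

Lemma taddA : associative tadd.
Proof.
move=> x y z; rewrite -(tclsK x) -(tclsK y) -(tclsK z) !taddE.
by apply/tclsP; apply: teq_addA.
Qed.
Lemma taddC : commutative tadd.
Proof.
move=> x y; rewrite -(tclsK x) -(tclsK y) !taddE.
by apply/tclsP; apply: teq_addC.
Qed.
Lemma tadd0 : left_id tzero tadd.
Proof. by move=> x; rewrite -(tclsK x) taddE; apply/tclsP; apply: teq_add0. Qed.
Lemma taddN : left_inverse tzero topp tadd.
Proof.
by move=> x; rewrite -(tclsK x) toppE taddE; apply/tclsP; apply: teq_addN.
Qed.

HB.instance Definition _ := GRing.isZmodule.Build tensor taddA taddC tadd0 taddN.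

Definition pure (m : M) (n : N) : tensor := tcls (TPure m n).

Lemma pureDl m m' n : pure (m + m') n = pure m n + pure m' n.
Proof. by rewrite /pure [RHS]taddE; apply/tclsP; apply: teq_Dl. Qed.
Lemma pureDr m n n' : pure m (n + n') = pure m n + pure m n'.
Proof. by rewrite /pure [RHS]taddE; apply/tclsP; apply: teq_Dr. Qed.
Lemma pure_bal m s n : pure (ract r m s) n = pure m (s *: n).
Proof. by apply/tclsP; apply: teq_bal. Qed.

Lemma tensor_ind (P : tensor -> Prop) :
    P 0 -> (forall x, P x -> P (- x)) -> (forall x y, P x -> P y -> P (x + y)) ->
    (forall m n, P (pure m n)) -> forall x, P x.
Proof.
move=> P0 PN PD PP x; rewrite -(tclsK x); move: (repr x) => {x}.
elim=> [|t IH|t IHt u IHu|m n]; first exact: P0.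
- by have := PN _ IH; rewrite [- _]toppE.
- by have := PD _ _ IHt IHu; rewrite [_ + _]taddE.
- exact: PP.
Qed.

Section Lift.
Variables (Z : zmodType) (f : M -> N -> Z).
Hypothesis fDl : forall m m' n, f (m + m') n = f m n + f m' n.
Hypothesis fDr : forall m n n', f m (n + n') = f m n + f m n'.
Hypothesis fB : forall m s n, f (ract r m s) n = f m (s *: n).

Fixpoint teval (t : tterm) : Z :=
  match t with
  | TZero => 0
  | TOpp t => - teval t
  | TAdd t u => teval t + teval u
  | TPure m n => f m n
  end.

Definition tlift (x : tensor) : Z := teval (repr x).

Lemma teval_teq t t' : teq t t' -> teval t = teval t'.
Proof.
elim=> //=.
- by move=> ? ? ? _ -> _ ->.
- by move=> ? ? _ ->.
- by move=> ? ? ? ? _ -> _ ->.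
- by move=> *; rewrite addrA.
- by move=> *; rewrite addrC.
- by move=> *; rewrite add0r.
- by move=> *; rewrite addNr.
Qed.

Lemma tliftE t : tlift (tcls t) = teval t.
Proof. by apply: teval_teq; apply: trepr. Qed.
Lemma tlift_pure m n : tlift (pure m n) = f m n.
Proof. exact: tliftE. Qed.
Lemma tliftD x y : tlift (x + y) = tlift x + tlift y.
Proof. by rewrite -(tclsK x) -(tclsK y) [tcls _ + _]taddE !tliftE. Qed.
Lemma tlift0 : tlift 0 = 0.
Proof. exact: tliftE. Qed.
Lemma tliftN x : tlift (- x) = - tlift x.
Proof. by rewrite -(tclsK x) [- tcls _]toppE !tliftE. Qed.
End Lift.

Lemma tlift_ext (Z : zmodType) (f g : M -> N -> Z) x :
  (forall m n, f m n = g m n) -> tlift f x = tlift g x.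
Proof.
by move=> fg; rewrite /tlift; elim: (repr x) => //= [t ->|t -> u ->].
Qed.

Lemma pure0l n : pure 0 n = 0.
Proof. by apply: (@addrI _ (pure 0 n)); rewrite -pureDl !addr0. Qed.
Lemma pure0r m : pure m 0 = 0.
Proof. by apply: (@addrI _ (pure m 0)); rewrite -pureDr !addr0. Qed.
Lemma pureNl m n : pure (- m) n = - pure m n.
Proof. by apply/eqP; rewrite -addr_eq0 -pureDl addNr pure0l. Qed.

(* The endomorphism f (x) 1 for f : M -> M commuting with the action of S. *)
Section TmapL.
Variable f : M -> M.
Hypothesis fD : forall m m', f (m + m') = f m + f m'.
Hypothesis fS : forall m s, f (ract r m s) = ract r (f m) s.
Definition tmapl : tensor -> tensor := tlift (fun m n => pure (f m) n).

Lemma tmapl_bal m s n : pure (f (ract r m s)) n = pure (f m) (s *: n).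
Proof. by rewrite fS pure_bal. Qed.
Lemma tmapl_pure m n : tmapl (pure m n) = pure (f m) n.
Proof.
apply: tlift_pure => [*|*|*]; [by rewrite fD pureDl|by rewrite pureDr|].
exact: tmapl_bal.
Qed.
Lemma tmaplD x y : tmapl (x + y) = tmapl x + tmapl y.
Proof.
apply: tliftD => [*|*|*]; [by rewrite fD pureDl|by rewrite pureDr|].
exact: tmapl_bal.
Qed.
Lemma tmaplN x : tmapl (- x) = - tmapl x.
Proof.
apply: tliftN => [*|*|*]; [by rewrite fD pureDl|by rewrite pureDr|].
exact: tmapl_bal.
Qed.
Lemma tmapl0 : tmapl 0 = 0.
Proof.
apply: tlift0 => [*|*|*]; [by rewrite fD pureDl|by rewrite pureDr|].
exact: tmapl_bal.
Qed.
End TmapL.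

Definition tscale (c : K) : tensor -> tensor := tmapl ( *:%R c).

Lemma scale_ract c m s : c *: ract r m s = ract r (c *: m) s.
Proof. by rewrite ractZ. Qed.

Definition tscale_pure c := tmapl_pure (scalerDr c) (scale_ract c).
Definition tscaleD c := tmaplD (scalerDr c) (scale_ract c).
Definition tscaleN c := tmaplN (scalerDr c) (scale_ract c).
Definition tscale0 c := tmapl0 (scalerDr c) (scale_ract c).

Lemma tscaleA a b v : tscale a (tscale b v) = tscale (a * b) v.
Proof.
elim/tensor_ind: v => [|x IH|x y IHx IHy|m n].
- by rewrite /tscale !tscale0.
- by rewrite /tscale !tscaleN [X in - X]IH.
- by rewrite /tscale !tscaleD [X in X + _]IHx [X in _ + X]IHy.
- by rewrite /tscale !tscale_pure scalerA.
Qed.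
Lemma tscale1 : left_id 1 tscale.
Proof.
elim/tensor_ind=> [|x IH|x y IHx IHy|m n].
- by rewrite /tscale !tscale0.
- by rewrite /tscale !tscaleN [X in - X]IH.
- by rewrite /tscale !tscaleD [X in X + _]IHx [X in _ + X]IHy.
- by rewrite /tscale !tscale_pure scale1r.
Qed.
Lemma tscaleDr : right_distributive tscale +%R.
Proof. by move=> c x y; apply: tscaleD. Qed.
Lemma tscaleDl v : {morph tscale^~ v : a b / a + b}.
Proof.
move=> a b; elim/tensor_ind: v => [|x IH|x y IHx IHy|m n].
- by rewrite /tscale !tscale0 addr0.
- by rewrite /tscale !tscaleN [X in - X]IH opprD.
- by rewrite /tscale !tscaleD [X in X + _]IHx [X in _ + X]IHy addrACA.
- by rewrite /tscale !tscale_pure scalerDl pureDl.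
Qed.

HB.instance Definition _ := GRing.Zmodule_isLmodule.Build K tensor
  tscaleA tscale1 tscaleDr tscaleDl.

Lemma pureZl c m n : pure (c *: m) n = c *: pure m n.
Proof. by rewrite [RHS]tscale_pure. Qed.

Lemma tmapl_linear (f : M -> M) (fD : forall m m', f (m + m') = f m + f m')
    (fS : forall m s, f (ract r m s) = ract r (f m) s)
    (fZ : forall c m, f (c *: m) = c *: f m) c x y :
  tmapl f (c *: x + y) = c *: tmapl f x + tmapl f y.
Proof.
rewrite tmaplD //; congr (_ + _).
elim/tensor_ind: x => [|x IH|x z IHx IHz|m n].
- by rewrite scaler0 tmapl0 // scaler0.
- by rewrite scalerN !tmaplN // scalerN IH.
- by rewrite scalerDr !tmaplD // scalerDr IHx IHz.
- by rewrite -pureZl !tmapl_pure // -pureZl fZ.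
Qed.

End Tensor.

Section CurrentAlgebra.
Context {K : fieldType}.

Definition scale_right (L : lmodType K) : rightMod K L.
Proof.
exists (fun (m : L) (c : K) => c *: m).
- by move=> *; rewrite scalerDr.
- by move=> *; rewrite scalerDl.
- by move=> *; rewrite scalerA mulrC.
- by move=> *; rewrite scale1r.
- by move=> c m s; rewrite !scalerA mulrC.
Defined.

Variables (L : lieAlgType K) (A : comAlgType K).

Definition lieTensor := tensor (scale_right L) A.
HB.instance Definition _ := GRing.Lmodule.on lieTensor.

Definition ltens (x : L) (a : A) : lieTensor := pure (scale_right L) x a.

Definition tlie1 (x : L) (a : A) : lieTensor -> lieTensor :=
  tlift (fun y b => ltens (lie x y) (a * b)).

(* [x (x) a, y (x) b] = [x, y] (x) ab, extended bilinearly. *)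
Definition tlie (s t : lieTensor) : lieTensor := tlift (fun x a => tlie1 x a t) s.

Lemma tlie1_axioms x a :
  [/\ forall m m' n, ltens (lie x (m + m')) (a * n)
          = ltens (lie x m) (a * n) + ltens (lie x m') (a * n),
      forall m n n', ltens (lie x m) (a * (n + n'))
          = ltens (lie x m) (a * n) + ltens (lie x m) (a * n') &
      forall m s n, ltens (lie x (ract (scale_right L) m s)) (a * n)
          = ltens (lie x m) (a * (s *: n))].
Proof.
split=> [m m' n|m n n'|m s n]; first by rewrite lieDr /ltens pureDl.
  by rewrite mulrDr /ltens pureDr.
by rewrite /= lieZr -scalerAr /ltens -pure_bal.
Qed.

Lemma tlie1_pure x a y b : tlie1 x a (ltens y b) = ltens (lie x y) (a * b).
Proof. by have [? ? ?] := tlie1_axioms x a; apply: tlift_pure. Qed.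
Lemma tlie1D x a s t : tlie1 x a (s + t) = tlie1 x a s + tlie1 x a t.
Proof. by have [? ? ?] := tlie1_axioms x a; apply: tliftD. Qed.
Lemma tlie1N x a s : tlie1 x a (- s) = - tlie1 x a s.
Proof. by have [? ? ?] := tlie1_axioms x a; apply: tliftN. Qed.
Lemma tlie10 x a : tlie1 x a 0 = 0.
Proof. by have [? ? ?] := tlie1_axioms x a; apply: tlift0. Qed.

Lemma ltens_ind (P : lieTensor -> Prop) :
    P 0 -> (forall x, P x -> P (- x)) -> (forall x y, P x -> P y -> P (x + y)) ->
    (forall m n, P (ltens m n)) -> forall x, P x.
Proof. exact: tensor_ind. Qed.

Lemma tlie_axioms t :
  [/\ forall m m' n, tlie1 (m + m') n t = tlie1 m n t + tlie1 m' n t,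
      forall m n n', tlie1 m (n + n') t = tlie1 m n t + tlie1 m n' t &
      forall m s n, tlie1 (ract (scale_right L) m s) n t = tlie1 m (s *: n) t].
Proof.
split=> [m m' n|m n n'|m s n]; elim/ltens_ind: t => [|u IH|u v IHu IHv|y b];
  rewrite ?tlie10 ?addr0 //.
- by rewrite !tlie1N IH opprD.
- by rewrite !tlie1D IHu IHv addrACA.
- by rewrite !tlie1_pure lieDl /ltens pureDl.
- by rewrite !tlie1N IH opprD.
- by rewrite !tlie1D IHu IHv addrACA.
- by rewrite !tlie1_pure mulrDl /ltens pureDr.
- by rewrite !tlie1N IH.
- by rewrite !tlie1D IHu IHv.
- by rewrite !tlie1_pure /= lieZl -scalerAl /ltens -pure_bal.
Qed.

Lemma tlie_pure x a y b :
  tlie (ltens x a) (ltens y b) = ltens (lie x y) (a * b).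
Proof.
have [? ? ?] := tlie_axioms (ltens y b).
rewrite -tlie1_pure; exact: (@tlift_pure _ _ _ _ _ _ (fun m n => tlie1 m n _)).
Qed.
Lemma tlieDl s s' t : tlie (s + s') t = tlie s t + tlie s' t.
Proof. by have [? ? ?] := tlie_axioms t; apply: tliftD. Qed.
Lemma tlieNl s t : tlie (- s) t = - tlie s t.
Proof. by have [? ? ?] := tlie_axioms t; apply: tliftN. Qed.
Lemma tlie0l t : tlie 0 t = 0.
Proof. by have [? ? ?] := tlie_axioms t; apply: tlift0. Qed.
Lemma tlie_purel x a t : tlie (ltens x a) t = tlie1 x a t.
Proof.
by have [? ? ?] := tlie_axioms t;
  apply: (@tlift_pure _ _ _ _ _ _ (fun m n => tlie1 m n _)).
Qed.
Lemma tlieDr s t t' : tlie s (t + t') = tlie s t + tlie s t'.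
Proof.
elim/ltens_ind: s => [|u IH|u v IHu IHv|y b].
- by rewrite !tlie0l addr0.
- by rewrite !tlieNl IH opprD.
- by rewrite !tlieDl IHu IHv addrACA.
- by rewrite !tlie_purel tlie1D.
Qed.
Lemma tlieNr s t : tlie s (- t) = - tlie s t.
Proof.
elim/ltens_ind: s => [|u IH|u v IHu IHv|y b].
- by rewrite !tlie0l oppr0.
- by rewrite !tlieNl IH.
- by rewrite !tlieDl IHu IHv opprD.
- by rewrite !tlie_purel tlie1N.
Qed.
Lemma tlie0r s : tlie s 0 = 0.
Proof. by apply: (@addrI _ (tlie s 0)); rewrite -tlieDr !addr0. Qed.

Lemma ltensZ c x a : ltens (c *: x) a = c *: ltens x a.
Proof. exact: pureZl. Qed.

Lemma tlieZl c s t : tlie (c *: s) t = c *: tlie s t.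
Proof.
elim/ltens_ind: s => [|u IH|u v IHu IHv|y b].
- by rewrite scaler0 tlie0l scaler0.
- by rewrite scalerN !tlieNl scalerN IH.
- by rewrite scalerDr !tlieDl scalerDr IHu IHv.
elim/ltens_ind: t => [|u IH|u v IHu IHv|z d].
- by rewrite !tlie0r scaler0.
- by rewrite !tlieNr scalerN IH.
- by rewrite !tlieDr scalerDr IHu IHv.
- by rewrite -ltensZ !tlie_pure lieZl ltensZ.
Qed.

Lemma tlieC s t : tlie s t = - tlie t s.
Proof.
elim/ltens_ind: s => [|u IH|u v IHu IHv|y b].
- by rewrite tlie0l tlie0r oppr0.
- by rewrite tlieNl tlieNr IH.
- by rewrite tlieDl tlieDr IHu IHv opprD.
elim/ltens_ind: t => [|u IH|u v IHu IHv|z d].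
- by rewrite tlie0l tlie0r oppr0.
- by rewrite tlieNl tlieNr IH.
- by rewrite tlieDl tlieDr IHu IHv opprD.
- by rewrite !tlie_pure lieC mulrC /ltens pureNl.
Qed.

Lemma tlie_linl c s t u : tlie (c *: s + t) u = c *: tlie s u + tlie t u.
Proof. by rewrite tlieDl tlieZl. Qed.
Lemma tlie_linr c s t u : tlie u (c *: s + t) = c *: tlie u s + tlie u t.
Proof. by rewrite tlieC tlie_linl opprD -scalerN -!tlieC. Qed.

Lemma tlie_xx s : tlie s s = 0.
Proof.
elim/ltens_ind: s => [|u IH|u v IHu IHv|y b].
- by rewrite tlie0l.
- by rewrite tlieNl tlieNr opprK.
- by rewrite tlieDl !tlieDr IHu IHv add0r addr0 (tlieC u) addNr.
- by rewrite tlie_pure lie_xx /ltens pure0l.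
Qed.

Lemma tlie_jacobi s t u :
  tlie s (tlie t u) + tlie t (tlie u s) + tlie u (tlie s t) = 0.
Proof.
have addr3 (W : zmodType) (a b c a' b' c' : W) :
    a + b + c = 0 -> a' + b' + c' = 0 -> (a + a') + (b + b') + (c + c') = 0.
  by move=> h h'; rewrite (addrACA a) (addrACA (a + b)) h h' addr0.
have oppr3 (W : zmodType) (a b c : W) : a + b + c = 0 -> - a + - b + - c = 0.
  by move=> h; rewrite -!opprD h oppr0.
elim/ltens_ind: s => [|s IH|s s' IHs IHs'|x a].
- by rewrite !(tlie0l, tlie0r) !addr0.
- by rewrite !(tlieNl, tlieNr); apply: oppr3.
- by rewrite !(tlieDl, tlieDr); apply: addr3.
elim/ltens_ind: t => [|s IH|s s' IHs IHs'|y b].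
- by rewrite !(tlie0l, tlie0r) !addr0.
- by rewrite !(tlieNl, tlieNr); apply: oppr3.
- by rewrite !(tlieDl, tlieDr); apply: addr3.
elim/ltens_ind: u => [|s IH|s s' IHs IHs'|z c].
- by rewrite !(tlie0l, tlie0r) !addr0.
- by rewrite !(tlieNl, tlieNr); apply: oppr3.
- by rewrite !(tlieDl, tlieDr); apply: addr3.
rewrite !tlie_pure (_ : b * (c * a) = a * (b * c)); last first.
  by rewrite mulrA mulrC.
rewrite (_ : c * (a * b) = a * (b * c)); last by rewrite mulrC mulrA.
by rewrite /ltens -!pureDl lie_jacobi pure0l.
Qed.

HB.instance Definition _ := isLie.Build K lieTensor
  tlie_linl tlie_linr tlie_xx tlie_jacobi.

Definition cur_emb : lieHom L lieTensor.
Proof.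
exists (fun x => ltens x 1).
- by move=> c x y; rewrite -ltensZ /ltens pureDl.
- by move=> x y; rewrite [RHS]tlie_pure mulr1.
Defined.

End CurrentAlgebra.

Section CurrentMap.
Context {K : fieldType} {L L' : lieAlgType K} (f : lieHom L L') (A : comAlgType K).

Definition cur_fun (t : lieTensor L A) : lieTensor L' A :=
  tlift (fun x a => ltens (f x) a) t.

Lemma cur_axioms :
  [/\ forall m m' n, ltens (f (m + m')) n = ltens (f m) n + ltens (f m') n :> lieTensor L' A,
      forall m n n', ltens (f m) (n + n') = ltens (f m) n + ltens (f m) n' :> lieTensor L' A &
      forall m s n, ltens (f (ract (scale_right L) m s)) n
                    = ltens (f m) (s *: n) :> lieTensor L' A].
Proof.
split=> [m m' n|m n n'|m s n]; first by rewrite lhD /ltens pureDl.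
  by rewrite /ltens pureDr.
by rewrite /= lhZ /ltens -pure_bal.
Qed.

Lemma cur_pure x a : cur_fun (ltens x a) = ltens (f x) a.
Proof.
have [? ? ?] := cur_axioms.
exact: (@tlift_pure _ _ _ _ _ _ (fun m n => ltens (f m) n)).
Qed.
Lemma cur_funD x y : cur_fun (x + y) = cur_fun x + cur_fun y.
Proof. by have [? ? ?] := cur_axioms; apply: tliftD. Qed.
Lemma cur_funN x : cur_fun (- x) = - cur_fun x.
Proof. by have [? ? ?] := cur_axioms; apply: tliftN. Qed.
Lemma cur_fun0 : cur_fun 0 = 0.
Proof. by have [? ? ?] := cur_axioms; apply: tlift0. Qed.

Definition cur_map : lieHom (lieTensor L A) (lieTensor L' A).
Proof.
exists cur_fun.
- move=> c x y; rewrite cur_funD; congr (_ + _).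
  elim/(@ltens_ind K L A): x => [|u IH|u v IHu IHv|z b].
  + by rewrite scaler0 cur_fun0 scaler0.
  + by rewrite scalerN !cur_funN scalerN IH.
  + by rewrite scalerDr !cur_funD scalerDr IHu IHv.
  + by rewrite -ltensZ !cur_pure lhZ ltensZ.
- move=> x y; elim/(@ltens_ind K L A): x => [|u IH|u v IHu IHv|z b].
  + by rewrite lie0l cur_fun0 lie0l.
  + by rewrite lieNl !cur_funN lieNl IH.
  + by rewrite lieDl !cur_funD lieDl IHu IHv.
  elim/(@ltens_ind K L A): y => [|u IH|u v IHu IHv|t a].
  + by rewrite lie0r cur_fun0 lie0r.
  + by rewrite lieNr !cur_funN lieNr IH.
  + by rewrite lieDr !cur_funD lieDr IHu IHv.
  + by rewrite [lie (ltens _ _) _]tlie_pure !cur_pure [RHS]tlie_pure lh_lie.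
Defined.

End CurrentMap.

(* The enveloping algebra U(L): the unital associative K-algebra with generators
   the elements of L, subject to K-linearity and [x, y] = xy - yx. *)
Section Enveloping.
Context {K : fieldType}.
Variable L : lieAlgType K.

Inductive uterm : Type :=
  | UGen of L
  | UCst of K
  | UAdd of uterm & uterm
  | UMul of uterm & uterm.

Inductive ueq : uterm -> uterm -> Prop :=
  | ueq_refl t : ueq t t
  | ueq_sym t t' : ueq t t' -> ueq t' t
  | ueq_trans t t' t'' : ueq t t' -> ueq t' t'' -> ueq t t''
  | ueq_add t t' u u' : ueq t t' -> ueq u u' -> ueq (UAdd t u) (UAdd t' u')
  | ueq_mul t t' u u' : ueq t t' -> ueq u u' -> ueq (UMul t u) (UMul t' u')
  | ueq_addA t u v : ueq (UAdd t (UAdd u v)) (UAdd (UAdd t u) v)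
  | ueq_addC t u : ueq (UAdd t u) (UAdd u t)
  | ueq_add0 t : ueq (UAdd (UCst 0) t) t
  | ueq_mulA t u v : ueq (UMul t (UMul u v)) (UMul (UMul t u) v)
  | ueq_mul0 t : ueq (UMul (UCst 0) t) (UCst 0)
  | ueq_mul1l t : ueq (UMul (UCst 1) t) t
  | ueq_mul1r t : ueq (UMul t (UCst 1)) t
  | ueq_mulDl t u v : ueq (UMul (UAdd t u) v) (UAdd (UMul t v) (UMul u v))
  | ueq_mulDr t u v : ueq (UMul t (UAdd u v)) (UAdd (UMul t u) (UMul t v))
  | ueq_cstD c d : ueq (UCst (c + d)) (UAdd (UCst c) (UCst d))
  | ueq_cstM c d : ueq (UCst (c * d)) (UMul (UCst c) (UCst d))
  | ueq_cstC c t : ueq (UMul (UCst c) t) (UMul t (UCst c))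
  | ueq_genlin c x y :
      ueq (UGen (c *: x + y)) (UAdd (UMul (UCst c) (UGen x)) (UGen y))
  | ueq_lie x y :
      ueq (UGen (lie x y))
          (UAdd (UMul (UGen x) (UGen y))
                (UMul (UCst (-1)) (UMul (UGen y) (UGen x)))).

HB.instance Definition _ := gen_eqMixin uterm.
HB.instance Definition _ := gen_choiceMixin uterm.

Definition ueqb (t t' : uterm) : bool := `[< ueq t t' >].

Lemma ueqb_refl : reflexive ueqb.
Proof. by move=> t; apply/asboolP; apply: ueq_refl. Qed.
Lemma ueqb_sym : symmetric ueqb.
Proof.
by move=> t t'; apply/idP/idP => /asboolP h; apply/asboolP; apply: ueq_sym.
Qed.
Lemma ueqb_trans : transitive ueqb.
Proof.
move=> t u v /asboolP h /asboolP h'; apply/asboolP.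
exact: ueq_trans h h'.
Qed.

Canonical ueqb_equiv := EquivRel ueqb ueqb_refl ueqb_sym ueqb_trans.

Definition envel := {eq_quot ueqb}.
HB.instance Definition _ := Choice.on envel.

Definition ucls (t : uterm) : envel := \pi_({eq_quot ueqb}) t.

Lemma uclsP t t' : ucls t = ucls t' <-> ueq t t'.
Proof.
split; first by move=> /eqmodP /asboolP.
by move=> h; apply/eqmodP/asboolP.
Qed.
Lemma uclsK (x : envel) : ucls (repr x) = x.
Proof. exact: reprK. Qed.
Lemma urepr t : ueq (repr (ucls t)) t.
Proof. by apply/uclsP; rewrite uclsK. Qed.

Definition uadd (x y : envel) : envel := ucls (UAdd (repr x) (repr y)).
Definition umul (x y : envel) : envel := ucls (UMul (repr x) (repr y)).
Definition ucst (c : K) : envel := ucls (UCst c).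
Definition uopp (x : envel) : envel := umul (ucst (-1)) x.
Definition uscale (c : K) (x : envel) : envel := umul (ucst c) x.

Lemma uaddE t u : uadd (ucls t) (ucls u) = ucls (UAdd t u).
Proof. by apply/uclsP; apply: ueq_add; apply: urepr. Qed.
Lemma umulE t u : umul (ucls t) (ucls u) = ucls (UMul t u).
Proof. by apply/uclsP; apply: ueq_mul; apply: urepr. Qed.

Lemma uaddA : associative uadd.
Proof.
move=> x y z; rewrite -(uclsK x) -(uclsK y) -(uclsK z) !uaddE.
by apply/uclsP; apply: ueq_addA.
Qed.
Lemma uaddC : commutative uadd.
Proof.
move=> x y; rewrite -(uclsK x) -(uclsK y) !uaddE.
by apply/uclsP; apply: ueq_addC.
Qed.
Lemma uadd0 : left_id (ucst 0) uadd.
Proof. by move=> x; rewrite -(uclsK x) uaddE; apply/uclsP; apply: ueq_add0. Qed.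
Lemma umulA : associative umul.
Proof.
move=> x y z; rewrite -(uclsK x) -(uclsK y) -(uclsK z) !umulE.
by apply/uclsP; apply: ueq_mulA.
Qed.
Lemma umul1l : left_id (ucst 1) umul.
Proof. by move=> x; rewrite -(uclsK x) umulE; apply/uclsP; apply: ueq_mul1l. Qed.
Lemma umul1r : right_id (ucst 1) umul.
Proof. by move=> x; rewrite -(uclsK x) umulE; apply/uclsP; apply: ueq_mul1r. Qed.
Lemma umul0l x : umul (ucst 0) x = ucst 0.
Proof. by rewrite -(uclsK x) umulE; apply/uclsP; apply: ueq_mul0. Qed.
Lemma umulDl : left_distributive umul uadd.
Proof.
move=> x y z; rewrite -(uclsK x) -(uclsK y) -(uclsK z).
rewrite uaddE !umulE uaddE; by apply/uclsP; apply: ueq_mulDl.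
Qed.
Lemma umulDr : right_distributive umul uadd.
Proof.
move=> x y z; rewrite -(uclsK x) -(uclsK y) -(uclsK z).
rewrite uaddE !umulE uaddE; by apply/uclsP; apply: ueq_mulDr.
Qed.
Lemma ucstD c d : ucst (c + d) = uadd (ucst c) (ucst d).
Proof. by rewrite uaddE; apply/uclsP; apply: ueq_cstD. Qed.
Lemma ucstM c d : ucst (c * d) = umul (ucst c) (ucst d).
Proof. by rewrite umulE; apply/uclsP; apply: ueq_cstM. Qed.
Lemma ucstC c x : umul (ucst c) x = umul x (ucst c).
Proof. by rewrite -(uclsK x) !umulE; apply/uclsP; apply: ueq_cstC. Qed.
Lemma uaddN : left_inverse (ucst 0) uopp uadd.
Proof.
move=> x; rewrite /uopp -{2}(umul1l x) -umulDl -ucstD addNr.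
exact: umul0l.
Qed.

HB.instance Definition _ := GRing.isZmodule.Build envel uaddA uaddC uadd0 uaddN.

(* The augmentation, used only to see that 1 <> 0. *)
Fixpoint uaug (t : uterm) : K :=
  match t with
  | UGen _ => 0
  | UCst c => c
  | UAdd t u => uaug t + uaug u
  | UMul t u => uaug t * uaug u
  end.

Lemma uaug_ueq t t' : ueq t t' -> uaug t = uaug t'.
Proof.
elim=> //=.
- by move=> ? ? ? _ -> _ ->.
- by move=> ? ? ? ? _ -> _ ->.
- by move=> ? ? ? ? _ -> _ ->.
- by move=> *; rewrite addrA.
- by move=> *; rewrite addrC.
- by move=> *; rewrite add0r.
- by move=> *; rewrite mulrA.
- by move=> *; rewrite mul0r.
- by move=> *; rewrite mul1r.
- by move=> *; rewrite mulr1.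
- by move=> *; rewrite mulrDl.
- by move=> *; rewrite mulrDr.
- by move=> *; rewrite mulrC.
- by move=> *; rewrite mulr0 addr0.
- by move=> *; rewrite !mulr0 addr0.
Qed.

Lemma ucst1_neq0 : ucst 1 != 0.
Proof.
by apply/eqP => /uclsP /uaug_ueq /= /eqP; rewrite oner_eq0.
Qed.

HB.instance Definition _ := GRing.Zmodule_isNzRing.Build envel
  umulA umul1l umul1r umulDl umulDr ucst1_neq0.

Lemma uscaleA a b v : uscale a (uscale b v) = uscale (a * b) v.
Proof. by rewrite /uscale umulA ucstM. Qed.
Lemma uscale1 : left_id 1 uscale.
Proof. exact: umul1l. Qed.
Lemma uscaleDr : right_distributive uscale +%R.
Proof. by move=> c x y; apply: umulDr. Qed.
Lemma uscaleDl v : {morph uscale^~ v : a b / a + b}.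
Proof. by move=> a b; rewrite /uscale ucstD; apply: umulDl. Qed.

HB.instance Definition _ := GRing.Zmodule_isLmodule.Build K envel
  uscaleA uscale1 uscaleDr uscaleDl.

Lemma uscaleAl (c : K) (u v : envel) : c *: (u * v) = c *: u * v.
Proof. exact: umulA. Qed.
Lemma uscaleAr (c : K) (u v : envel) : c *: (u * v) = u * (c *: v).
Proof.
rewrite /GRing.scale /= /uscale; rewrite [LHS]umulA ucstC.
by rewrite -[LHS]umulA.
Qed.

HB.instance Definition _ := GRing.Lmodule_isLalgebra.Build K envel uscaleAl.
HB.instance Definition _ := GRing.Lalgebra_isAlgebra.Build K envel uscaleAr.

Definition ugen (x : L) : envel := ucls (UGen x).

Lemma ucstE c : ucst c = c%:A :> envel.
Proof. by rewrite -[LHS]umul1r. Qed.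
Lemma uclsZ c t : c *: ucls t = ucls (UMul (UCst c) t).
Proof. exact: umulE. Qed.
Lemma uclsM t u : ucls t * ucls u = ucls (UMul t u).
Proof. exact: umulE. Qed.
Lemma uclsD t u : ucls t + ucls u = ucls (UAdd t u).
Proof. exact: uaddE. Qed.
Lemma ugen_lin c x y : ugen (c *: x + y) = c *: ugen x + ugen y.
Proof.
by rewrite /ugen uclsZ uclsD; apply/uclsP; apply: ueq_genlin.
Qed.
Lemma ugen_lie x y : ugen (lie x y) = ugen x * ugen y - ugen y * ugen x.
Proof.
rewrite -scaleN1r /ugen !uclsM uclsZ uclsD.
by apply/uclsP; apply: ueq_lie.
Qed.
Lemma ugen0 : ugen 0 = 0.
Proof. by have := ugen_lin (-1) 0 0; rewrite scaler0 addr0 scaleN1r addNr. Qed.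

Lemma envel_ind (P : envel -> Prop) :
    (forall c, P (c%:A)) -> (forall x, P (ugen x)) ->
    (forall u v, P u -> P v -> P (u + v)) ->
    (forall u v, P u -> P v -> P (u * v)) -> forall u, P u.
Proof.
move=> Pc Pg PD PM u; rewrite -(uclsK u); elim: (repr u) => {u}.
- exact: Pg.
- by move=> c; have := Pc c; rewrite -ucstE.
- by move=> t IHt u IHu; have := PD _ _ IHt IHu; rewrite uclsD.
- by move=> t IHt u IHu; have := PM _ _ IHt IHu; rewrite [_ * _]umulE.
Qed.

End Enveloping.

Section EnvelMap.
Context {K : fieldType} {L L' : lieAlgType K}.
Variable f : lieHom L L'.

Fixpoint umap_term (t : uterm L) : uterm L' :=
  match t with
  | UGen x => UGen (f x)
  | UCst c => UCst L' c
  | UAdd t u => UAdd (umap_term t) (umap_term u)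
  | UMul t u => UMul (umap_term t) (umap_term u)
  end.

Lemma umap_ueq t t' : ueq t t' -> ueq (umap_term t) (umap_term t').
Proof.
elim=> /=.
- by move=> *; apply: ueq_refl.
- by move=> *; apply: ueq_sym.
- by move=> ? u ? _ h _ h'; apply: ueq_trans h h'.
- by move=> *; apply: ueq_add.
- by move=> *; apply: ueq_mul.
- by move=> *; apply: ueq_addA.
- by move=> *; apply: ueq_addC.
- by move=> *; apply: ueq_add0.
- by move=> *; apply: ueq_mulA.
- by move=> *; apply: ueq_mul0.
- by move=> *; apply: ueq_mul1l.
- by move=> *; apply: ueq_mul1r.
- by move=> *; apply: ueq_mulDl.
- by move=> *; apply: ueq_mulDr.
- by move=> *; apply: ueq_cstD.
- by move=> *; apply: ueq_cstM.
- by move=> *; apply: ueq_cstC.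
- by move=> *; rewrite lh_lin; apply: ueq_genlin.
- by move=> *; rewrite lh_lie; apply: ueq_lie.
Qed.

Definition umap (u : envel L) : envel L' := ucls (umap_term (repr u)).

Lemma umapE t : umap (ucls t) = ucls (umap_term t).
Proof. by apply/uclsP; apply: umap_ueq; apply: urepr. Qed.

Lemma umapD u v : umap (u + v) = umap u + umap v.
Proof.
by rewrite -(uclsK u) -(uclsK v) uclsD !umapE -uclsD.
Qed.
Lemma umapM u v : umap (u * v) = umap u * umap v.
Proof.
by rewrite -(uclsK u) -(uclsK v) uclsM !umapE -uclsM.
Qed.
Lemma umap_cst c : umap c%:A = c%:A.
Proof. by rewrite -!ucstE umapE. Qed.
Lemma umap1 : umap 1 = 1.
Proof. exact: umapE. Qed.
Lemma umap0 : umap 0 = 0.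
Proof. exact: umapE. Qed.
Lemma umap_gen x : umap (ugen x) = ugen (f x).
Proof. exact: umapE. Qed.
Lemma umapN u : umap (- u) = - umap u.
Proof. by apply/eqP; rewrite -addr_eq0 -umapD addNr umap0. Qed.

End EnvelMap.

Record lieMod (K : fieldType) (L : lieAlgType K) := LieMod {
  lm_car :> lmodType K;
  lact : L -> lm_car -> lm_car;
  lact_linl : forall c x y v, lact (c *: x + y) v = c *: lact x v + lact y v;
  lact_linr : forall c x u v, lact x (c *: u + v) = c *: lact x u + lact x v;
  lact_lie : forall x y v,
    lact (lie x y) v = lact x (lact y v) - lact y (lact x v)
}.

Record lmHom (K : fieldType) (L : lieAlgType K) (V W : lieMod L) := LmHom {
  lmh_fun :> V -> W;
  lmh_lin : forall c u v, lmh_fun (c *: u + v) = c *: lmh_fun u + lmh_fun v;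
  lmh_act : forall x v, lmh_fun (lact x v) = lact x (lmh_fun v)
}.

Definition lm_iso (K : fieldType) (L : lieAlgType K) (V W : lieMod L) : Prop :=
  exists f : lmHom V W, bijective f.

Section LieModTheory.
Context {K : fieldType} {L : lieAlgType K} {V : lieMod L}.
Implicit Types (x : L) (v : V).

Lemma lactDr x u v : lact x (u + v) = lact x u + lact x v.
Proof. by have := lact_linr 1 x u v; rewrite !scale1r. Qed.
Lemma lact0r x : lact x (0 : V) = 0.
Proof. by apply: (@addrI _ (lact x 0)); rewrite -lactDr !addr0. Qed.
Lemma lactZr c x v : lact x (c *: v) = c *: lact x v.
Proof. by have := lact_linr c x v 0; rewrite lact0r !addr0. Qed.
Lemma lactNr x v : lact x (- v) = - lact x v.
Proof. by rewrite -[- v]scaleN1r lactZr scaleN1r. Qed.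
Lemma lactDl x y v : lact (x + y) v = lact x v + lact y v.
Proof. by have := lact_linl 1 x y v; rewrite !scale1r. Qed.
Lemma lact0l v : lact 0 v = 0.
Proof. by apply: (@addrI _ (lact 0 v)); rewrite -lactDl !addr0. Qed.
Lemma lactZl c x v : lact (c *: x) v = c *: lact x v.
Proof. by have := lact_linl c x 0 v; rewrite lact0l !addr0. Qed.
Lemma lactNl x v : lact (- x) v = - lact x v.
Proof. by rewrite -[- x]scaleN1r lactZl scaleN1r. Qed.

Fixpoint uact_term (t : uterm L) (v : V) : V :=
  match t with
  | UGen x => lact x v
  | UCst c => c *: v
  | UAdd t u => uact_term t v + uact_term u v
  | UMul t u => uact_term t (uact_term u v)
  end.

Lemma uact_term_lin t c u v :
  uact_term t (c *: u + v) = c *: uact_term t u + uact_term t v.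
Proof.
elim: t u v => /= [x|d|s IHs t IHt|s IHs t IHt] u v.
- exact: lact_linr.
- by rewrite scalerDr !scalerA mulrC.
- by rewrite IHs IHt scalerDr addrACA.
- by rewrite IHt IHs.
Qed.
Lemma uact_termD t u v : uact_term t (u + v) = uact_term t u + uact_term t v.
Proof. by have := uact_term_lin t 1 u v; rewrite !scale1r. Qed.
Lemma uact_term0 t : uact_term t 0 = 0.
Proof. by apply: (@addrI _ (uact_term t 0)); rewrite -uact_termD !addr0. Qed.
Lemma uact_termZ t c v : uact_term t (c *: v) = c *: uact_term t v.
Proof. by have := uact_term_lin t c v 0; rewrite uact_term0 !addr0. Qed.

Lemma uact_ueq t t' : ueq t t' -> uact_term t =1 uact_term t'.
Proof.
elim=> //=.
- by move=> ? ? _ IH v; rewrite IH.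
- by move=> ? ? ? _ IH _ IH' v; rewrite IH IH'.
- by move=> ? ? ? ? _ IH _ IH' v; rewrite IH IH'.
- by move=> ? ? ? ? _ IH _ IH' v; rewrite IH IH'.
- by move=> * v /=; rewrite addrA.
- by move=> * v /=; rewrite addrC.
- by move=> * v /=; rewrite scale0r add0r.
- by move=> * v /=; rewrite !scale0r.
- by move=> * v /=; rewrite !scale1r.
- by move=> * v /=; rewrite !scale1r.
- by move=> * v /=; rewrite uact_termD.
- by move=> * v /=; rewrite scalerDl.
- by move=> * v /=; rewrite scalerA.
- by move=> * v /=; rewrite uact_termZ.
- by move=> * v /=; rewrite lact_linl.
- by move=> * v /=; rewrite lact_lie scaleN1r.
Qed.

Definition uact (u : envel L) (v : V) : V := uact_term (repr u) v.

Lemma uactE t v : uact (ucls t) v = uact_term t v.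
Proof. by apply: uact_ueq; apply: urepr. Qed.

Lemma uactDl u u' v : uact (u + u') v = uact u v + uact u' v.
Proof. by rewrite -(uclsK u) -(uclsK u') uclsD !uactE. Qed.
Lemma uactM u u' v : uact (u * u') v = uact u (uact u' v).
Proof. by rewrite -(uclsK u) -(uclsK u') uclsM !uactE. Qed.
Lemma uact_cst c v : uact c%:A v = c *: v.
Proof. by rewrite -ucstE uactE. Qed.
Lemma uact1 v : uact 1 v = v.
Proof. by rewrite -[1]scale1r uact_cst scale1r. Qed.
Lemma uact0l v : uact 0 v = 0.
Proof. by rewrite -(scale0r 1) uact_cst scale0r. Qed.
Lemma uactZl c u v : uact (c *: u) v = c *: uact u v.
Proof. by rewrite -[u in LHS]mul1r scalerAl uactM uact_cst. Qed.
Lemma uactNl u v : uact (- u) v = - uact u v.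
Proof. by rewrite -[- u]scaleN1r uactZl scaleN1r. Qed.
Lemma uact_gen x v : uact (ugen x) v = lact x v.
Proof. exact: uactE. Qed.
Lemma uactDr u v w : uact u (v + w) = uact u v + uact u w.
Proof. exact: uact_termD. Qed.
Lemma uact0r u : uact u 0 = 0.
Proof. exact: uact_term0. Qed.
Lemma uactZr c u v : uact u (c *: v) = c *: uact u v.
Proof. exact: uact_termZ. Qed.

End LieModTheory.

Section UModule.
Context {K : fieldType} {L : lieAlgType K} (V : lieMod L).

Definition umodule : Type := lm_car V.
HB.instance Definition _ := GRing.Zmodule.on umodule.

Let us (u : envel L) (v : umodule) : umodule := uact u v.
Lemma usA a b v : us a (us b v) = us (a * b) v.
Proof. by rewrite /us uactM. Qed.
Lemma us1 : left_id 1 us.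
Proof. exact: uact1. Qed.
Lemma usDr : right_distributive us +%R.
Proof. by move=> *; apply: uactDr. Qed.
Lemma usDl v : {morph us^~ v : a b / a + b}.
Proof. by move=> a b; apply: uactDl. Qed.
HB.instance Definition _ := GRing.Zmodule_isLmodule.Build (envel L) umodule
  usA us1 usDr usDl.
End UModule.

Definition restr (K : fieldType) (L L' : lieAlgType K) (f : lieHom L L')
  (V : lieMod L') : lieMod L.
Proof.
exists (lm_car V) (fun x v => lact (f x) v).
- by move=> c x y v; rewrite lh_lin lact_linl.
- by move=> c x u v; rewrite lact_linr.
- by move=> x y v; rewrite lh_lie lact_lie.
Defined.

Definition dsum (K : fieldType) (L : lieAlgType K) (V W : lieMod L) : lieMod L.
Proof.
exists (lm_car V * lm_car W)%type (fun x p => (lact x p.1, lact x p.2)).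
- by move=> c x y v; rewrite /= !lact_linl.
- by move=> c x u v; rewrite /= !lact_linr.
- by move=> x y v; rewrite /= !lact_lie.
Defined.

Record lieSub (K : fieldType) (L : lieAlgType K) (V : lieMod L) := LieSub {
  ls_pred :> V -> Prop;
  ls_0 : ls_pred 0;
  ls_lin : forall c u v, ls_pred u -> ls_pred v -> ls_pred (c *: u + v);
  ls_act : forall x v, ls_pred v -> ls_pred (lact x v)
}.

Section Quotient.
Context {K : fieldType} {L : lieAlgType K} {V : lieMod L} (N : lieSub V).

Lemma lsD u v : N u -> N v -> N (u + v).
Proof. by move=> Nu Nv; rewrite -[u]scale1r; apply: ls_lin. Qed.
Lemma lsZ c u : N u -> N (c *: u).
Proof. by move=> Nu; rewrite -[_ *: u]addr0; apply: ls_lin => //; apply: ls_0. Qed.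
Lemma lsN u : N u -> N (- u).
Proof. by move=> Nu; rewrite -scaleN1r; apply: lsZ. Qed.

Definition qeqb (u v : V) : bool := `[< N (u - v) >].
Lemma qeqb_refl : reflexive qeqb.
Proof. by move=> u; apply/asboolP; rewrite subrr; apply: ls_0. Qed.
Lemma qeqb_sym : symmetric qeqb.
Proof.
by move=> u v; apply/idP/idP => /asboolP h; apply/asboolP;
  rewrite -opprB; apply: lsN.
Qed.
Lemma qeqb_trans : transitive qeqb.
Proof.
move=> u v w /asboolP h /asboolP h'; apply/asboolP.
have -> : v - w = (v - u) + (u - w) by rewrite addrA subrK.
exact: lsD.
Qed.
Canonical qeqb_equiv := EquivRel qeqb qeqb_refl qeqb_sym qeqb_trans.

Definition quot_car := {eq_quot qeqb}.
HB.instance Definition _ := Choice.on quot_car.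

Definition qcls (v : V) : quot_car := \pi_({eq_quot qeqb}) v.
Lemma qclsP u v : qcls u = qcls v <-> N (u - v).
Proof.
split; first by move=> /eqmodP /asboolP.
by move=> h; apply/eqmodP/asboolP.
Qed.
Lemma qclsK (x : quot_car) : qcls (repr x) = x.
Proof. exact: reprK. Qed.
Lemma qrepr v : N (repr (qcls v) - v).
Proof. by apply/qclsP; rewrite qclsK. Qed.

Definition qadd (x y : quot_car) := qcls (repr x + repr y).
Definition qopp (x : quot_car) := qcls (- repr x).
Definition qscale (c : K) (x : quot_car) := qcls (c *: repr x).
Definition qact (l : L) (x : quot_car) := qcls (lact l (repr x)).

Lemma qaddE u v : qadd (qcls u) (qcls v) = qcls (u + v).
Proof. by apply/qclsP; rewrite opprD addrACA; apply: lsD; apply: qrepr. Qed.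
Lemma qoppE u : qopp (qcls u) = qcls (- u).
Proof. by apply/qclsP; rewrite -opprD; apply: lsN; apply: qrepr. Qed.
Lemma qscaleE c u : qscale c (qcls u) = qcls (c *: u).
Proof. by apply/qclsP; rewrite -scalerBr; apply: lsZ; apply: qrepr. Qed.
Lemma qactE l u : qact l (qcls u) = qcls (lact l u).
Proof.
by apply/qclsP; rewrite -lactNr -lactDr; apply: ls_act; apply: qrepr.
Qed.

Lemma qaddA : associative qadd.
Proof.
by move=> x y z; rewrite -(qclsK x) -(qclsK y) -(qclsK z) !qaddE addrA.
Qed.
Lemma qaddC : commutative qadd.
Proof. by move=> x y; rewrite /qadd addrC. Qed.
Lemma qadd0 : left_id (qcls 0) qadd.
Proof. by move=> x; rewrite -(qclsK x) qaddE add0r. Qed.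
Lemma qaddN : left_inverse (qcls 0) qopp qadd.
Proof. by move=> x; rewrite -(qclsK x) qoppE qaddE addNr. Qed.
HB.instance Definition _ := GRing.isZmodule.Build quot_car qaddA qaddC qadd0 qaddN.

Lemma qscaleA a b v : qscale a (qscale b v) = qscale (a * b) v.
Proof. by rewrite -(qclsK v) !qscaleE scalerA. Qed.
Lemma qscale1 : left_id 1 qscale.
Proof. by move=> v; rewrite -(qclsK v) !qscaleE scale1r. Qed.
Lemma qscaleDr : right_distributive qscale +%R.
Proof.
move=> c x y; rewrite -(qclsK x) -(qclsK y) [qcls _ + _]qaddE !qscaleE.
by rewrite [RHS]qaddE scalerDr.
Qed.
Lemma qscaleDl v : {morph qscale^~ v : a b / a + b}.
Proof.
by move=> a b; rewrite -(qclsK v) !qscaleE [RHS]qaddE scalerDl.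
Qed.
HB.instance Definition _ := GRing.Zmodule_isLmodule.Build K quot_car
  qscaleA qscale1 qscaleDr qscaleDl.

Lemma qclsD u v : qcls u + qcls v = qcls (u + v).
Proof. exact: qaddE. Qed.
Lemma qclsN u : - qcls u = qcls (- u).
Proof. exact: qoppE. Qed.
Lemma qclsZ c u : c *: qcls u = qcls (c *: u).
Proof. exact: qscaleE. Qed.

Definition quotMod : lieMod L.
Proof.
exists quot_car qact.
- by move=> c x y v; rewrite -(qclsK v) !qactE qclsZ qclsD lact_linl.
- move=> c x u v; rewrite -(qclsK v) -(qclsK u) qclsZ qclsD !qactE.
  by rewrite qclsZ qclsD lact_linr.
- by move=> x y v; rewrite -(qclsK v) !qactE qclsN qclsD lact_lie.
Defined.

Definition qproj : lmHom V quotMod.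
Proof.
exists qcls.
- by move=> c u v; rewrite qclsZ qclsD.
- by move=> x v; rewrite [RHS]qactE.
Defined.

End Quotient.

(* The submodule generated by the elements satisfying X, i.e. U(L) X. *)
Section GeneratedSubmodule.
Context {K : fieldType} {L : lieAlgType K} {V : lieMod L} (X : V -> Prop).

Definition gen_pred (v : V) : Prop :=
  exists2 s : seq (envel L * V),
    (forall p, p \in s -> X p.2) & v = \sum_(p <- s) uact p.1 p.2.

Definition gen_sub : lieSub V.
Proof.
exists gen_pred.
- by exists [::] => //; rewrite big_nil.
- move=> c u v [s Xs ->] [t Xt ->].
  exists ([seq (c *: p.1, p.2) | p <- s] ++ t).
    by move=> p; rewrite mem_cat => /orP[/mapP[q qs ->]|/Xt//]; apply: Xs qs.
  rewrite big_cat big_map scaler_sumr; congr (_ + _).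
  by apply: eq_bigr => p _; rewrite uactZl.
- move=> x v [s Xs ->]; exists [seq (ugen x * p.1, p.2) | p <- s].
    by move=> p /mapP[q qs ->]; apply: Xs qs.
  rewrite big_map; elim: s {Xs} => [|p s IH].
    by rewrite !big_nil lact0r.
  by rewrite !big_cons lactDr IH uactM uact_gen.
Defined.

End GeneratedSubmodule.

(* (L, S)-bimodules and the functor B (x)_S -. *)
Record bimod (K : fieldType) (L : lieAlgType K) (S : pzRingType) := Bimod {
  bm_mod :> lieMod L;
  bm_right : rightMod S bm_mod;
  bm_comm : forall x m s,
    lact x (ract bm_right m s) = ract bm_right (lact x m) s
}.

Section BimodTensor.
Context {K : fieldType} {L : lieAlgType K} {S : pzRingType}.
Variables (B : bimod L S) (N : lmodType S).

Definition bt_act (x : L) : tensor (bm_right B) N -> tensor (bm_right B) N :=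
  tmapl (lact x).

Let btD x := @tmaplD K S B (bm_right B) N (lact x) (lactDr x) (bm_comm x).
Let btN x := @tmaplN K S B (bm_right B) N (lact x) (lactDr x) (bm_comm x).
Let bt0 x := @tmapl0 K S B (bm_right B) N (lact x) (lactDr x) (bm_comm x).
Let btP x := @tmapl_pure K S B (bm_right B) N (lact x) (lactDr x) (bm_comm x).

Lemma bt_act_pure x m n : bt_act x (pure (bm_right B) m n) = pure _ (lact x m) n.
Proof. exact: btP. Qed.
Lemma bt_act_linl c x y v : bt_act (c *: x + y) v = c *: bt_act x v + bt_act y v.
Proof.
rewrite /bt_act; elim/(@tensor_ind K S B (bm_right B) N): v => [|v IH|u v IHu IHv|m n].
- by rewrite !bt0 scaler0 addr0.
- by rewrite !btN IH scalerN opprD.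
- by rewrite !btD IHu IHv scalerDr addrACA.
- by rewrite !btP lact_linl pureDl pureZl.
Qed.
Lemma bt_act_linr c x u v : bt_act x (c *: u + v) = c *: bt_act x u + bt_act x v.
Proof.
apply: tmapl_linear; [exact: lactDr|exact: bm_comm|].
by move=> d m; rewrite lactZr.
Qed.
Lemma bt_act_lie x y v :
  bt_act (lie x y) v = bt_act x (bt_act y v) - bt_act y (bt_act x v).
Proof.
rewrite /bt_act; elim/(@tensor_ind K S B (bm_right B) N): v => [|v IH|u v IHu IHv|m n].
- by rewrite !bt0 oppr0 addr0.
- by rewrite !btN IH opprB opprK addrC.
- by rewrite !btD IHu IHv opprD addrACA.
- by rewrite !btP lact_lie pureDl pureNl.
Qed.

Definition bimod_tensor : lieMod L := LieMod bt_act_linl bt_act_linr bt_act_lie.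
End BimodTensor.

(* U(L') is a (L', U(L))-bimodule along L -> L'; the induced module is
   U(L') (x)_{U(L)} V. *)
Section Induction.
Context {K : fieldType} {L L' : lieAlgType K} (f : lieHom L L').

Definition env_left : lieMod L'.
Proof.
exists (envel L') (fun x u => ugen x * u).
- by move=> c x y v; rewrite ugen_lin mulrDl scalerAl.
- by move=> c x u v; rewrite mulrDr scalerAr.
- by move=> x y v; rewrite ugen_lie mulrBl !mulrA.
Defined.

Definition env_right : rightMod (envel L) env_left.
Proof.
exists (fun (u : envel L') s => u * umap f s).
- by move=> *; rewrite mulrDl.
- by move=> *; rewrite umapD mulrDr.
- by move=> *; rewrite umapM mulrA.
- by move=> m; rewrite umap1 mulr1.
- by move=> c m s; rewrite scalerAl.
Defined.

Definition env_bimod : bimod L' (envel L).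
Proof. by exists env_left env_right => x m s; rewrite /= mulrA. Defined.

Definition induced (V : lieMod L) : lieMod L' := bimod_tensor env_bimod (umodule V).

Definition ind_pure (u : envel L') (V : lieMod L) (v : V) : induced V :=
  pure env_right u (v : umodule V).

End Induction.

Section SimpleLie.
Context {K : fieldType}.
Implicit Types g : finLieAlgType K.

Definition is_simple g : Prop :=
  (exists x y : g, lie x y != 0) /\
  forall I : {vspace g}, (forall x y, y \in I -> lie x y \in I) ->
    I = 0%VS \/ I = fullv.

Record subLie g := SubLie {
  sl_sp :> {vspace g};
  sl_closed : forall x y, x \in sl_sp -> y \in sl_sp -> lie x y \in sl_sp
}.

End SimpleLie.

Section SubLieAlgebra.
Context {K : fieldType} {g : finLieAlgType K} (h : subLie g).

Definition sub_lie : Type := subvs_of (sl_sp h).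
HB.instance Definition _ := Vector.on sub_lie.

Definition sub_val (x : sub_lie) : g := vsval (x : subvs_of (sl_sp h)).
Definition slie (x y : sub_lie) : sub_lie :=
  vsproj (sl_sp h) (lie (sub_val x) (sub_val y)).

Lemma sub_val_slie x y : sub_val (slie x y) = lie (sub_val x) (sub_val y).
Proof. by rewrite /sub_val vsprojK //; apply: sl_closed; apply: subvsP. Qed.
Lemma sub_val_inj : injective sub_val.
Proof. exact: subvs_inj. Qed.
Lemma sub_val_lin c x y : sub_val (c *: x + y) = c *: sub_val x + sub_val y.
Proof. exact: linearP. Qed.
Lemma sub_valD x y : sub_val (x + y) = sub_val x + sub_val y.
Proof. exact: linearD. Qed.
Lemma sub_val0 : sub_val 0 = 0.
Proof. exact: linear0. Qed.

Lemma slie_linl c x y z : slie (c *: x + y) z = c *: slie x z + slie y z.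
Proof.
by apply: sub_val_inj; rewrite sub_val_lin !sub_val_slie sub_val_lin lie_linl.
Qed.
Lemma slie_linr c x y z : slie z (c *: x + y) = c *: slie z x + slie z y.
Proof.
by apply: sub_val_inj; rewrite sub_val_lin !sub_val_slie sub_val_lin lie_linr.
Qed.
Lemma slie_xx x : slie x x = 0.
Proof. by apply: sub_val_inj; rewrite sub_val_slie sub_val0 lie_xx. Qed.
Lemma slie_jacobi x y z :
  slie x (slie y z) + slie y (slie z x) + slie z (slie x y) = 0.
Proof.
by apply: sub_val_inj; rewrite !sub_valD !sub_val_slie sub_val0 lie_jacobi.
Qed.

HB.instance Definition _ := isLie.Build K sub_lie
  slie_linl slie_linr slie_xx slie_jacobi.

Definition sub_incl : lieHom sub_lie g := LieHom sub_val_lin sub_val_slie.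

End SubLieAlgebra.

Section Cartan.
Context {K : fieldType} {g : finLieAlgType K}.

Definition lie_prod (U V : {vspace g}) : {vspace g} :=
  <<[seq lie x y | x <- vbasis U, y <- vbasis V]>>%VS.

Definition is_nilpotent (h : subLie g) : Prop :=
  exists n, iter n (lie_prod h) h = 0%VS.

Definition is_cartan (h : subLie g) : Prop :=
  is_nilpotent h /\
  forall x, (forall y, y \in sl_sp h -> lie x y \in sl_sp h) -> x \in sl_sp h.

Definition dual (h : subLie g) : Type := 'Hom(sub_lie h, K^o).
HB.instance Definition _ h := Vector.on (dual h).

Definition ev (h : subLie g) (mu : dual h) (x : sub_lie h) : K :=
  (mu : 'Hom(sub_lie h, K^o)) x.

Definition root_vec (h : subLie g) (a : dual h) (x : g) : Prop :=
  forall y : sub_lie h, lie (sub_val y) x = ev a y *: x.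

Definition is_root (h : subLie g) (a : dual h) : Prop :=
  a != 0 /\ exists2 x, x != 0 & root_vec a x.

Lemma lie_suml (I : Type) (r : seq I) (P : pred I) (F : I -> g) z :
  lie (\sum_(i <- r | P i) F i) z = \sum_(i <- r | P i) lie (F i) z.
Proof. by apply: (big_morph (lie^~ z)) => [x y|]; rewrite ?lieDl ?lie0l. Qed.
Lemma lie_sumr (I : Type) (r : seq I) (P : pred I) (F : I -> g) z :
  lie z (\sum_(i <- r | P i) F i) = \sum_(i <- r | P i) lie z (F i).
Proof. by apply: (big_morph (lie z)) => [x y|]; rewrite ?lieDr ?lie0r. Qed.

Lemma mem_lie_prod (U V : {vspace g}) x y :
  x \in U -> y \in V -> lie x y \in lie_prod U V.
Proof.
move=> /coord_vbasis -> /coord_vbasis ->.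
rewrite lie_suml; apply: memv_suml => i _; rewrite lieZl memvZ //.
rewrite lie_sumr; apply: memv_suml => j _; rewrite lieZr memvZ //.
by apply: memv_span; apply: allpairs_f; apply: mem_nth; rewrite size_tuple.
Qed.

End Cartan.

(* A Cartan subalgebra csa, the roots, a base alpha, the coroots, the
   fundamental weights omega and a Chevalley basis (xr a, coroot (alpha i)).
   For a positive root a, x^+_a is xr a and x^-_a is xr (- a); h_i is
   coroot (alpha i). The vector [xr a, xr (- a)] of csa is normalised by
   ev a (coroot a) = 2, which characterises the coroot of a.
   The functions xr and coroot are unconstrained outside the roots. *)
Record chevalley (K : fieldType) (g : finLieAlgType K) := Chevalley {
  csa : subLie g;
  csaP : is_cartan csa;
  roots : seq (dual csa);
  roots_uniq : uniq roots;
  rootsP : forall a, a \in roots <-> is_root a;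
  rank : nat;
  alpha : 'I_rank -> dual csa;
  alpha_root : forall i, alpha i \in roots;
  alpha_basis : basis_of fullv [seq alpha i | i <- enum 'I_rank];
  alpha_pos : forall a, a \in roots -> exists k : 'I_rank -> nat,
    a = \sum_i alpha i *+ k i \/ a = - \sum_i alpha i *+ k i;
  xr : dual csa -> g;
  coroot : dual csa -> sub_lie csa;
  xr_root : forall a, a \in roots -> root_vec a (xr a);
  xr_lie : forall a, a \in roots -> lie (xr a) (xr (- a)) = sub_val (coroot a);
  coroot_norm : forall a, a \in roots -> ev a (coroot a) = 2%:R;
  xr_struct : forall a b c d, a \in roots -> b \in roots -> a + b \in roots ->
    lie (xr a) (xr b) = c *: xr (a + b) ->
    lie (xr (- a)) (xr (- b)) = d *: xr (- (a + b)) -> d = - c;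
  chevalley_basis : basis_of fullv
    ([seq xr a | a <- roots] ++
     [seq sub_val (coroot (alpha i)) | i <- enum 'I_rank]);
  omega : 'I_rank -> dual csa;
  omega_coroot : forall i j, ev (omega i) (coroot (alpha j)) = (i == j)%:R
}.

Arguments alpha {K g} D i : rename.
Arguments omega {K g} D i : rename.
Arguments xr {K g} D a : rename.
Arguments coroot {K g} D a : rename.

Section Weights.
Context {K : fieldType} {g : finLieAlgType K} (D : chevalley g).

Definition cartan_lie : lieAlgType K := sub_lie (csa D).
Definition weight : zmodType := dual (csa D).

Definition in_Qplus (mu : weight) : Prop :=
  exists k : 'I_(rank D) -> nat, mu = \sum_i alpha D i *+ k i.
Definition in_Pplus (mu : weight) : Prop :=
  exists k : 'I_(rank D) -> nat, mu = \sum_i omega D i *+ k i.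
Definition wle (mu nu : weight) : Prop := in_Qplus (nu - mu).
Definition pos_root (a : weight) : Prop := a \in roots D /\ in_Qplus a.

Definition wt_vec (V : lieMod g) (mu : weight) (v : V) : Prop :=
  forall x : cartan_lie, lact (sub_val x) v = ev mu x *: v.

End Weights.

Section CartanAbelian.
Context {K : fieldType} {g : finLieAlgType K} (gs : is_simple g) (D : chevalley g).

Lemma center0 (z : g) : (forall x, lie x z = 0) -> z = 0.
Proof.
move=> zc; have [[x [y xy]] /(_ <[z]>%VS)] := gs.
case=> [u v /vlineP[c ->]||]; first by rewrite lieZr zc scaler0 mem0v.
  by move=> z0; apply/eqP; rewrite -memv0 -z0 memv_line.
move=> zT; have /vlineP[c yE] : y \in <[z]>%VS by rewrite zT memvf.
by move: xy; rewrite yE lieZr zc scaler0 eqxx.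
Qed.

Lemma csa_abelian (x y : sub_lie (csa D)) : lie x y = 0.
Proof.
have [[n nil] _] := csaP D.
set h := sl_sp (csa D) in nil.
have brh u v : u \in h -> v \in h -> lie u v \in h by apply: sl_closed.
have subh : forall k, (iter k (lie_prod h) h <= h)%VS.
  elim=> [|k IH]; first by rewrite subvv.
  apply/span_subvP => _ /allpairsP[[u v] /= [uh vk ->]].
  apply: brh; first exact: (vbasis_mem uh).
  exact: (subvP IH) (vbasis_mem vk).
(* a bracket of elements of h annihilates every root vector *)
have brx (u v : sub_lie (csa D)) a : a \in roots D ->
    lie (lie (sub_val u) (sub_val v)) (xr D a) = 0.
  move=> aR; have xa := xr_root aR.
  have := lie_jacobi (sub_val u) (sub_val v) (xr D a).
  rewrite [lie (xr D a) (sub_val u)]lieC xa xa !(lieNr, lieZr) !xa.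
  rewrite !scalerA mulrC subrr add0r lieC => /eqP.
  by rewrite oppr_eq0 => /eqP.
have cent u v : u \in h -> v \in h ->
    (forall w, w \in h -> lie w (lie u v) = 0) -> lie u v = 0.
  move=> uh vh hc; apply: center0 => w.
  set s := [seq xr D a | a <- roots D] ++
      [seq sub_val (coroot D (alpha D i)) | i <- enum 'I_(rank D)].
  have /coord_span -> : w \in <<in_tuple s>>%VS.
    by rewrite (span_basis (chevalley_basis D)) memvf.
  rewrite lie_suml big1 // => i _; rewrite lieZl.
  have := mem_nth 0 (ltn_ord i : (i < size s)%N).
  rewrite {2}/s mem_cat => /orP[/mapP[a aR ->]|/mapP[j _ ->]].
    have := brx (vsproj h u) (vsproj h v) a aR.
    by rewrite /sub_val !vsprojK // lieC => /eqP; rewrite oppr_eq0 => /eqP ->;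
      rewrite scaler0.
  by rewrite hc ?scaler0 //; apply: subvsP.
have step k : iter k.+2 (lie_prod h) h = 0%VS -> iter k.+1 (lie_prod h) h = 0%VS.
  move=> k2; apply/eqP; rewrite -subv0.
  apply/span_subvP => _ /allpairsP[[u v] /= [uh vk ->]].
  have uh' := vbasis_mem uh; have vk' := vbasis_mem vk.
  rewrite memv0; apply/eqP; apply: cent => //; first exact: (subvP (subh k)).
  move=> w wh; apply/eqP; rewrite -memv0 -k2.
  by apply: mem_lie_prod => //; apply: mem_lie_prod.
have h1 : lie_prod h h = 0%VS.
  have : iter n.+1 (lie_prod h) h = 0%VS.
    rewrite /= nil; apply/eqP; rewrite -subv0.
    apply/span_subvP => _ /allpairsP[[u v] /= [_ v0 ->]].
    by move: (vbasis_mem v0); rewrite !memv0 => /eqP ->; rewrite lie0r.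
  by elim: {nil} n => [//|n IH] /step.
apply: sub_val_inj; rewrite sub_val0 sub_val_slie; apply/eqP.
by rewrite -memv0 -h1; apply: mem_lie_prod; apply: subvsP.
Qed.

End CartanAbelian.

Lemma envel_comm (K : fieldType) (L : lieAlgType K) :
  (forall x y : L, lie x y = 0) -> forall u v : envel L, u * v = v * u.
Proof.
move=> ab u v.
have gg (x y : L) : ugen x * ugen y = ugen y * ugen x.
  by apply/eqP; rewrite -subr_eq0 -ugen_lie ab ugen0.
have gu (x : L) : ugen x * v = v * ugen x.
  elim/(@envel_ind K L): v => [c|y|a b IHa IHb|a b IHa IHb].
  - by rewrite -scalerAr -scalerAl mulr1 mul1r.
  - exact: gg.
  - by rewrite mulrDr mulrDl IHa IHb.
  - by rewrite mulrA IHa -mulrA IHb mulrA.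
elim/(@envel_ind K L): u => [c|y|a b IHa IHb|a b IHa IHb].
- by rewrite -scalerAr -scalerAl mulr1 mul1r.
- exact: gu.
- by rewrite mulrDr mulrDl IHa IHb.
- by rewrite -mulrA IHb mulrA IHa mulrA.
Qed.

Lemma lieTensor_abelian (K : fieldType) (L : lieAlgType K) (A : comAlgType K) :
  (forall x y : L, lie x y = 0) -> forall s t : lieTensor L A, lie s t = 0.
Proof.
move=> ab s t; elim/(@ltens_ind K L A): s => [|s IH|s u IHs IHu|x a].
- by rewrite lie0l.
- by rewrite lieNl IH oppr0.
- by rewrite lieDl IHs IHu addr0.
elim/(@ltens_ind K L A): t => [|s IH|s u IHs IHu|y b].
- by rewrite lie0r.
- by rewrite lieNr IH oppr0.
- by rewrite lieDr IHs IHu addr0.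
by rewrite [LHS]tlie_pure ab /ltens pure0l.
Qed.

Section FiniteDimension.
Context {K : fieldType} {L : lieAlgType K} (V : lieMod L).

Definition in_span n (b : 'I_n -> V) (v : V) : Prop :=
  exists c : 'I_n -> K, v = \sum_i c i *: b i.

Definition fin_dim : Prop :=
  exists n (b : 'I_n -> V), forall v, in_span b v.

Definition locally_fin_dim : Prop :=
  forall v : V, exists n (b : 'I_n -> V),
    in_span b v /\ forall x i, in_span b (lact x (b i)).

Definition irreducible : Prop :=
  (exists v : V, v != 0) /\
  forall N : lieSub V, (forall v, N v -> v = 0) \/ (forall v, N v).

End FiniteDimension.

Record hw_module (K : fieldType) (g : finLieAlgType K) (D : chevalley g)
    (lam : weight D) := HwModule {
  hw_mod :> lieMod g;
  hw_fd : fin_dim hw_mod;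
  hw_irr : irreducible hw_mod;
  hw_vec : hw_mod;
  hw_vec_neq0 : hw_vec != 0;
  hw_vec_wt : wt_vec lam hw_vec;
  hw_vec_pos : forall a, pos_root a -> lact (xr D a) hw_vec = 0
}.

Section Categories.
Context {K : fieldType} {g : finLieAlgType K} (D : chevalley g) (A : comAlgType K).

Definition cwt_vec (V : lieMod (lieTensor g A)) (mu : weight D) (v : V) : Prop :=
  wt_vec (V := restr (cur_emb g A) V) mu v.

Definition in_IA (V : lieMod (lieTensor g A)) : Prop :=
  locally_fin_dim (restr (cur_emb g A) V).

(* The sum over mu not <= nu of U(g (x) A) V_mu. *)
Definition trunc_sub (nu : weight D) (V : lieMod (lieTensor g A)) : lieSub V :=
  gen_sub (fun v => exists2 mu : weight D, ~ wle mu nu & cwt_vec mu v).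

Definition trunc (nu : weight D) (V : lieMod (lieTensor g A)) :
    lieMod (lieTensor g A) :=
  quotMod (trunc_sub nu V).

Definition in_I (nu : weight D) (V : lieMod (lieTensor g A)) : Prop :=
  in_IA V /\ forall v, trunc_sub nu V v -> v = 0.

End Categories.

Section HomExt.
Context {K : fieldType} {L : lieAlgType K}.
Implicit Types U V : lieMod L.

Definition hom_zero V U : Prop := forall (f : lmHom V U) v, f v = 0.

(* 0 -> U -> E -> V -> 0 *)
Record extension V U := Extension {
  ext_mod : lieMod L;
  ext_in : lmHom U ext_mod;
  ext_out : lmHom ext_mod V;
  ext_inj : injective ext_in;
  ext_surj : forall v, exists e, ext_out e = v;
  ext_exact : forall e, ext_out e = 0 <-> exists u, ext_in u = e
}.

Definition ext_equiv V U (X Y : extension V U) : Prop :=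
  exists f : lmHom (ext_mod X) (ext_mod Y),
    (forall u, f (ext_in X u) = ext_in Y u) /\
    (forall e, ext_out Y (f e) = ext_out X e).

Definition split_ext V U : extension V U.
Proof.
have i1 c (u v : U) : (c *: u + v, 0) = c *: (u, 0) + (v, 0) :> dsum U V.
  by apply/pair_equal_spec; split; rewrite //= scaler0 addr0.
have i2 x (u : U) : (lact x u, 0) = lact x ((u, 0) : dsum U V) :> dsum U V.
  by rewrite /= lact0r.
have o1 c (p q : dsum U V) : (c *: p + q).2 = c *: p.2 + q.2 by [].
have o2 x (p : dsum U V) : (lact x p).2 = lact x p.2 by [].
exists (dsum U V) (LmHom i1 i2) (LmHom o1 o2).
- by move=> u v [].
- by move=> v; exists (0, v).
- move=> [u v] /=; split=> [->|[u' [_ <-]] //]; by exists u.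
Defined.

(* Ext^1(V, U) = 0, computed in the full subcategory of modules satisfying C,
   as Yoneda classes of extensions. *)
Definition ext1_zero (C : lieMod L -> Prop) V U : Prop :=
  forall X : extension V U, C (ext_mod X) -> ext_equiv X (split_ext V U).

End HomExt.

Section WeylModule.
Context {K : fieldType} {g : finLieAlgType K} {D : chevalley g}.
Context {lam : weight D} (M : hw_module lam) (A : comAlgType K).

Definition PA : lieMod (lieTensor g A) := induced (cur_emb g A) M.

Definition weyl_mod : lieMod (lieTensor g A) := trunc lam PA.

Definition PA_vec : PA := ind_pure (cur_emb g A) 1 (hw_vec M).

Definition weyl_vec : weyl_mod := qproj (trunc_sub lam PA) PA_vec.

Definition env_incl : envel (lieTensor (cartan_lie D) A) -> envel (lieTensor g A) :=
  umap (cur_map (sub_incl (csa D)) A).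

Definition hact (V : lieMod (lieTensor g A))
    (p : envel (lieTensor (cartan_lie D) A)) (v : V) : V :=
  uact (env_incl p) v.

Definition weyl_ann (p : envel (lieTensor (cartan_lie D) A)) : Prop :=
  hact p weyl_vec = 0.

Lemma uact_eq (L : lieAlgType K) (V : lieMod L) (a b : envel L) (v : V) :
  uact (a - b) v = 0 <-> uact a v = uact b v.
Proof.
rewrite uactDl uactNl; split=> [/eqP|->]; last by rewrite subrr.
by rewrite subr_eq0 => /eqP.
Qed.

Lemma lmh_uact (L : lieAlgType K) (V W : lieMod L) (f : lmHom V W) u v :
  f (uact u v) = uact u (f v).
Proof.
have fD x y : f (x + y) = f x + f y by have := lmh_lin f 1 x y; rewrite !scale1r.
have f0 : f 0 = 0 by apply: (@addrI _ (f 0)); rewrite -fD !addr0.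
have fZ c x : f (c *: x) = c *: f x by rewrite -[LHS](congr1 f (addr0 _)) lmh_lin f0 addr0.
elim/(@envel_ind K L): u v => [c|x|s t IHs IHt|s t IHs IHt] v.
- by rewrite !uact_cst.
- by rewrite !uact_gen lmh_act.
- by rewrite !uactDl fD IHs IHt.
- by rewrite !uactM IHs IHt.
Qed.

Lemma uact_ind_pure s u (v : M) :
  uact s (ind_pure (cur_emb g A) u v) = ind_pure (cur_emb g A) (s * u) v.
Proof.
elim/(@envel_ind K (lieTensor g A)): s u => [c|x|s t IHs IHt|s t IHs IHt] u.
- by rewrite uact_cst -scalerAl mul1r /ind_pure pureZl.
- by rewrite uact_gen; apply: bt_act_pure.
- by rewrite uactDl IHs IHt mulrDl /ind_pure pureDl.
- by rewrite uactM IHt IHs mulrA.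
Qed.

Lemma uact_sum (L : lieAlgType K) (V : lieMod L) (v : V) (s : seq (envel L)) :
  \sum_(u <- s) uact u v = uact (\sum_(u <- s) u) v.
Proof.
elim: s => [|u s IH]; first by rewrite !big_nil uact0l.
by rewrite !big_cons uactDl IH.
Qed.

Lemma weyl_cyclic (w : weyl_mod) : exists u, uact u weyl_vec = w.
Proof.
have Mcyc (v : M) : exists u, uact u (hw_vec M) = v.
  have [_ /(_ (gen_sub (eq (hw_vec M))))] := hw_irr M.
  case=> [h|/(_ v)[s Xs ->]].
    have /h : gen_sub (eq (hw_vec M)) (hw_vec M).
      exists [:: (1, hw_vec M)] => [p|]; first by rewrite inE => /eqP ->.
      by rewrite big_seq1 uact1.
    by move/eqP; rewrite (negPf (hw_vec_neq0 M)).
  exists (\sum_(u <- [seq p.1 | p <- s]) u); rewrite -uact_sum big_map.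
  by rewrite !big_seq; apply: eq_bigr => p ps; rewrite (Xs p ps).
have Pcyc (x : PA) : exists u, uact u PA_vec = x.
  elim/(@tensor_ind _ _ _ (env_right (cur_emb g A)) (umodule M)): x
    => [|x [u <-]|x y [u <-] [v <-]|u v].
  - by exists 0; rewrite uact0l.
  - by exists (- u); rewrite uactNl.
  - by exists (u + v); rewrite uactDl.
  - have [s <-] := Mcyc v; exists (u * umap (cur_emb g A) s).
    rewrite /PA_vec uact_ind_pure mulr1.
    exact: (pure_bal (env_right (cur_emb g A))).
rewrite -(qclsK w); have [u <-] := Pcyc (repr w); exists u.
by rewrite /weyl_vec -lmh_uact.
Qed.

(* The rule (u w_lam) p = u p w_lam does not depend on u. *)
Definition right_action_wd : Prop :=
  forall u p, uact u weyl_vec = 0 -> uact (u * env_incl p) weyl_vec = 0.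

Definition ann_kills (V : lieMod (lieTensor g A)) : Prop :=
  forall p v, weyl_ann p -> cwt_vec lam v -> hact (V := V) p v = 0.

End WeylModule.

Section Alam.
Context {K : fieldType} {g : finLieAlgType K} (gs : is_simple g) {D : chevalley g}.
Context {lam : weight D} (M : hw_module lam) (A : comAlgType K).

Notation UhA := (envel (lieTensor (cartan_lie D) A)).
Implicit Types p q : UhA.
Notation ann := (@weyl_ann K g D lam M A).

Lemma hactDl (V : lieMod (lieTensor g A)) p q (v : V) :
  hact (p + q) v = hact p v + hact q v.
Proof. by rewrite /hact /env_incl umapD uactDl. Qed.
Lemma hactM (V : lieMod (lieTensor g A)) p q (v : V) :
  hact (p * q) v = hact p (hact q v).
Proof. by rewrite /hact /env_incl umapM uactM. Qed.
Lemma hactNl (V : lieMod (lieTensor g A)) p (v : V) : hact (- p) v = - hact p v.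
Proof. by rewrite /hact /env_incl umapN uactNl. Qed.

Lemma ann0 : ann 0.
Proof. by rewrite /weyl_ann /hact /env_incl umap0 uact0l. Qed.
Lemma annD p q : ann p -> ann q -> ann (p + q).
Proof. by rewrite /weyl_ann hactDl => -> ->; rewrite addr0. Qed.
Lemma annN p : ann p -> ann (- p).
Proof. by rewrite /weyl_ann hactNl => ->; rewrite oppr0. Qed.
Lemma annMl p q : ann q -> ann (p * q).
Proof. by rewrite /weyl_ann hactM => ->; rewrite /hact uact0r. Qed.

Lemma UhAC p q : p * q = q * p.
Proof. by apply: envel_comm; apply: lieTensor_abelian; apply: (csa_abelian gs). Qed.

Lemma annMr p q : ann p -> ann (p * q).
Proof. by rewrite UhAC; apply: annMl. Qed.

Definition aeqb (p q : UhA) : bool := `[< ann (p - q) >].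
Lemma aeqb_refl : reflexive aeqb.
Proof. by move=> p; apply/asboolP; rewrite subrr; apply: ann0. Qed.
Lemma aeqb_sym : symmetric aeqb.
Proof.
by move=> u v; apply/idP/idP => /asboolP h; apply/asboolP;
  rewrite -opprB; apply: annN.
Qed.
Lemma aeqb_trans : transitive aeqb.
Proof.
move=> u v w /asboolP h /asboolP h'; apply/asboolP.
have -> : v - w = (v - u) + (u - w) by rewrite addrA subrK.
exact: annD.
Qed.
Canonical aeqb_equiv := EquivRel aeqb aeqb_refl aeqb_sym aeqb_trans.

(* U(h (x) A) / Ann(w_lam). The quotient depends on the proof gs only so that
   the ring structure (which needs h to be abelian) can be inferred for it. *)
Definition Alam := let _ := gs in {eq_quot aeqb}.
HB.instance Definition _ := Choice.on Alam.

Definition acls (p : UhA) : Alam := \pi_({eq_quot aeqb}) p.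
Definition arepr (x : Alam) : UhA := repr (x : {eq_quot aeqb}).

Lemma aclsP p q : acls p = acls q <-> ann (p - q).
Proof.
split; first by move=> /eqmodP /asboolP.
by move=> h; apply/eqmodP/asboolP.
Qed.
Lemma aclsK (x : Alam) : acls (arepr x) = x.
Proof. exact: reprK. Qed.
Lemma arepr_ann p : ann (arepr (acls p) - p).
Proof. by apply/aclsP; rewrite aclsK. Qed.

Definition aadd (x y : Alam) := acls (arepr x + arepr y).
Definition aopp (x : Alam) := acls (- arepr x).
Definition amul (x y : Alam) := acls (arepr x * arepr y).

Lemma aaddE p q : aadd (acls p) (acls q) = acls (p + q).
Proof. by apply/aclsP; rewrite opprD addrACA; apply: annD; apply: arepr_ann. Qed.
Lemma aoppE p : aopp (acls p) = acls (- p).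
Proof. by apply/aclsP; rewrite -opprD; apply: annN; apply: arepr_ann. Qed.
Lemma amulE p q : amul (acls p) (acls q) = acls (p * q).
Proof.
apply/aclsP; set p' := arepr _; set q' := arepr _.
have -> : p' * q' - p * q = (p' - p) * q' + p * (q' - q).
  by rewrite mulrBl mulrBr addrA subrK.
by apply: annD; [apply: annMr|apply: annMl]; apply: arepr_ann.
Qed.

Lemma aaddA : associative aadd.
Proof. by move=> x y z; rewrite -(aclsK x) -(aclsK y) -(aclsK z) !aaddE addrA. Qed.
Lemma aaddC : commutative aadd.
Proof. by move=> x y; rewrite /aadd addrC. Qed.
Lemma aadd0 : left_id (acls 0) aadd.
Proof. by move=> x; rewrite -(aclsK x) aaddE add0r. Qed.
Lemma aaddN : left_inverse (acls 0) aopp aadd.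
Proof. by move=> x; rewrite -(aclsK x) aoppE aaddE addNr. Qed.
Lemma amulA : associative amul.
Proof. by move=> x y z; rewrite -(aclsK x) -(aclsK y) -(aclsK z) !amulE mulrA. Qed.
Lemma amulC : commutative amul.
Proof. by move=> x y; rewrite /amul UhAC. Qed.
Lemma amul1 : left_id (acls 1) amul.
Proof. by move=> x; rewrite -(aclsK x) amulE mul1r. Qed.
Lemma amulDl : left_distributive amul aadd.
Proof.
move=> x y z; rewrite -(aclsK x) -(aclsK y) -(aclsK z).
by rewrite aaddE !amulE aaddE mulrDl.
Qed.

HB.instance Definition _ := GRing.isZmodule.Build Alam aaddA aaddC aadd0 aaddN.
HB.instance Definition _ := GRing.Zmodule_isComPzRing.Build Alam
  amulA amulC amul1 amulDl.

Lemma aclsD p q : acls (p + q) = acls p + acls q.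
Proof. by rewrite [RHS]aaddE. Qed.
Lemma aclsM p q : acls (p * q) = acls p * acls q.
Proof. by rewrite [RHS]amulE. Qed.

Section WeylBimodule.
Notation W := (weyl_mod M A).
Notation w_ := (weyl_vec M A).
Hypothesis Hw : right_action_wd M A.

(* Choose u with u w_lam = w; by Hw the result does not depend on it. *)
Definition weyl_ract (w : W) (a : Alam) : W :=
  uact (sval (cid (weyl_cyclic w)) * env_incl (arepr a)) w_.

Lemma weyl_ractE u p : weyl_ract (uact u w_) (acls p) = uact (u * env_incl p) w_.
Proof.
rewrite /weyl_ract; case: (cid _) => u' u'E; rewrite [sval _]/=.
apply/uact_eq; set p' := arepr _.
have -> : u' * env_incl p' - u * env_incl p
    = (u' - u) * env_incl p' + u * env_incl (p' - p).
  by rewrite /env_incl umapD umapN mulrBl mulrDr mulrN addrA subrK.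
rewrite uactDl (@Hw (u' - u)) ?add0r.
  have := arepr_ann p; rewrite /weyl_ann /hact uactM => ->.
  by rewrite uact0r.
by apply/uact_eq.
Qed.

Definition weyl_right : rightMod Alam W.
Proof.
exists weyl_ract.
- move=> m m' s; have [u <-] := weyl_cyclic m; have [u' <-] := weyl_cyclic m'.
  by rewrite -(aclsK s) -uactDl !weyl_ractE -uactDl mulrDl.
- move=> m s s'; have [u <-] := weyl_cyclic m; rewrite -(aclsK s) -(aclsK s').
  by rewrite -aclsD !weyl_ractE -uactDl -mulrDr /env_incl umapD.
- move=> m s s'; have [u <-] := weyl_cyclic m; rewrite -(aclsK s) -(aclsK s').
  by rewrite -aclsM !weyl_ractE /env_incl umapM mulrA.
- move=> m; have [u <-] := weyl_cyclic m.
  by rewrite [1]/(acls 1) weyl_ractE /env_incl umap1 mulr1.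
- move=> c m s; have [u <-] := weyl_cyclic m; rewrite -(aclsK s).
  by rewrite -uactZl !weyl_ractE -uactZl scalerAl.
Defined.

Lemma weyl_comm x m s :
  lact x (ract weyl_right m s) = ract weyl_right (lact x m) s.
Proof.
have [u <-] := weyl_cyclic m; rewrite -(aclsK s).
change (lact x (weyl_ract (uact u w_) (acls (arepr s)))
  = weyl_ract (lact x (uact u w_)) (acls (arepr s))).
by rewrite weyl_ractE -!uact_gen -!uactM weyl_ractE mulrA.
Qed.

Definition weyl_bimod : bimod (lieTensor g A) Alam := Bimod weyl_comm.

Definition weyl_functor (N : lmodType Alam) : lieMod (lieTensor g A) :=
  bimod_tensor weyl_bimod N.

End WeylBimodule.

Section Restriction.
Variable V : lieMod (lieTensor g A).

Definition wspace_pred : {pred V} := fun v => `[< cwt_vec lam v >].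

Lemma wspace_zmod_closed : zmod_closed wspace_pred.
Proof.
split=> [|u v /asboolP hu /asboolP hv]; apply/asboolP => x.
  by rewrite lact0r scaler0.
by rewrite lactDr lactNr (hu x) (hv x) scalerBr.
Qed.
HB.instance Definition _ := GRing.isZmodClosed.Build V wspace_pred wspace_zmod_closed.

Record wspace := WSpace { ws_val : V; ws_valP : ws_val \in wspace_pred }.
HB.instance Definition _ := [isSub for ws_val].
HB.instance Definition _ := [Choice of wspace by <:].
HB.instance Definition _ := [SubChoice_isSubZmodule of wspace by <:].

Lemma hact_wt p v : cwt_vec lam v -> cwt_vec lam (hact (V := V) p v).
Proof.
elim/(@envel_ind K (lieTensor (cartan_lie D) A)): p v
  => [c|t|p q IHp IHq|p q IHp IHq] v vl x.
- by rewrite /hact /env_incl umap_cst uact_cst lactZr vl !scalerA mulrC.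
- rewrite /hact /env_incl umap_gen uact_gen.
  elim/(@ltens_ind K (cartan_lie D) A): t => [|t IH|s t IHs IHt|y a].
  + by rewrite [cur_map _ _ _]cur_fun0 lact0l lact0r scaler0.
  + by rewrite [cur_map _ _ _]cur_funN lactNl lactNr IH scalerN.
  + by rewrite [cur_map _ _ _]cur_funD lactDl lactDr IHs IHt scalerDr.
  + rewrite [cur_map _ _ _]cur_pure /=.
    set s := ltens (sub_incl _ y) a; set t := ltens (sub_val x) 1.
    have st : lie t s = 0.
      rewrite [LHS]tlie_pure /= -sub_val_slie (_ : slie x y = 0).
        by rewrite sub_val0 /ltens pure0l.
      exact: (csa_abelian gs).
    have /eqP := lact_lie t s v; rewrite st lact0l eq_sym subr_eq0 => /eqP ->.
    by rewrite [lact t v](vl x) lactZr.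
- by rewrite hactDl lactDr (IHp _ vl x) (IHq _ vl x) scalerDr.
- by rewrite hactM; apply: IHp; apply: IHq.
Qed.

Hypothesis HV : ann_kills M V.

(* V_lam as an A_lam-module, the action being well defined by HV. *)
Definition res_functor : Type := let _ := HV in wspace.
HB.instance Definition _ := GRing.Zmodule.on res_functor.

Definition rscale (a : Alam) (v : res_functor) : res_functor :=
  WSpace (asboolT (hact_wt (arepr a) (asboolW (ws_valP v)))).

Lemma rscaleE p v : ws_val (rscale (acls p) v) = hact p (ws_val v).
Proof.
apply/eqP; rewrite -subr_eq0 -hactNl -hactDl; apply/eqP; apply: HV.
  exact: arepr_ann.
exact: asboolW (ws_valP v).
Qed.

Lemma ws_val_inj : injective ws_val.
Proof. exact: val_inj. Qed.

Lemma rscaleA a b v : rscale a (rscale b v) = rscale (a * b) v.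
Proof.
rewrite -(aclsK a) -(aclsK b) -aclsM; apply: ws_val_inj.
by rewrite !rscaleE hactM.
Qed.
Lemma rscale1 : left_id 1 rscale.
Proof.
move=> v; apply: ws_val_inj; rewrite [1]/(acls 1) rscaleE.
by rewrite /hact /env_incl umap1 uact1.
Qed.
Lemma rscaleDr : right_distributive rscale +%R.
Proof. by move=> a u v; apply: ws_val_inj; rewrite /= /hact uactDr. Qed.
Lemma rscaleDl v : {morph rscale^~ v : a b / a + b}.
Proof.
move=> a b; rewrite -(aclsK a) -(aclsK b) -aclsD; apply: ws_val_inj.
by rewrite rscaleE hactDl -!rscaleE.
Qed.
HB.instance Definition _ := GRing.Zmodule_isLmodule.Build Alam res_functor
  rscaleA rscale1 rscaleDr rscaleDl.

End Restriction.

End Alam.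

Arguments weyl_functor {K g} gs {D lam M A} Hw N.

(* Main.v *)
From HB Require Import structures.
From mathcomp Require Import all_boot all_order all_algebra.
From mathcomp Require Import boolp reals complex.
From mathcomp Require Import ring.
Require Import Defs.

Set Implicit Arguments.
Unset Strict Implicit.
Unset Printing Implicit Defensive.

Import Order.TTheory GRing.Theory Num.Theory.
Local Open Scope ring_scope.

(** The Weyl functor F N = W (x) N, where W is the global Weyl module, is left adjoint to
    taking the lam-weight space R. All follows from three facts.

    First, W has a universal property: a vector x of weight lam in a module of I^lam is
    killed by every u that kills w_lam ([weyl_univ]). Indeed x is killed by the positive
    root vectors, so it generates a highest weight module of weight lam over g, and the
    point is that this module satisfies all the relations of the irreducible module M
    ([hw_univ]). To see it, let z be the pair formed by the highest weight vector of M
    and x, and suppose that u z is nonzero with first component 0. The elements of U(g) z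
    with first component 0 form a submodule; if it is nonzero, it contains a highest
    weight vector, whose weight mu is dominant, lies below lam, and differs from lam
    because the lam-weight space of U(g) z is spanned by z. The Casimir element is central, so
    it acts on that vector by the scalar by which it acts on z. But the two scalars are
    values at mu and lam of (nu, nu + 2 rho), and these differ ([casimir_scalar_neq]). The
    Casimir element exists since g is simple and the Killing form is positive on the
    coroots. From [weyl_univ] it follows that the right action on W is well defined and
    that Ann(w_lam) kills the lam-weight spaces of the modules of I^lam.

    Second, every module of I^lam is the direct sum of its weight spaces
    ([weight_decomp]), which reduces to the theory of sl2: the coroots act
    diagonalisably on finite-dimensional modules. Hence weight vectors lift along
    surjections ([cwt_lift]), and I^lam is stable under quotients and extensions.

    Third, the lam-weight space of W is U(h (x) A) w_lam ([weyl_top]), so the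
    lam-weight space of F N consists of the vectors w_lam (x) n ([weyl_functor_top]).
    Also, an A_lam-linear map from N to the lam-weight space of X extends to a module map
    from F N to X ([weyl_functor_lift]).

    If V is isomorphic to F N and U has no weight lam, then Hom(V, U) = 0 because F N is
    generated by its lam-weight space; and an extension X of V by U has the same
    lam-weight space as V, so the inclusion of N in it extends to a section of X.
    Conversely, assume that Hom(V, U) and Ext^1(V, U) vanish for all such U, and let eps
    be the counit from F (R V) to V. It is onto because its cokernel has no weight lam
    and receives a map from V. Its kernel has no weight lam either, since eps is
    injective on lam-weight spaces. So eps is a split extension, and its kernel is a
    quotient of F (R V), which has no nonzero map to a module without weight lam. *)

(** * Finite sums and eigenvectors *)

Inductive sums (Z : zmodType) (P : Z -> Prop) : Z -> Prop :=
  | sums0 : sums P 0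
  | sums_cons x y : P x -> sums P y -> sums P (x + y).

Section Sums.
Context {Z : zmodType}.
Implicit Types P Q : Z -> Prop.

Lemma sums1 P x : P x -> sums P x.
Proof. by move=> Px; rewrite -[x]addr0; apply: sums_cons => //; apply: sums0. Qed.

Lemma sumsD P x y : sums P x -> sums P y -> sums P (x + y).
Proof.
move=> Px Py; elim: Px => [|a b Pa _ IH]; first by rewrite add0r.
by rewrite -addrA; apply: sums_cons.
Qed.

Lemma sums_sub P Q x : (forall y, P y -> Q y) -> sums P x -> sums Q x.
Proof. by move=> PQ; elim=> [|a b /PQ Qa _ IH]; [apply: sums0|apply: sums_cons]. Qed.
End Sums.

Lemma sums_bind (Z Z' : zmodType) (P : Z -> Prop) (Q : Z' -> Prop) (f : Z -> Z') x :
  {morph f : a b / a + b} -> (forall y, P y -> sums Q (f y)) -> sums P x -> sums Q (f x).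
Proof.
move=> fD fP; elim=> [|a b Pa _ IH]; last first.
  by rewrite fD; apply: sumsD IH; apply: fP.
have -> : f 0 = 0 by apply: (@addrI _ (f 0)); rewrite -fD !addr0.
exact: sums0.
Qed.

Section Eigen.
Context {K : numClosedFieldType} {L : lieAlgType K} {V : lieMod L}.
Implicit Types (h e f : envel L) (v w : V) (s : seq K) (c : K).

Definition eig h c v : Prop := uact h v = c *: v.

(** Annihilating polynomials of h are recorded by their lists of roots, since moving h
    past a weight vector of U(L) only translates the roots ([linprod_shift]). *)
Definition linprod h s : envel L := \prod_(c <- s) (h - c%:A).

Lemma uactB h e v : uact (h - e) v = uact h v - uact e v.
Proof. by rewrite uactDl uactNl. Qed.

Lemma uact_linear h c v : uact (h - c%:A) v = uact h v - c *: v.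
Proof. by rewrite uactB uact_cst. Qed.

Lemma scalar_comm c h : c%:A * h = h * c%:A.
Proof. by rewrite -scalerAl mul1r -scalerAr mulr1. Qed.

Lemma linprod_comm h s c : (h - c%:A) * linprod h s = linprod h s * (h - c%:A).
Proof.
have com d (u : envel L) : GRing.comm d%:A u by rewrite /GRing.comm scalar_comm.
apply: commr_prod => d _; apply: commrB; last exact/commr_sym/com.
by apply/commr_sym/commrB; [apply: commr_refl|apply/commr_sym/com].
Qed.

Lemma linprod_cons h c s : linprod h (c :: s) = (h - c%:A) * linprod h s.
Proof. by rewrite /linprod big_cons. Qed.

Lemma linprod_cat h s t : linprod h (s ++ t) = linprod h s * linprod h t.
Proof. by rewrite /linprod big_cat. Qed.

Lemma linear_shift h x d c : h * x - x * h = d *: x ->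
  (h - c%:A) * x = x * (h - (c - d)%:A).
Proof.
move/eqP; rewrite subr_eq => /eqP hx.
rewrite mulrBl mulrBr hx scalar_comm scalerBl mulrBr opprB.
by rewrite -(scalerAr d) mulr1 (addrC (d *: x)) -addrA; congr (_ + _).
Qed.

Lemma linprod_shift h x d s : h * x - x * h = d *: x ->
  linprod h s * x = x * linprod h [seq c - d | c <- s].
Proof.
move=> hx; elim: s => [|c s IH]; first by rewrite /linprod !big_nil mulr1 mul1r.
by rewrite map_cons !linprod_cons -mulrA IH mulrA (linear_shift _ hx) mulrA.
Qed.

Lemma linprod_eig h c v s : eig h c v ->
  uact (linprod h s) v = (\prod_(d <- s) (c - d)) *: v.
Proof.
move=> hv; elim: s => [|d s IH].
  by rewrite /linprod !big_nil uact1 scale1r.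
rewrite linprod_cons uactM IH big_cons uact_linear !uactZr hv.
by rewrite !scalerA -scalerBl [d * _]mulrC -mulrBr mulrC.
Qed.

(** Lagrange interpolation. The eigenvectors obtained are polynomials in h applied to v,
    so they stay in any h-stable subspace P containing v; this is how several commuting
    operators are diagonalised at once. *)
Lemma sums_eig (P : V -> Prop) h s v :
    (forall c u w, P u -> P w -> P (c *: u + w)) ->
    (forall u, P u -> P (uact h u)) ->
    uniq s -> P v -> uact (linprod h s) v = 0 ->
  sums (fun y => P y /\ exists2 c, c \in s & eig h c y) v.
Proof.
move=> PL Ph.
have PX c u : P u -> P (uact (h - c%:A) u).
  by move=> Pu; rewrite uact_linear addrC -scaleNr; apply: PL => //; apply: Ph.
elim: s v => [|c s IH] v /=.
  by move=> _ _; rewrite /linprod big_nil uact1 => ->; apply: sums0.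
case/andP=> cs us Pv; rewrite linprod_cons linprod_comm uactM => /(IH _ us (PX _ _ Pv)).
have P0 : P 0 by rewrite -(addNr v) -scaleN1r; apply: PL.
set Q := fun y => _; set Q' := fun y => _ => Sv.
(* h - c is invertible on the span of the eigenvectors for the other roots *)
have inv w : sums Q w -> exists2 w', sums Q' w' /\ P w' & uact (h - c%:A) w' = w.
  elim=> [|a b [Pa [d ds ha]] _ [b' [Sb' Pb'] bE]].
    exists 0; rewrite ?uact0r //; split => //; exact: sums0.
  have dc : d - c != 0 by rewrite subr_eq0; apply: contra cs => /eqP <-.
  have PZa : P ((d - c)^-1 *: a) by rewrite -[_ *: a]addr0; apply: PL.
  exists ((d - c)^-1 *: a + b'); first split.
  - apply: sums_cons => //; split=> //; exists d; first by rewrite inE ds orbT.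
    by rewrite /eig uactZr ha !scalerA mulrC.
  - exact: PL.
  rewrite uactDr bE uactZr uact_linear ha -scalerBl scalerA mulVf // scale1r //.
have [w' [Sw' Pw'] w'E] := inv _ Sv.
rewrite -(subrK w' v); apply: sums_cons => //; split.
  by rewrite addrC -scaleN1r; apply: PL.
exists c; first by rewrite inE eqxx.
by apply/eqP; rewrite -subr_eq0 -uact_linear uactDr -[- w']scaleN1r uactZr w'E scaleN1r subrr.
Qed.

Lemma linprod_sub h s t v : uniq s -> {subset s <= t} ->
  uact (linprod h s) v = 0 -> uact (linprod h t) v = 0.
Proof.
elim: t s v => [|c t IH] s v us st.
  by case: s us st => [|d s] _ st //; have := st d; rewrite inE eqxx => /(_ isT).
have [cs|cs] := boolP (c \in s).
  move=> s0; rewrite linprod_cons linprod_comm uactM; apply: (IH (rem c s)).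
  - exact: rem_uniq.
  - move=> x; rewrite mem_rem_uniq // !inE => /andP[xc /st].
    by rewrite inE (negPf xc).
  rewrite -uactM -linprod_comm -linprod_cons -s0; congr (uact _ _).
  suff H (r : seq K) : c \in r -> linprod h (c :: rem c r) = linprod h r by apply: H.
  elim: r => [//|d r IHr]; rewrite inE /=; case: eqVneq => [->//|dc] /=.
  move=> /IHr; rewrite !linprod_cons => <-.
  rewrite !mulrA; congr (_ * _).
  by have := linprod_comm h [:: d] c; rewrite /linprod !big_seq1.
move=> s0; rewrite linprod_cons uactM (IH s) ?uact0r //.
by move=> x xs; have := st x xs; rewrite inE => /orP[/eqP xc|//]; rewrite -xc xs in cs.
Qed.

Lemma eig_linprod h (Q : K -> Prop) v :
  sums (fun y => exists2 c, Q c & eig h c y) v ->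
  exists2 s, uniq s /\ (forall c, c \in s -> Q c) & uact (linprod h s) v = 0.
Proof.
elim=> [|a b [c Qc hc] _ [s [us sQ] sb]].
  by exists [::]; rewrite ?uact0r.
have sub : {subset s <= undup (c :: s)} by move=> x xs; rewrite mem_undup inE xs orbT.
exists (undup (c :: s)).
  split=> [|d]; first exact: undup_uniq.
  by rewrite mem_undup inE => /orP[/eqP->|/sQ].
rewrite uactDr (linprod_sub us sub sb) addr0 (linprod_eig _ hc).
have ct : c \in undup (c :: s) by rewrite mem_undup inE eqxx.
rewrite (perm_big _ (perm_to_rem ct)) big_cons subrr.
by rewrite [X in X *: _]mul0r scale0r.
Qed.

Lemma eigD h c u v : eig h c u -> eig h c v -> eig h c (u + v).
Proof. by rewrite /eig uactDr scalerDr => -> ->. Qed.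
Lemma eigZ h c d u : eig h c u -> eig h c (d *: u).
Proof. by rewrite /eig uactZr !scalerA mulrC -scalerA => ->; rewrite scalerA. Qed.
Lemma eig_shift h x d c v : h * x - x * h = d *: x -> eig h c v -> eig h (c + d) (uact x v).
Proof.
move/eqP; rewrite subr_eq => /eqP hx; rewrite /eig -uactM hx uactDl uactM => ->.
by rewrite uactZl uactZr -scalerDl addrC.
Qed.

End Eigen.

(** * Modules over sl2 *)

(** Stated for a triple in any algebra, in order to be used for (e, f, h) and for
    (f, e, -h). *)
Lemma sl2_pow (K : fieldType) (B : algType K) (x y z : B) k :
    x * y - y * x = z -> z * y - y * z = - 2%:R *: y ->
  x * y ^+ k.+1 - y ^+ k.+1 * x = k.+1%:R *: (y ^+ k * (z - k%:R%:A)).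
Proof.
move=> xy zy; elim: k => [|k IH].
  by rewrite !expr1 expr0 scale0r subr0 mul1r scale1r.
have -> : x * y ^+ k.+2 - y ^+ k.+2 * x
     = (x * y ^+ k.+1 - y ^+ k.+1 * x) * y + y ^+ k.+1 * (x * y - y * x).
  by rewrite mulrBl mulrBr (mulrA _ y x) -(mulrA x) -!exprSr (mulrA _ x y) addrA subrK.
move/eqP: zy; rewrite subr_eq => /eqP zy.
rewrite IH xy -scalerAl -mulrA mulrBl zy -scalerAl mul1r.
rewrite (_ : _ + y * z - _ = y * (z - (k.+2)%:R%:A)); last first.
  rewrite mulrBr -(scalerAr k.+2%:R) mulr1 addrAC -scalerBl addrC -scaleNr.
  by congr (_ + _ *: _); rewrite -[in RHS]addn2 natrD [RHS]opprD addrC.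
rewrite mulrA -exprSr !mulrBr -!(scalerAr _ (y ^+ k.+1)) mulr1 !scalerBr !scalerA addrAC.
by rewrite -{2}[_ * z]scale1r -scalerDl natr1 [k.+1%:R * _]mulrC.
Qed.

Section Sl2.
Context {K : numClosedFieldType} {L : lieAlgType K} {V : lieMod L}.
Variables h e f : envel L.
Hypotheses (he : h * e - e * h = 2%:R *: e) (hf : h * f - f * h = - 2%:R *: f).
Hypothesis ef : e * f - f * e = h.

(** On the kernel of e, the product e^k f^k is a polynomial in h with simple roots
    0, ..., k - 1. As f is nilpotent, h is diagonalisable there. *)
Lemma ker_e_linprod k (w : V) : uact e w = 0 ->
  uact (e ^+ k * f ^+ k) w = k`!%:R *: uact (linprod h [seq i%:R | i <- iota 0 k]) w.
Proof.
elim: k w => [|k IH] w ew; first by rewrite /linprod big_nil mulr1 scale1r.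
have eXw : uact e (uact (h - k%:R%:A) w) = 0.
  rewrite -uactM -[k%:R](addrK 2%:R) -(linear_shift _ he) uactM ew.
  exact: uact0r.
have fh : f * h - h * f = 2%:R *: f by rewrite -opprB hf scaleNr opprK.
have := sl2_pow k ef; rewrite hf => /(_ erefl)/eqP; rewrite subr_eq => /eqP efk.
rewrite exprSr -mulrA efk mulrDr uactDl -scalerAr uactZl mulrA !uactM ew !uact0r addr0.
rewrite -uactM (IH _ eXw) scalerA -natrM factS -[in iota 0 k.+1]addn1 iotaD map_cat linprod_cat.
by rewrite uactM [linprod h (map _ (iota _ 1))]big_seq1.
Qed.

(** On a weight space of positive weight, with e nilpotent, e f is invertible: by
    [sl2_pow] it acts on the successive quotients of the filtration by the kernels of the
    e^k as the nonzero integers (k + 1) (n + 1 + k). *)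
Lemma pos_lift k n (d : V) : uact (e ^+ k) d = 0 -> eig h n.+1%:R d ->
  exists2 y, eig h n.+1%:R y & d = uact e (uact f y).
Proof.
have eigef (y : V) : eig h n.+1%:R y -> eig h n.+1%:R (uact e (uact f y)).
  by move=> /(eig_shift hf)/(eig_shift he); rewrite addrNK.
elim: k d => [|k IH] d.
  rewrite uact1 => -> _; exists 0; last by rewrite !uact0r.
  by rewrite /eig uact0r scaler0.
move=> ekd scoroot_dual; pose a : K := k.+1%:R * (n.+1 + k)%:R.
have a0 : a != 0 by rewrite mulf_neq0 // pnatr_eq0.
have fe : f * e - e * f = - h by rewrite -opprB ef.
have he' : - h * e - e * - h = - 2%:R *: e by rewrite mulNr mulrN -opprD he scaleNr.
have := congr1 (fun u => uact u d) (sl2_pow k fe he').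
rewrite /= uactB uactZl !uactM ekd uact0r sub0r uact_linear uactNl scoroot_dual.
rewrite -opprD -scalerDl -natrD -scaleNr uactZr scalerA mulrN scaleNr => /oppr_inj.
rewrite -/a => eE.
have [y hy yE] : exists2 y, eig h n.+1%:R y
    & uact e (uact f d) - a *: d = uact e (uact f y).
  apply: IH; last by apply: eigD (eigef _ scoroot_dual) _; rewrite -scaleNr; apply: eigZ.
  by rewrite uactDr -scaleNr uactZr -uactM -exprSr eE scaleNr subrr.
exists (a^-1 *: (d - y)).
  by apply/eigZ/eigD => //; rewrite -scaleN1r; apply: eigZ.
rewrite !uactZr -scaleN1r !uactDr !uactZr -yE scaleN1r opprB addrCA subrr addr0.
by rewrite scalerA mulVf ?scale1r.
Qed.

Definition pos_int (c : K) := exists n, c = n.+1%:R.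
Definition nonpos_int (c : K) := exists n, c = - n%:R.

Hypotheses (en : forall v : V, exists k, uact (e ^+ k) v = 0).
Hypotheses (fn : forall v : V, exists k, uact (f ^+ k) v = 0).

(** Induction on k such that e^k v = 0. By induction e v is a sum of eigenvectors; those of
    positive weight lift to eigenvectors by [pos_lift], so they can be subtracted. If the
    remaining ones have weights c in a set s, then the product of the h - (c - 2) maps v
    into the kernel of e, where [ker_e_linprod] applies. The roots c - 2 are negative and
    those coming from the kernel of e are natural numbers, so all of them are distinct. *)
Lemma sl2_eig (v : V) : sums (fun y => exists2 c, pos_int c \/ nonpos_int c & eig h c y) v.
Proof.
have [k] := en v; elim: k v => [|k IH] v.
  by rewrite uact1 => ->; apply: sums0.
rewrite exprSr uactM => /IH ev.
have [a [b [Sa Sb abE]]] : exists a b,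
   [/\ sums (fun y => exists2 c, pos_int c & eig h c y) a,
     sums (fun y => exists2 c, nonpos_int c & eig h c y) b & uact e v = a + b].
  elim: ev => [|x y [c cI hx] _ [a [b [Sa Sb ->]]]].
    by exists 0, 0; split; rewrite ?addr0 //; apply: sums0.
  case: cI => cI; [exists (x + a), b|exists a, (x + b)]; split=> //.
  - by apply: sums_cons => //; exists c.
  - by rewrite addrA.
  - by apply: sums_cons => //; exists c.
  - by rewrite addrCA.
have [y Sy yE] : exists2 y, sums (fun y => exists2 c, pos_int c \/ nonpos_int c & eig h c y) y
    & uact e y = a.
  elim: Sa => [|x z [c [n ->] hx] _ [z' Sz' <-]].
    by exists 0; [apply: sums0|rewrite uact0r].
  have [i ei] := en x; have [x' hx' ->] := pos_lift ei hx.
  exists (uact f x' + z'); last by rewrite uactDr.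
  apply: sums_cons => //; exists (n.+1%:R - 2%:R); last exact: eig_shift hx'.
  case: n {hx hx'} => [|[|n]].
    by right; exists 1; rewrite -natr1 add0r opprD addrA subrr sub0r.
    by right; exists 0; rewrite subrr oppr0.
  by left; exists n; rewrite -addn2 natrD addrK.
rewrite -(subrK y v); apply: sumsD Sy.
have ev' : uact e (v - y) = b by rewrite uactDr -scaleN1r uactZr scaleN1r yE abE addrC addKr.
have [s [us sN] s0] := eig_linprod Sb.
pose s' := [seq c - 2%:R | c <- s].
have es' : uact e (uact (linprod h s') (v - y)) = 0.
  by rewrite -uactM -(linprod_shift _ he) uactM ev'.
have [N fN] := fn (uact (linprod h s') (v - y)).
have := ker_e_linprod N es'; rewrite uactM fN uact0r => /esym/eqP.
rewrite scaler_eq0 pnatr_eq0 eqn0Ngt fact_gt0 /= -uactM -linprod_cat => /eqP P0.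
have := sums_eig (P := fun _ => True) (fun _ _ _ _ _ => I) (fun _ _ => I) _ I P0.
have pnI (c : K) : c \in [seq i%:R | i <- iota 0 N] ++ s' -> pos_int c \/ nonpos_int c.
  rewrite mem_cat => /orP[/mapP[i _ ->]|/mapP[d /sN[n ->] ->]].
    by case: i => [|i]; [right; exists 0|left; exists i]; rewrite ?oppr0.
  by right; exists (n + 2)%N; rewrite -opprD -natrD.
move=> H; apply: sums_sub (H _) => [z [_ [c /pnI cI hc]]|]; first by exists c.
rewrite cat_uniq !map_inj_uniq ?iota_uniq ?us ?andbT /=; last first.
- by move=> i j /eqP; rewrite eqr_nat => /eqP.
- exact: addIr.
apply/hasPn => c /mapP[d /sN[n ->] ->]; apply/mapP => -[i _] /eqP.
by rewrite -opprD -natrD -subr_eq0 -opprD -natrD oppr_eq0 pnatr_eq0 addn2.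
Qed.

End Sl2.

(** * Finite-dimensional stable subspaces *)

Section Span.
Context {K : fieldType} {L : lieAlgType K} {V : lieMod L}.

Lemma in_span_lin n (b : 'I_n -> V) c u v :
  in_span b u -> in_span b v -> in_span b (c *: u + v).
Proof.
move=> [x ->] [y ->]; exists (fun i => c * x i + y i).
rewrite scaler_sumr -big_split; apply: eq_bigr => i _.
by rewrite scalerDl scalerA.
Qed.

Lemma in_span0 n (b : 'I_n -> V) : in_span b 0.
Proof. by exists (fun=> 0); rewrite big1 // => i _; rewrite scale0r. Qed.

Lemma in_spanZ n (b : 'I_n -> V) c u : in_span b u -> in_span b (c *: u).
Proof. by move=> bu; rewrite -[_ *: _]addr0; apply: in_span_lin => //; apply: in_span0. Qed.

Lemma in_spanD n (b : 'I_n -> V) u v : in_span b u -> in_span b v -> in_span b (u + v).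
Proof. by move=> bu bv; rewrite -[u]scale1r; apply: in_span_lin. Qed.

Lemma in_span_gen n (b : 'I_n -> V) i : in_span b (b i).
Proof.
exists (fun j => (j == i)%:R); rewrite (bigD1 i) //= eqxx scale1r big1 ?addr0 //.
by move=> j /negPf ->; rewrite scale0r.
Qed.

Lemma in_span_min n (b : 'I_n -> V) (P : V -> Prop) v :
    P 0 -> (forall c u w, P u -> P w -> P (c *: u + w)) -> (forall i, P (b i)) ->
  in_span b v -> P v.
Proof.
move=> P0 PL Pb [c ->]; elim/big_rec: _ => [//|i x _ Px]; exact: PL.
Qed.

Definition stable_span n (b : 'I_n -> V) := forall x i, in_span b (lact x (b i)).

Lemma stable_lact n (b : 'I_n -> V) x v :
  stable_span b -> in_span b v -> in_span b (lact x v).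
Proof.
move=> sb; apply: (@in_span_min n b (fun v => in_span b (lact x v))) => [|c u w bu bw|//].
  by rewrite lact0r; apply: in_span0.
by rewrite lact_linr; apply: in_span_lin.
Qed.

Lemma stable_uact n (b : 'I_n -> V) u v :
  stable_span b -> in_span b v -> in_span b (uact u v).
Proof.
move=> sb; elim/(@envel_ind K L): u v => [c|x|s t IHs IHt|s t IHs IHt] v bv.
- by rewrite uact_cst; apply: in_spanZ.
- by rewrite uact_gen; apply: stable_lact.
- by rewrite uactDl; apply: in_spanD; [apply: IHs|apply: IHt].
- by rewrite uactM; apply/IHs/IHt.
Qed.

(** Coordinates identify the span with a quotient of K^n, where a subspace of
   maximal dimension among those mapped into P exists and is everything. *)
Lemma in_span_sub n (b : 'I_n -> V) (P : V -> Prop) :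
    P 0 -> (forall c u w, P u -> P w -> P (c *: u + w)) ->
  exists m (b' : 'I_m -> V), (forall i, P (b' i)) /\
    forall v, P v -> in_span b v -> in_span b' v.
Proof.
move=> P0 PL; pose phi (c : 'rV[K]_n) := \sum_i c 0 i *: b i.
have phiL c x y : phi (c *: x + y) = c *: phi x + phi y.
  rewrite /phi scaler_sumr -big_split; apply: eq_bigr => i _.
  by rewrite !mxE scalerDl scalerA.
have phi0 : phi 0 = 0 by rewrite /phi big1 // => i _; rewrite mxE scale0r.
pose good d := exists2 U : {vspace 'rV[K]_n}, (forall c, c \in U -> P (phi c)) & \dim U = d.
have g0 : exists d, `[< good d >].
  exists 0; apply/asboolP; exists 0%VS; last exact: dimv0.
  by move=> c; rewrite memv0 => /eqP ->; rewrite phi0.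
have gb d : `[< good d >] -> (d <= \dim (fullv : {vspace 'rV[K]_n}))%N.
  by move=> /asboolP[U _ <-]; apply/dimvS/subvf.
have [d /asboolP[U UP <-] dmax] := ex_maxnP g0 gb.
exists (\dim U), (fun i => phi (vbasis U)`_i); split=> [i|v Pv [c cE]].
  by apply/UP/vbasis_mem/mem_nth; rewrite size_tuple.
pose r := \row_i c i; have rE : phi r = v.
  by rewrite cE; apply: eq_bigr => i _; rewrite mxE.
have rU : r \in U.
  have gUr : forall x, x \in (U + <[r]>)%VS -> P (phi x).
    move=> x /memv_addP[y yU [z /vlineP[k ->] ->]].
    rewrite addrC phiL rE; apply: PL => //; exact: UP.
  have := dmax (\dim (U + <[r]>)%VS); rewrite asboolT; last by exists (U + <[r]>)%VS.
  move=> /(_ isT) dle; have UE : U = (U + <[r]>)%VS.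
    by apply/eqP; rewrite eqEdim addvSl.
  by rewrite UE; apply: subvP (addvSr _ _) _ (memv_line r).
rewrite -rE (coord_vbasis rU).
exists (fun i => coord (vbasis U) i r).
have phiS (I : Type) (s : seq I) (k : I -> K) (F : I -> 'rV[K]_n) :
    phi (\sum_(i <- s) k i *: F i) = \sum_(i <- s) k i *: phi (F i).
  elim: s => [|i s IH]; first by rewrite !big_nil.
  by rewrite !big_cons phiL IH.
by rewrite phiS.
Qed.

End Span.

Section SpanOperators.
Context {K : numClosedFieldType} {L : lieAlgType K} {V : lieMod L}.
Implicit Types (h x : envel L) (s t : seq K).

(** The characteristic polynomial of a matrix of h on the spanning family b; the family
    need not be free, as Cayley-Hamilton holds on the level of coordinates. *)
Lemma span_linprod n (b : 'I_n -> V) h : stable_span b ->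
  exists s, forall v, in_span b v -> uact (linprod h s) v = 0.
Proof.
case: n b => [|n] b sb.
  by exists [::] => v [c ->]; rewrite big_ord0 uact0r.
have /choice[X XE] i : exists c : 'I_n.+1 -> K, uact h (b i) = \sum_j c j *: b j.
  exact: stable_uact (in_span_gen b i).
pose M := \matrix_(i, j) X i j.
pose phi (c : 'rV[K]_n.+1) := \sum_i c 0 i *: b i.
have phiM c : uact h (phi c) = phi (c *m M).
  rewrite /phi; transitivity (\sum_i \sum_j (c 0 i * X i j) *: b j).
    elim/big_ind2: _ => [|u u' v v' <- <-|i _]; rewrite ?uact0r ?uactDr //.
    by rewrite uactZr XE scaler_sumr; apply: eq_bigr => j _; rewrite scalerA.
  rewrite exchange_big; apply: eq_bigr => j _; rewrite mxE scaler_suml.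
  by apply: eq_bigr => i _; rewrite mxE.
have [s sE] := closed_field_poly_normal (char_poly M).
rewrite (monicP (char_poly_monic M)) scale1r in sE.
exists s => v [c vE].
have -> : v = phi (\row_i c i) by rewrite vE; apply: eq_bigr => i _; rewrite mxE.
have phiP t r : uact (linprod h t) (phi r) = phi (r *m \prod_(k <- rev t) (M - k%:M)).
  elim: t r => [|k t IH] r; first by rewrite /linprod !big_nil uact1 mulmx1.
  rewrite linprod_cons uactM IH rev_cons -cats1 big_cat big_seq1 /=.
  set r' := r *m _; rewrite -[r *m _]/(r *m (_ *m _)) mulmxA -/r' uact_linear phiM mulmxBr.
  by rewrite /phi scaler_sumr -sumrB; apply: eq_bigr => i _;
    rewrite mul_mx_scalar !mxE scalerBl scalerA.
rewrite phiP (_ : \prod_(k <- rev s) _ = 0) ?mulmx0.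
  by rewrite /phi big1 // => i _; rewrite mxE scale0r.
rewrite -(Cayley_Hamilton M) sE (perm_big (rev s)); last by rewrite perm_sym perm_rev.
rewrite rmorph_prod; apply: eq_bigr => k _.
by rewrite rmorphB /= horner_mx_X horner_mx_C.
Qed.

Lemma linprod_disjoint h s t (w : V) : uact (linprod h s) w = 0 -> uact (linprod h t) w = 0 ->
  (forall c, c \in t -> c \notin s) -> w = 0.
Proof.
elim: t w => [|c t IH] w s0; first by rewrite /linprod big_nil uact1.
rewrite linprod_cons uactM => ct0 dis.
apply: IH => // [|d dt]; last by apply: dis; rewrite inE dt orbT.
have hc : eig h c (uact (linprod h t) w).
  by apply/eqP; rewrite -subr_eq0 -uact_linear ct0.
have st : linprod h s * linprod h t = linprod h t * linprod h s.
  by apply/commr_prod => d _; apply/commr_sym/linprod_comm.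
have := linprod_eig s hc; rewrite -uactM st uactM s0 uact0r => /esym/eqP.
rewrite scaler_eq0 => /orP[|/eqP//]; rewrite prodf_seq_eq0 => /hasP[d ds /=].
by rewrite subr_eq0 => /eqP cd; have := dis c; rewrite inE eqxx cd ds => /(_ isT).
Qed.

Lemma shift_exp h x d k : h * x - x * h = d *: x ->
  h * x ^+ k - x ^+ k * h = (d *+ k) *: x ^+ k.
Proof.
move=> hx; elim: k => [|k IH]; first by rewrite mulr1 mul1r subrr scale0r.
have -> : h * x ^+ k.+1 - x ^+ k.+1 * h
    = (h * x ^+ k - x ^+ k * h) * x + x ^+ k * (h * x - x * h).
  by rewrite mulrBl mulrBr exprSr !mulrA addrA subrK.
by rewrite IH hx -scalerAr -scalerAl -exprSr -scalerDl mulrSr.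
Qed.

(** The vector x^k v is killed by the annihilating polynomial of h on the span, and also by
    its translate by k d. For a suitable k they have no common root, so x^k v = 0. *)
Lemma span_nilpotent n (b : 'I_n -> V) h x d v : stable_span b ->
  h * x - x * h = d *: x -> d != 0 -> in_span b v -> exists k, uact (x ^+ k) v = 0.
Proof.
move=> sb hx d0 bv; have [s s0] := span_linprod h sb.
pose D := [seq (c - c') / d | c <- s, c' <- s].
(* the multiples of d exceed in number the differences of roots *)
have [k kD] : exists k, k%:R \notin D.
  apply: contrapT => /forallNP H.
  have : (size [seq k%:R : K | k <- iota 0 (size D).+1] <= size D)%N.
    apply: uniq_leq_size => [|c /mapP[k _ ->]]; last by have /negP := H k; rewrite negbK.
    by rewrite map_inj_uniq ?iota_uniq // => i j /eqP; rewrite eqr_nat => /eqP.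
  by rewrite size_map size_iota ltnn.
exists k; apply: (@linprod_disjoint h s [seq c + d *+ k | c <- s]).
- exact/s0/stable_uact.
- rewrite -uactM (linprod_shift _ (shift_exp k hx)) -map_comp.
  rewrite (eq_map (g := id)) ?map_id; last by move=> c /=; rewrite addrK.
  by rewrite uactM s0 ?uact0r.
- move=> _ /mapP[c cs ->]; apply: contra kD => cks.
  apply/allpairsP; exists (c + d *+ k, c); split=> //=.
  by rewrite addrAC subrr add0r -[d *+ k]mulr_natl mulfK.
Qed.

Lemma common_eig (hs : seq (envel L)) :
    {in hs &, forall h h', h * h' = h' * h} ->
    (forall h (v : V), h \in hs -> sums (fun y => exists c, eig h c y) v) ->
  forall v : V, sums (fun y => exists chi : envel L -> K, {in hs, forall h, eig h (chi h) y}) v.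
Proof.
elim: hs => [|h hs IH] hC hdiag v; first by apply: sums1; exists (fun=> 0).
have : sums (fun y => exists chi : envel L -> K, {in hs, forall h, eig h (chi h) y}) v.
  apply: IH => [a c ah ch|a u ah]; first by apply: hC; rewrite inE ?ah ?ch orbT.
  by apply: hdiag; rewrite inE ah orbT.
apply: (@sums_bind V V _ _ id) => // y [chi yE].
have /eig_linprod[s [us _] s0] : sums (fun y => exists2 c, True & eig h c y) y.
  by apply: sums_sub (hdiag h y (mem_head _ _)) => z [c zc]; exists c.
pose P (u : V) := {in hs, forall h, eig h (chi h) u}.
have PL c (u w : V) : P u -> P w -> P (c *: u + w).
  by move=> Pu Pw a ah; apply: eigD; [apply/eigZ/Pu|apply: Pw].
have Ph (u : V) : P u -> P (uact h u).
  move=> Pu a ah; rewrite /eig -uactM hC ?inE ?eqxx ?ah ?orbT //.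
  by rewrite uactM (Pu a ah) uactZr.
apply: sums_sub (sums_eig PL Ph us yE s0) => z [Pz [c cs hz]].
exists (fun a => if a == h then c else chi a) => a.
by rewrite inE; case: eqVneq => [->|_ /=]; [|apply: Pz].
Qed.

End SpanOperators.

(** * The Chevalley basis and weight decompositions *)

Section Structure.
Context {K : numClosedFieldType} {g : finLieAlgType K} (gs : is_simple g) (D : chevalley g).
Notation W := (weight D).
Notation H := (cartan_lie D).
Implicit Types (mu nu a : W) (x y z : g) (u v : H).

Lemma evDl mu nu v : ev (mu + nu) v = ev mu v + ev nu v.
Proof. by rewrite /ev add_lfunE. Qed.
Lemma ev0l v : ev (0 : W) v = 0.
Proof. by rewrite /ev zero_lfunE. Qed.
Lemma evNl mu v : ev (- mu) v = - ev mu v.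
Proof. by rewrite /ev opp_lfunE. Qed.
Lemma evDr mu u v : ev mu (u + v) = ev mu u + ev mu v.
Proof. exact: (@linearD _ _ _ _ (mu : 'Hom(sub_lie (csa D), K^o))). Qed.
Lemma ev0r mu : ev mu (0 : H) = 0.
Proof. exact: (@linear0 _ _ _ _ (mu : 'Hom(sub_lie (csa D), K^o))). Qed.
Lemma evZr mu c v : ev mu (c *: v) = c * ev mu v.
Proof. exact: (linearZZ (mu : 'Hom(sub_lie (csa D), K^o))). Qed.
Lemma ev_suml (I : Type) (r : seq I) (P : pred I) (F : I -> W) v :
  ev (\sum_(i <- r | P i) F i) v = \sum_(i <- r | P i) ev (F i) v.
Proof. by apply: (big_morph (fun mu => ev mu v)) => [m n|]; rewrite ?evDl ?ev0l. Qed.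
Lemma ev_sumr (I : Type) (r : seq I) (P : pred I) (F : I -> H) mu :
  ev mu (\sum_(i <- r | P i) F i) = \sum_(i <- r | P i) ev mu (F i).
Proof. by apply: (big_morph (ev mu)) => [m n|]; rewrite ?evDr ?ev0r. Qed.
Lemma evMn mu n v : ev (mu *+ n) v = ev mu v *+ n.
Proof. by elim: n => [|n IH]; rewrite ?ev0l // !mulrS evDl IH. Qed.
Lemma ev_inj mu nu : (forall v, ev mu v = ev nu v) -> mu = nu.
Proof. by move=> e; apply/lfunP. Qed.

Lemma root_neq0 a : a \in roots D -> a != 0.
Proof. by move=> /rootsP[]. Qed.

Notation I := ('I_(size (roots D) + rank D)).

Definition cbasis : seq g := [seq xr D a | a <- roots D] ++
  [seq sub_val (coroot D (alpha D i)) | i <- enum 'I_(rank D)].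

Lemma size_cbasis : size cbasis = (size (roots D) + rank D)%N.
Proof. by rewrite size_cat size_map size_map size_enum_ord. Qed.

(** The Chevalley basis is indexed by roots, then simple roots, and split into these two
    kinds with [split]. *)
Definition nth_root (i : 'I_(size (roots D))) : W := (roots D)`_i.
Definition scoroot (j : 'I_(rank D)) : H := coroot D (alpha D j).
Definition chev (i : I) : g :=
  match split i with inl i => xr D (nth_root i) | inr j => sub_val (scoroot j) end.
Definition chev_wt (i : I) : W := match split i with inl i => nth_root i | inr _ => 0 end.

Lemma nth_root_mem i : nth_root i \in roots D.
Proof. exact: mem_nth. Qed.

Lemma nth_rootP a : a \in roots D -> exists i, nth_root i = a.
Proof.
move=> aR; have aI : (index a (roots D) < size (roots D))%N by rewrite index_mem.
by exists (Ordinal aI); rewrite /nth_root /= nth_index.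
Qed.

Lemma chev_nth i : chev i = cbasis`_i.
Proof.
rewrite /chev /cbasis nth_cat size_map; case: splitP => [k ik|k ik].
  by rewrite ik (nth_map 0).
rewrite ik addKn (nth_map k) ?size_enum_ord //=.
by rewrite nth_ord_enum.
Qed.

Definition chev_coef (i : I) (x : g) : K :=
  coord (in_tuple cbasis) (cast_ord (esym size_cbasis) i) x.

Lemma chev_coefP c i x y : chev_coef i (c *: x + y) = c * chev_coef i x + chev_coef i y.
Proof. by rewrite /chev_coef linearP. Qed.
Lemma chev_coefD i x y : chev_coef i (x + y) = chev_coef i x + chev_coef i y.
Proof. by rewrite /chev_coef linearD. Qed.
Lemma chev_coefZ c i x : chev_coef i (c *: x) = c * chev_coef i x.
Proof. by rewrite /chev_coef linearZ. Qed.
Lemma chev_coef_sum i (J : Type) (s : seq J) (F : J -> g) :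
  chev_coef i (\sum_(j <- s) F j) = \sum_(j <- s) chev_coef i (F j).
Proof. by rewrite /chev_coef linear_sum. Qed.

Lemma chev_coefE i j : chev_coef i (chev j) = (i == j)%:R.
Proof.
rewrite chev_nth /chev_coef.
have := @coord_free K g _ (in_tuple cbasis) (cast_ord (esym size_cbasis) j)
  (cast_ord (esym size_cbasis) i) (basis_free (chevalley_basis D)).
by move=> /= ->; rewrite (inj_eq (@cast_ord_inj _ _ _)) eq_sym.
Qed.

Lemma chev_expand x : x = \sum_i chev_coef i x *: chev i.
Proof.
have xs : x \in <<in_tuple cbasis>>%VS by rewrite (span_basis (chevalley_basis D)) memvf.
rewrite {1}(coord_span xs) (reindex (cast_ord (esym size_cbasis))) /=; last first.
  by exists (cast_ord size_cbasis) => i _; rewrite ?cast_ordK ?cast_ordKV.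
by apply: eq_bigr => i _; rewrite chev_nth.
Qed.

Lemma chev_root_vec i : root_vec (chev_wt i) (chev i).
Proof.
rewrite /chev_wt /chev; case: split => [k|k] y; first exact/xr_root/nth_root_mem.
rewrite ev0l scale0r -sub_val_slie; have := csa_abelian gs y (scoroot k).
by rewrite /lie /= => ->; rewrite sub_val0.
Qed.

Lemma chev_wt_root i : chev_wt i = 0 \/ chev_wt i \in roots D.
Proof. by rewrite /chev_wt; case: split => k; [right; apply: nth_root_mem|left]. Qed.

Lemma chev_coef_wt a x i : root_vec a x -> chev_coef i x != 0 -> chev_wt i = a.
Proof.
move=> xa ci; apply: ev_inj => v.
have := congr1 (chev_coef i) (xa v); rewrite chev_coefZ {1}[x]chev_expand lie_sumr chev_coef_sum.
rewrite (bigD1 i) //= lieZr chev_root_vec !chev_coefZ chev_coefE eqxx mulr1 big1 ?addr0.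
  by rewrite mulrC => /(mulIf ci).
by move=> j /negPf ji; rewrite lieZr chev_root_vec !chev_coefZ chev_coefE eq_sym ji !mulr0.
Qed.

Lemma chev_coef_neq0 x : x != 0 -> exists i, chev_coef i x != 0.
Proof.
move=> x0; apply: contrapT => /forallNP H; move/eqP: x0; apply.
rewrite [x]chev_expand big1 // => i _; have /negP := H i.
by rewrite negbK => /eqP ->; rewrite scale0r.
Qed.

Lemma coroot_neq0 a : a \in roots D -> coroot D a != 0.
Proof.
move=> /coroot_norm; apply: contra_eq_neq => ->.
by rewrite ev0r eq_sym pnatr_eq0.
Qed.

Lemma root_vecD a b x y : root_vec a x -> root_vec b y -> root_vec (a + b : W) (lie x y).
Proof.
move=> xa yb v; have := lie_jacobi (sub_val v) x y.
rewrite [lie y (lie _ _)]lieC xa [lie y (sub_val v)]lieC yb lieZl lieNr lieZr.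
move/eqP; rewrite -addrA addr_eq0 opprD !opprK => /eqP ->.
by rewrite evDl scalerDl addrC.
Qed.

Lemma sub_val_wt0 v : root_vec (0 : W) (sub_val v).
Proof.
move=> y; rewrite ev0l scale0r -sub_val_slie; have := csa_abelian gs y v.
by rewrite /lie /= => ->; rewrite sub_val0.
Qed.

(** The bracket of xr a with xr (- a) is a nonzero vector of weight 0, so xr (- a), which
    is a priori any vector, has a component of weight - a. *)
Lemma opp_root a : a \in roots D -> - a \in roots D.
Proof.
move=> aR; have /chev_coef_neq0[j] : sub_val (coroot D a) != 0.
  apply: contra (coroot_neq0 aR) => /eqP c0.
  by apply/eqP/sub_val_inj; rewrite c0 sub_val0.
move=> cj; have j0 := chev_coef_wt (sub_val_wt0 (coroot D a)) cj.
move: cj; rewrite -xr_lie // {1}[xr D (- a)]chev_expand lie_sumr chev_coef_sum.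
move/eqP => cj; have [i ci] : exists i, chev_coef j (lie (xr D a) (chev i)) != 0.
  apply: contrapT => /forallNP H; apply: cj; rewrite big1 // => i _.
  by rewrite lieZr chev_coefZ; have /negP := H i; rewrite negbK => /eqP ->; rewrite mulr0.
have := chev_coef_wt (root_vecD (xr_root aR) (chev_root_vec i)) ci.
rewrite j0 => /esym/eqP; rewrite addrC addr_eq0 => /eqP ia.
have [i0|] := chev_wt_root i; last by rewrite ia.
by move: (root_neq0 aR); rewrite -oppr_eq0 -ia i0 eqxx.
Qed.

Lemma g_ind (P : g -> Prop) :
    (forall c x y, P x -> P y -> P (c *: x + y)) ->
    (forall a, a \in roots D -> P (xr D a)) -> (forall v, P (sub_val v)) ->
  forall x, P x.
Proof.
move=> PL Pr Ph x; rewrite [x]chev_expand.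
have P0 : P 0 by rewrite -(sub_val0 (csa D)); apply: Ph.
elim/big_rec: _ => [//|i y _ Py]; apply: PL => //.
by rewrite /chev; case: split => k //; apply/Pr/nth_root_mem.
Qed.

Lemma scoroot_expand v : v = \sum_j chev_coef (rshift _ j) (sub_val v) *: scoroot j.
Proof.
apply: sub_val_inj; rewrite {1}[sub_val v]chev_expand big_split_ord /= big1 ?add0r.
  rewrite [in RHS](big_morph (@sub_val _ _ _) (@sub_valD _ _ _) (sub_val0 _)).
  apply: eq_bigr => j _; rewrite /chev (unsplitK (inr j)).
  have := sub_val_lin (chev_coef (rshift _ j) (sub_val v)) (scoroot j) 0.
  by rewrite sub_val0 !addr0.
move=> i _; set c := chev_coef _ _.
have [->|/(chev_coef_wt (sub_val_wt0 v))] := eqVneq c 0.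
  by rewrite scale0r.
by rewrite /chev_wt (unsplitK (inl i)) => /eqP; rewrite (negPf (root_neq0 (nth_root_mem i))).
Qed.

Lemma sl2_triple a : a \in roots D ->
  let h := ugen (sub_val (coroot D a)) in let e := ugen (xr D a) in
  let f := ugen (xr D (- a)) in
  [/\ h * e - e * h = 2%:R *: e, h * f - f * h = - 2%:R *: f & e * f - f * e = h].
Proof.
have ugZ c x : ugen (c *: x) = c *: ugen x by have := ugen_lin c x 0; rewrite ugen0 !addr0.
move=> aR; have naR := opp_root aR; split; rewrite -ugen_lie.
- by rewrite xr_root // coroot_norm // ugZ.
- by rewrite xr_root // evNl coroot_norm // ugZ.
- by rewrite xr_lie.
Qed.

Section Integrable.
Variable V : lieMod g.
Hypothesis V_lf : locally_fin_dim V.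

Lemma root_nilp a (v : V) : a \in roots D -> exists k, uact (ugen (xr D a) ^+ k) v = 0.
Proof.
move=> aR; have [he _ _] := sl2_triple aR; have [m [b [bv sb]]] := V_lf v.
by apply: (span_nilpotent sb he) => //; rewrite pnatr_eq0.
Qed.

Lemma coroot_eig a (v : V) : a \in roots D ->
  sums (fun y : V => exists2 c, pos_int c \/ nonpos_int c
    & eig (ugen (sub_val (coroot D a))) c y) v.
Proof.
move=> aR; have [he hf ef] := sl2_triple aR.
by apply: (sl2_eig he hf ef) => w; apply: root_nilp => //; apply: opp_root.
Qed.

Lemma wt_vec_scoroot mu (y : V) :
  (forall j, lact (sub_val (scoroot j)) y = ev mu (scoroot j) *: y) -> wt_vec mu y.
Proof.
move=> hy v; rewrite [v]scoroot_expand; elim/big_rec: _ => [|j u _ IH].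
  by rewrite sub_val0 ev0r lact0l scale0r.
by rewrite sub_val_lin lact_linl hy IH evDr evZr scalerDl scalerA.
Qed.

(** The simple coroots act diagonalisably by the theory of sl2, and commute. A common
    eigenvector is a weight vector because the simple coroots span the Cartan subalgebra;
    its weight is the combination of the fundamental weights given by the eigenvalues. *)
Lemma weight_decomp (v : V) : sums (fun y : V => exists mu : W, wt_vec mu y) v.
Proof.
pose hs := [seq ugen (sub_val (scoroot j)) | j <- enum 'I_(rank D)].
have hsC : {in hs &, forall h h', h * h' = h' * h}.
  move=> _ _ /mapP[i _ ->] /mapP[j _ ->]; apply/eqP.
  rewrite -subr_eq0 -ugen_lie -sub_val_slie; have := csa_abelian gs (scoroot i) (scoroot j).
  by rewrite /lie /= => ->; rewrite sub_val0 ugen0.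
have hsd h (w : V) : h \in hs -> sums (fun y : V => exists c, eig h c y) w.
  move=> /mapP[i _ ->]; apply: sums_sub (coroot_eig w (alpha_root i)) => y [c _ hc].
  by exists c.
apply: sums_sub (common_eig hsC hsd v) => y [chi yE].
exists (\sum_i chi (ugen (sub_val (scoroot i))) *: omega D i); apply: wt_vec_scoroot => j.
have jh : ugen (sub_val (scoroot j)) \in hs by apply/mapP; exists j; rewrite ?mem_enum.
rewrite -uact_gen [LHS](yE _ jh); congr (_ *: _).
rewrite ev_suml (bigD1 j) //= big1 ?addr0.
  by rewrite /ev scale_lfunE [omega _ _ _]omega_coroot eqxx [_ *: _]mulr1.
move=> i /negPf ij.
by rewrite /ev scale_lfunE [omega _ _ _]omega_coroot ij [_ *: _]mulr0.
Qed.

Lemma coroot_int mu (v : V) a : a \in roots D -> wt_vec mu v -> v != 0 ->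
  pos_int (ev mu (coroot D a)) \/ nonpos_int (ev mu (coroot D a)).
Proof.
move=> aR vm v0; have [s [_ sI] s0] := eig_linprod (coroot_eig v aR).
apply: sI; have hv : eig (ugen (sub_val (coroot D a))) (ev mu (coroot D a)) v.
  by rewrite /eig uact_gen.
have /eqP := linprod_eig s hv; rewrite s0 eq_sym scaler_eq0 (negPf v0) orbF.
by rewrite prodf_seq_eq0 => /hasP[c cs /=]; rewrite subr_eq0 => /eqP ->.
Qed.

(** Some f^k kills v, so by [ker_e_linprod] the weight is one of 0, ..., k - 1. *)
Lemma dominant mu (v : V) a : a \in roots D -> wt_vec mu v -> v != 0 ->
  lact (xr D a) v = 0 -> 0 <= ev mu (coroot D a).
Proof.
move=> aR vm v0 ev0; have [he hf ef] := sl2_triple aR.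
have [k fk] := root_nilp v (opp_root aR).
have := ker_e_linprod he hf ef k (w := v); rewrite uact_gen uactM fk uact0r => /(_ ev0)/esym.
have hv : eig (ugen (sub_val (coroot D a))) (ev mu (coroot D a)) v.
  by rewrite /eig uact_gen.
move/eqP; rewrite scaler_eq0 pnatr_eq0 eqn0Ngt fact_gt0 /= (linprod_eig _ hv).
rewrite scaler_eq0 (negPf v0) orbF prodf_seq_eq0 => /hasP[_ /mapP[i _ ->] /=].
by rewrite subr_eq0 => /eqP ->; apply: ler0n.
Qed.

End Integrable.

End Structure.

Arguments chev {K g} D i.
Arguments chev_wt {K g} D i.
Arguments chev_coef {K g} D i x.
Arguments scoroot {K g} D j.
Arguments nth_root {K g} D i.

(** * The Killing form and the Casimir element *)

Section Killing.
Context {K : numClosedFieldType} {g : finLieAlgType K} (gs : is_simple g) (D : chevalley g).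
Notation W := (weight D).
Notation H := (cartan_lie D).
Notation chev := (chev D).
Notation chev_wt := (chev_wt D).
Notation chev_coef := (chev_coef D).
Implicit Types (mu nu a b : W) (x y z : g) (u v : H).

Definition chev_trace (f : g -> g) : K := \sum_i chev_coef i (f (chev i)).
Definition killing x y : K := chev_trace (fun z => lie x (lie y z)).

Lemma chev_coefN i x : chev_coef i (- x) = - chev_coef i x.
Proof. by rewrite -scaleN1r chev_coefZ mulN1r. Qed.

Lemma chev_coef_lie i x y :
  chev_coef i (lie x y) = \sum_k chev_coef k y * chev_coef i (lie x (chev k)).
Proof.
rewrite {1}[y](chev_expand D) lie_sumr chev_coef_sum.
by apply: eq_bigr => k _; rewrite lieZr chev_coefZ.
Qed.

Lemma killingC x y : killing x y = killing y x.
Proof.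
rewrite /killing /chev_trace (eq_bigr _ (fun i _ => chev_coef_lie i x _)) exchange_big.
by apply: eq_bigr => k _; rewrite chev_coef_lie; apply: eq_bigr => i _; rewrite mulrC.
Qed.

Lemma killing_linl c x y z : killing (c *: x + y) z = c * killing x z + killing y z.
Proof.
rewrite /killing /chev_trace mulr_sumr -big_split; apply: eq_bigr => i _.
by rewrite lie_linl chev_coefP.
Qed.
Lemma killing_linr c x y z : killing z (c *: x + y) = c * killing z x + killing z y.
Proof. by rewrite killingC killing_linl !(killingC z). Qed.
Lemma killingDl x y z : killing (x + y) z = killing x z + killing y z.
Proof. by rewrite -[x]scale1r killing_linl scale1r mul1r. Qed.
Lemma killing0l z : killing 0 z = 0.
Proof. by apply: (@addrI _ (killing 0 z)); rewrite -killingDl !addr0. Qed.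
Lemma killingZl c x z : killing (c *: x) z = c * killing x z.
Proof. by rewrite -[c *: x]addr0 killing_linl killing0l addr0. Qed.
Lemma killingZr c x z : killing z (c *: x) = c * killing z x.
Proof. by rewrite killingC killingZl killingC. Qed.
Lemma killingNl x z : killing (- x) z = - killing x z.
Proof. by rewrite -scaleN1r killingZl mulN1r. Qed.
Lemma killing_suml (I : Type) (r : seq I) (F : I -> g) y :
  killing (\sum_(i <- r) F i) y = \sum_(i <- r) killing (F i) y.
Proof. by apply: (big_morph (killing^~ y)) => [a b|]; rewrite ?killingDl ?killing0l. Qed.
Lemma killing_sumr (I : Type) (r : seq I) (F : I -> g) y :
  killing y (\sum_(i <- r) F i) = \sum_(i <- r) killing y (F i).
Proof. by rewrite killingC killing_suml; apply: eq_bigr => i _; rewrite killingC. Qed.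

Lemma lie_lie x y z : lie (lie x y) z = lie x (lie y z) - lie y (lie x z).
Proof.
have /eqP := lie_jacobi x y z; rewrite addrC addr_eq0 => /eqP zxy.
by rewrite lieC zxy opprK (lieC z x) lieNr.
Qed.

(** Both sides are traces of products of three operators, equal by cyclicity of the
    trace. *)
Lemma killing_invariant x y z : killing (lie x y) z = killing x (lie y z).
Proof.
have trB (f h : g -> g) : chev_trace (fun t => f t - h t) = chev_trace f - chev_trace h.
  by rewrite /chev_trace -sumrB; apply: eq_bigr => i _; rewrite chev_coefD chev_coefN.
have trE (f h : g -> g) : f =1 h -> chev_trace f = chev_trace h.
  by move=> fh; rewrite /chev_trace; apply: eq_bigr => i _; rewrite fh.
rewrite /killing.
under trE => t do rewrite lie_lie.
under [RHS]trE => t do rewrite lie_lie lieDr lieNr.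
rewrite !trB; congr (_ - _).
have cyc (f : g -> g) : (forall c (a b : g), f (c *: a + b) = c *: f a + f b) ->
   chev_trace (fun t => lie y (f t)) = chev_trace (fun t => f (lie y t)).
  move=> fL; have f0 : f 0 = 0 by have := fL (-1) 0 0; rewrite scaler0 addr0 scaleN1r addNr.
  have fS (a : g) : f a = \sum_k chev_coef k a *: f (chev k).
    rewrite {1}[a](chev_expand D); elim: (index_enum _) => [|k s IH].
      by rewrite !big_nil.
    by rewrite !big_cons fL IH.
  rewrite /chev_trace (eq_bigr _ (fun i _ => chev_coef_lie i y _)) exchange_big.
  apply: eq_bigr => k _; rewrite [f (lie _ _)]fS chev_coef_sum.
  by apply: eq_bigr => i _; rewrite chev_coefZ mulrC.
by rewrite (cyc (fun t => lie x (lie z t))) // => c a b; rewrite !lie_linr.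
Qed.

Lemma killing_wt a b x y : root_vec a x -> root_vec b y -> a + b != 0 -> killing x y = 0.
Proof.
move=> xa yb ab0; apply: contrapT => /eqP k0; move/eqP: ab0; apply; apply: ev_inj => v.
have := killing_invariant x (sub_val v) y.
rewrite yb lieC xa killingNl killingZl killingZr ev0l => /eqP.
rewrite eq_sym -subr_eq0 opprK -mulrDl mulf_eq0 (negPf k0) orbF => /eqP.
by rewrite evDl addrC.
Qed.

Lemma killing_csa u v :
  killing (sub_val u) (sub_val v) = \sum_i ev (chev_wt i) u * ev (chev_wt i) v.
Proof.
apply: eq_bigr => i _; rewrite (chev_root_vec gs i v) lieZr chev_coefZ.
by rewrite (chev_root_vec gs i u) chev_coefZ chev_coefE eqxx mulr1 mulrC.
Qed.

Definition killing_root a : K := killing (xr D a) (xr D (- a)).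

Lemma killing_coroot a u : a \in roots D ->
  killing (sub_val (coroot D a)) (sub_val u) = ev a u * killing_root a.
Proof.
move=> aR; rewrite -xr_lie // killing_invariant lieC (xr_root (opp_root gs aR)).
by rewrite evNl scaleNr opprK killingZr.
Qed.

Definition adj : lieMod g.
Proof.
exists g (@lie K g).
- exact: lie_linl.
- by move=> c x u v; rewrite lie_linr.
- exact: lie_lie.
Defined.

Lemma adj_lf : locally_fin_dim adj.
Proof.
have sp (v : adj) : in_span (chev : _ -> adj) v.
  by exists (fun i => chev_coef i v); apply: chev_expand.
by move=> v; exists _, (chev : _ -> adj).
Qed.

Lemma xr_neq0 a : a \in roots D -> xr D a != 0.
Proof.
move=> aR; apply: contra (coroot_neq0 aR) => /eqP x0.
by apply/eqP/sub_val_inj; rewrite -xr_lie // x0 lie0l sub_val0.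
Qed.

Lemma ev_coroot_int a b : a \in roots D -> b \in roots D ->
  pos_int (ev b (coroot D a)) \/ nonpos_int (ev b (coroot D a)).
Proof. by move=> aR bR; apply: (coroot_int gs adj_lf aR _ (xr_neq0 bR)); apply: xr_root. Qed.

Lemma int_sqr_ge0 (c : K) : pos_int c \/ nonpos_int c -> 0 <= c * c.
Proof.
by case=> -[m ->]; rewrite ?mulrN ?mulNr ?opprK -natrM ler0n.
Qed.

(** Twice this number is killing (coroot a) (coroot a), which is the sum of the squares of the
    integers b (coroot a) over the roots b, and the root a contributes 4. *)
Lemma killing_root_gt0 a : a \in roots D -> 0 < killing_root a.
Proof.
move=> aR; rewrite -(pmulr_rgt0 _ (ltr0Sn K 1)).
rewrite -(coroot_norm aR) -killing_coroot // killing_csa.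
have [i ia] := nth_rootP aR; rewrite (bigD1 (lshift _ i)) //=.
rewrite {1 2}/chev_wt (unsplitK (inl i)) ia coroot_norm // -natrM.
apply: ltr_wpDr; last by rewrite ltr0n.
apply: sumr_ge0 => j _; apply: int_sqr_ge0; have [->|] := chev_wt_root j.
  by right; exists 0; rewrite ev0l oppr0.
exact: ev_coroot_int.
Qed.

Lemma exists_root : exists a, a \in roots D.
Proof.
case: (boolP (size (roots D) == 0)) => [/eqP r0|r0]; last first.
  by exists (roots D)`_0; rewrite mem_nth // lt0n.
have [[x [y /eqP xy]] _] := gs; case: xy.
have noI (i : 'I_(size (roots D) + rank D)) : False.
  case: (split i) => j; first by case: j => j; rewrite r0.
  by have := alpha_root j; rewrite (size0nil r0).
by rewrite [x](chev_expand D) lie_suml big1 // => i; case: (noI i).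
Qed.

(** By invariance the radical is an ideal; it is not g because killing (xr a) (xr (- a))
    is nonzero for a root a. *)
Lemma killing_nondeg x : (forall y, killing x y = 0) -> x = 0.
Proof.
pose f (x : g) := \row_(i < size (roots D) + rank D) killing x (chev i).
have fL : linear f.
  by move=> c y z; apply/rowP => i; rewrite !mxE killing_linl.
pose fl := GRing.isLinear.Build _ _ _ _ _ fL.
pose F : {linear g -> 'rV[K]_(size (roots D) + rank D)} := HB.pack f fl.
have fP z : reflect (forall y, killing z y = 0) (z \in lker (linfun F)).
  rewrite memv_ker lfunE /=; apply: (iffP eqP) => [z0 y|z0].
    rewrite [y](chev_expand D) killing_sumr big1 // => i _; rewrite killingZr.
    by have /rowP/(_ i) := z0; rewrite !mxE => ->; rewrite mulr0.
  by apply/rowP => i; rewrite !mxE z0.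
have [_ /(_ (lker (linfun F)))] := gs; case.
- move=> y z /fP z0; apply/fP => t; rewrite lieC killingNl killing_invariant z0 oppr0 //.
- by move=> k0 xk; apply/eqP; rewrite -memv0 -k0; apply/fP.
- move=> kT; have [a aR] := exists_root; have := killing_root_gt0 aR.
  have /fP : xr D a \in lker (linfun F) by rewrite kT memvf.
  by move=> /(_ (xr D (- a))); rewrite -/(killing_root a) => ->; rewrite ltxx.
Qed.

Definition coroot_gram := \matrix_(j, k) killing (sub_val (scoroot D j)) (sub_val (scoroot D k)).

Lemma sub_val_sum (m : nat) (c : 'I_m -> K) (F : 'I_m -> H) :
  sub_val (\sum_j c j *: F j) = \sum_j c j *: sub_val (F j).
Proof.
elim/big_rec2: _ => [|j x y _ <-]; first exact: sub_val0.
exact: sub_val_lin.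
Qed.

(** The Killing form is nondegenerate on the Cartan subalgebra, which is orthogonal to the
    root vectors. *)
Lemma coroot_gram_unit : coroot_gram \in unitmx.
Proof.
rewrite -row_free_unit -kermx_eq0; apply/eqP/row_matrixP => i.
rewrite row0; set u := row i _.
have uG : u *m coroot_gram = 0 by apply/sub_kermxP/row_sub.
clearbody u.
pose x := \sum_j u 0 j *: scoroot D j.
have kx k : killing (sub_val x) (sub_val (scoroot D k)) = 0.
  have /rowP/(_ k) := uG; rewrite !mxE => <-; rewrite sub_val_sum killing_suml.
  by apply: eq_bigr => j _; rewrite killingZl !mxE.
have : sub_val x = 0.
  apply: killing_nondeg; apply: (@g_ind K g D (fun y => killing _ y = 0)) => [c y z py pz|a aR|v].
  - by rewrite killing_linr py pz mulr0 addr0.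
  - apply: killing_wt (sub_val_wt0 gs x) (xr_root aR) _.
    by rewrite add0r root_neq0.
  - rewrite (scoroot_expand gs v) sub_val_sum killing_sumr big1 // => k _.
    by rewrite killingZr kx mulr0.
move=> x0; have {}x0 : x = 0 by apply: sub_val_inj; rewrite x0 sub_val0.
apply/rowP => k; rewrite [RHS]mxE; have := ev0r (omega D k).
rewrite -x0 ev_sumr (bigD1 k) //= evZr [ev _ _]omega_coroot eqxx mulr1 big1 ?addr0 //.
by move=> j /negPf jk; rewrite evZr [ev _ _]omega_coroot eq_sym jk mulr0.
Qed.

Definition scoroot_dual (i : 'I_(rank D)) : H := \sum_k invmx coroot_gram k i *: scoroot D k.

Lemma killing_scoroot_dual j i :
  killing (sub_val (scoroot D j)) (sub_val (scoroot_dual i)) = (j == i)%:R.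
Proof.
have /matrixP/(_ j i) := mulmxV coroot_gram_unit; rewrite !mxE => <-.
rewrite sub_val_sum killing_sumr; apply: eq_bigr => k _.
by rewrite killingZr !mxE mulrC.
Qed.

Definition chev_dual (i : 'I_(size (roots D) + rank D)) : g :=
  match split i with
  | inl i => (killing_root (nth_root D i))^-1 *: xr D (- nth_root D i)
  | inr j => sub_val (scoroot_dual j) end.

Lemma killing_dual i j : killing (chev i) (chev_dual j) = (i == j)%:R.
Proof.
have LR (a : 'I_(size (roots D))) (b : 'I_(rank D)) : (lshift _ a == rshift _ b) = false.
  by rewrite -val_eqE /= ltn_eqF // ltn_addr.
have pR (a : 'I_(size (roots D))) := xr_root (nth_root_mem a).
have nR (a : 'I_(size (roots D))) := xr_root (opp_root gs (nth_root_mem a)).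
rewrite -(splitK i) -(splitK j) /chev /chev_dual !unsplitK.
case: (split i) (split j) => a [] b /=.
- rewrite eq_lshift killingZr; case: eqVneq => [->|ab].
    by rewrite mulVf // gt_eqF // killing_root_gt0 // nth_root_mem.
  rewrite (killing_wt (pR a) (nR b)) ?mulr0 // subr_eq0; apply: contra ab => /eqP ab.
  apply/eqP/val_inj/eqP; rewrite -(nth_uniq 0 (ltn_ord a) (ltn_ord b) (roots_uniq D)).
  by apply/eqP; exact: ab.
- rewrite LR (killing_wt (pR a) (sub_val_wt0 gs _)) //.
  by rewrite addr0 root_neq0 // nth_root_mem.
- rewrite eq_sym LR killingZr (killing_wt (sub_val_wt0 gs _) (nR b)) ?mulr0 //.
  by rewrite add0r oppr_eq0 root_neq0 // nth_root_mem.
- by rewrite killing_scoroot_dual eq_rshift.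
Qed.

Lemma killing_chev_dual i x : killing x (chev_dual i) = chev_coef i x.
Proof.
rewrite {1}[x](chev_expand D) killing_suml (bigD1 i) //= killingZl killing_dual eqxx.
rewrite mulr1 big1 ?addr0 //.
by move=> j /negPf ji; rewrite killingZl killing_dual ji mulr0.
Qed.

Lemma chev_dual_expand x : x = \sum_i killing x (chev i) *: chev_dual i.
Proof.
apply/eqP; rewrite -subr_eq0; apply/eqP/killing_nondeg => y.
rewrite killingDl killingNl killing_suml [y in killing x y](chev_expand D) killing_sumr.
apply/eqP; rewrite subr_eq0; apply/eqP; apply: eq_bigr => i _.
by rewrite killingZr killingZl [killing (chev_dual i) y]killingC killing_chev_dual mulrC.
Qed.

Definition casimir : envel g := \sum_i ugen (chev i) * ugen (chev_dual i).

Lemma ugen_sum (I : Type) (r : seq I) (c : I -> K) (F : I -> g) :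
  ugen (\sum_(i <- r) c i *: F i) = \sum_(i <- r) c i *: ugen (F i).
Proof.
elim: r => [|i r IH]; first by rewrite !big_nil ugen0.
by rewrite !big_cons ugen_lin IH.
Qed.

(** The matrices of ad x in the bases chev and chev_dual are opposite transposes of each
    other, by invariance, so the two halves of [ugen x, casimir] cancel. *)
Lemma casimirC (u : envel g) : casimir * u = u * casimir.
Proof.
have gen x : ugen x * casimir = casimir * ugen x.
  apply/eqP; rewrite -subr_eq0 /casimir mulr_sumr mulr_suml -sumrB.
  set F := chev; set F' := chev_dual.
  have -> : \sum_i (ugen x * (ugen (F i) * ugen (F' i)) - ugen (F i) * ugen (F' i) * ugen x)
     = \sum_i ugen (lie x (F i)) * ugen (F' i) + \sum_i ugen (F i) * ugen (lie x (F' i)).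
    rewrite -big_split /=; apply: eq_bigr => i _; rewrite !ugen_lie mulrBl mulrBr !mulrA.
    by rewrite addrA subrK.
  have -> : \sum_i ugen (lie x (chev i)) * ugen (chev_dual i)
      = \sum_i \sum_k chev_coef k (lie x (chev i)) *: (ugen (chev k) * ugen (chev_dual i)).
    apply: eq_bigr => i _; rewrite {1}[lie x (chev i)](chev_expand D) ugen_sum mulr_suml.
    by apply: eq_bigr => k _; rewrite scalerAl.
  have -> : \sum_i ugen (chev i) * ugen (lie x (chev_dual i))
      = \sum_i \sum_k - (chev_coef i (lie x (chev k)) *: (ugen (chev i) * ugen (chev_dual k))).
    apply: eq_bigr => i _; rewrite {1}[lie x (chev_dual i)]chev_dual_expand ugen_sum mulr_sumr.
    apply: eq_bigr => k _; rewrite lieC killingNl killing_invariant killingC killing_chev_dual.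
    by rewrite -scalerAr scaleNr.
  rewrite [X in X + _]exchange_big /= -big_split big1 //= => i _.
  by rewrite -big_split big1 //= => k _; rewrite subrr.
elim/(@envel_ind K g): u => [c|x|s t IHs IHt|s t IHs IHt].
- by rewrite scalar_comm.
- by rewrite gen.
- by rewrite mulrDl mulrDr IHs IHt.
- by rewrite mulrA IHs -!mulrA IHt.
Qed.

(** The form on weights dual to the Killing form on the Cartan subalgebra. *)
Definition weight_form mu nu : K := \sum_j ev mu (scoroot D j) * ev nu (scoroot_dual j).

Lemma weight_formDl mu nu a : weight_form (mu + nu) a = weight_form mu a + weight_form nu a.
Proof. by rewrite /weight_form -big_split; apply: eq_bigr => j _; rewrite evDl mulrDl. Qed.
Lemma weight_formDr mu nu a : weight_form a (mu + nu) = weight_form a mu + weight_form a nu.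
Proof. by rewrite /weight_form -big_split; apply: eq_bigr => j _; rewrite evDl mulrDr. Qed.
Lemma weight_form0l a : weight_form 0 a = 0.
Proof. by rewrite /weight_form big1 // => j _; rewrite ev0l mul0r. Qed.
Lemma weight_form0r a : weight_form a 0 = 0.
Proof. by rewrite /weight_form big1 // => j _; rewrite ev0l mulr0. Qed.

(** Through the Killing form, the root a corresponds to coroot a / killing_root a. *)
Lemma coroot_expand a : a \in roots D ->
  (sub_val (coroot D a)
     = \sum_j (ev a (scoroot_dual j) * killing_root a) *: sub_val (scoroot D j)) /\
  (sub_val (coroot D a)
     = \sum_j (ev a (scoroot D j) * killing_root a) *: sub_val (scoroot_dual j)).
Proof.
move=> aR; have c0 i : killing (sub_val (coroot D a)) (chev (lshift (rank D) i)) = 0.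
  rewrite /chev (unsplitK (inl i)) (killing_wt (sub_val_wt0 gs _) (xr_root (nth_root_mem i))) //.
  by rewrite add0r root_neq0 // nth_root_mem.
split.
  rewrite {1}[sub_val _](chev_expand D) big_split_ord /= big1 ?add0r.
    apply: eq_bigr => j _; rewrite -killing_chev_dual /chev_dual /chev !(unsplitK (inr j)).
    by rewrite killing_coroot.
  move=> i _; rewrite -killing_chev_dual /chev_dual (unsplitK (inl i)) killingZr.
  have nR := xr_root (opp_root gs (nth_root_mem i)).
  rewrite (killing_wt (sub_val_wt0 gs _) nR) ?mulr0 ?scale0r //.
  by rewrite add0r oppr_eq0 root_neq0 // nth_root_mem.
rewrite {1}[sub_val _]chev_dual_expand big_split_ord /= big1 ?add0r; last first.
  by move=> i _; rewrite c0 scale0r.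
apply: eq_bigr => j _; rewrite /chev_dual /chev !(unsplitK (inr j)).
by rewrite killing_coroot.
Qed.

Lemma weight_form_rootr mu a : a \in roots D ->
  weight_form mu a = ev mu (coroot D a) / killing_root a.
Proof.
move=> aR; have k0 : killing_root a != 0 by rewrite gt_eqF // killing_root_gt0.
apply: (mulIf k0); rewrite mulfVK //.
have [e1 _] := coroot_expand aR.
rewrite -sub_val_sum in e1; rewrite (sub_val_inj e1) ev_sumr /weight_form mulr_suml.
by apply: eq_bigr => j _; rewrite evZr -mulrA mulrC.
Qed.
Lemma weight_form_rootl mu a : a \in roots D ->
  weight_form a mu = ev mu (coroot D a) / killing_root a.
Proof.
move=> aR; have k0 : killing_root a != 0 by rewrite gt_eqF // killing_root_gt0.
apply: (mulIf k0); rewrite mulfVK //.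
have [_ e2] := coroot_expand aR.
rewrite -sub_val_sum in e2; rewrite (sub_val_inj e2) ev_sumr /weight_form mulr_suml.
by apply: eq_bigr => j _; rewrite evZr mulrAC.
Qed.

End Killing.

(** * The root lattice and Casimir scalars *)

Section RootLattice.
Context {K : numClosedFieldType} {g : finLieAlgType K} {D : chevalley g}.
Notation W := (weight D).
Implicit Types (a b mu nu : W) (i j : 'I_(rank D)).

Definition simples : seq W := [seq alpha D i | i <- enum 'I_(rank D)].

Lemma size_simples : size simples = rank D.
Proof. by rewrite size_map size_enum_ord. Qed.

Definition root_coord j a : K :=
  coord (in_tuple simples) (cast_ord (esym size_simples) j) (a : dual (csa D)).

Lemma root_coordD j a b : root_coord j (a + b) = root_coord j a + root_coord j b.
Proof. by rewrite /root_coord linearD. Qed.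
Lemma root_coordN j a : root_coord j (- a) = - root_coord j a.
Proof. by rewrite /root_coord linearN. Qed.
Lemma root_coord0 j : root_coord j 0 = 0.
Proof. by rewrite /root_coord linear0. Qed.
Lemma simples_nth i : simples`_i = alpha D i.
Proof. by rewrite (nth_map i) ?size_enum_ord // nth_ord_enum. Qed.

Lemma root_coord_alpha i j : root_coord j (alpha D i) = (i == j)%:R.
Proof.
have := @coord_free K (dual (csa D)) _ (in_tuple simples)
  (cast_ord (esym size_simples) i) (cast_ord (esym size_simples) j)
  (basis_free (alpha_basis D)).
by rewrite /= simples_nth (inj_eq (@cast_ord_inj _ _ _)).
Qed.

Lemma root_coord_sum j (k : 'I_(rank D) -> nat) :
  root_coord j (\sum_i alpha D i *+ k i) = (k j)%:R.
Proof.
have Mn m a : root_coord j (a *+ m) = root_coord j a *+ m.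
  by elim: m => [|m IH]; rewrite ?root_coord0 // !mulrS root_coordD IH.
rewrite (big_morph (root_coord j) (root_coordD j) (root_coord0 j)) (bigD1 j) //=.
rewrite Mn root_coord_alpha eqxx.
by rewrite big1 ?addr0 // => i /negPf ij; rewrite Mn root_coord_alpha ij mul0rn.
Qed.

Lemma root_coord_expand a : a = \sum_j root_coord j a *: (alpha D j : dual (csa D)).
Proof.
have aS : (a : dual (csa D)) \in <<in_tuple simples>>%VS.
  by rewrite (span_basis (alpha_basis D)) memvf.
rewrite {1}(coord_span aS) (reindex (cast_ord (esym size_simples))) /=; last first.
  by exists (cast_ord size_simples) => i _; rewrite ?cast_ordK ?cast_ordKV.
by apply: eq_bigr => i _; rewrite simples_nth.
Qed.

Lemma Qplus0 : in_Qplus (0 : W).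
Proof. by exists (fun=> 0); rewrite big1. Qed.

Lemma QplusD a b : in_Qplus a -> in_Qplus b -> in_Qplus (a + b : W).
Proof.
move=> [k ->] [l ->]; exists (fun i => (k i + l i)%N).
by rewrite -big_split; apply: eq_bigr => i _; rewrite mulrnDr.
Qed.

Lemma Qplus_root_coord a j : in_Qplus a -> 0 <= root_coord j a.
Proof. by move=> [k ->]; rewrite root_coord_sum ler0n. Qed.

Lemma Qplus_anti a : in_Qplus a -> in_Qplus (- a : W) -> a = 0.
Proof.
move=> pa na; rewrite [a]root_coord_expand big1 // => j _.
have := Qplus_root_coord j na; rewrite root_coordN oppr_ge0 => na0.
have /eqP -> : root_coord j a == 0 by rewrite eq_le na0 Qplus_root_coord.
by rewrite scale0r.
Qed.

Lemma root_pm a : a \in roots D -> in_Qplus a \/ in_Qplus (- a : W).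
Proof.
by move=> /alpha_pos[k [->|->]]; [left|right]; exists k; rewrite ?opprK.
Qed.

Lemma Qplus_alpha i : in_Qplus (alpha D i : W).
Proof.
exists (fun j => (j == i)); rewrite (bigD1 i) //= eqxx big1 ?addr0 //.
by move=> j /negPf ->.
Qed.

Lemma wle_trans mu nu a : wle mu nu -> wle nu a -> wle mu a.
Proof. by move=> h h'; rewrite /wle -(subrK nu a) -addrA; apply: QplusD. Qed.

Lemma wle_refl mu : wle mu mu.
Proof. by rewrite /wle subrr; apply: Qplus0. Qed.

Lemma wle_anti mu nu : wle mu nu -> wle nu mu -> mu = nu.
Proof. by move=> h h'; apply/esym/subr0_eq/(Qplus_anti h); rewrite opprB. Qed.

End RootLattice.

Section Rho.
Context {K : numClosedFieldType} {g : finLieAlgType K} (gs : is_simple g) (D : chevalley g).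
Notation W := (weight D).
Variable i : 'I_(rank D).

Definition transverse (l : 'I_(size (roots D) + rank D)) : bool :=
  `[< in_Qplus (chev_wt D l) /\ exists2 j, j != i & root_coord j (chev_wt D l) != 0 >].

(** Adding a multiple of alpha_i does not change the other coordinates of a root. One of them
    is positive here, and a root with a positive coordinate is a positive root. *)
Lemma transverse_stable (b : W) k l : b \in roots D ->
    (forall j, j != i -> root_coord j b = 0) ->
  transverse l -> chev_coef D k (lie (xr D b) (chev D l)) != 0 -> transverse k.
Proof.
move=> bR b0 /asboolP[lQ [j ji lj]] ck; apply/asboolP.
have kE := chev_coef_wt gs (root_vecD (xr_root bR) (chev_root_vec gs l)) ck.
have kj : root_coord j (chev_wt D k) = root_coord j (chev_wt D l).
  by rewrite kE root_coordD b0 // add0r.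
split; last by exists j; rewrite ?kj.
have [k0|kR] := chev_wt_root k; first by move: lj; rewrite -kj k0 root_coord0 eqxx.
have [//|nk] := root_pm kR; move/eqP: lj; case; apply/eqP.
by rewrite eq_le Qplus_root_coord // andbT -kj -oppr_ge0 -root_coordN Qplus_root_coord.
Qed.

(** This is the trace of the coroot of alpha_i, a commutator, on the span of the root
    vectors of the positive roots not proportional to alpha_i, which is stable under
    the two root vectors whose bracket is that coroot ([transverse_stable]). *)
Lemma transverse_sum0 : \sum_(l | transverse l) ev (chev_wt D l) (scoroot D i) = 0.
Proof.
have aR := alpha_root i; have naR := opp_root gs aR.
have ai j : j != i -> root_coord j (alpha D i : W) = 0.
  by rewrite root_coord_alpha [i == j]eq_sym => /negPf ->.
have nai j : j != i -> root_coord j (- alpha D i : W) = 0.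
  by move=> ji; rewrite root_coordN ai ?oppr0.
set x := xr D (alpha D i); set y := xr D (- alpha D i).
have half (u v : g) :
    (forall k l, transverse l -> chev_coef D k (lie v (chev D l)) != 0 -> transverse k) ->
    \sum_(l | transverse l) chev_coef D l (lie u (lie v (chev D l)))
    = \sum_(l | transverse l) \sum_(k | transverse k)
        chev_coef D k (lie v (chev D l)) * chev_coef D l (lie u (chev D k)).
  move=> st; apply: eq_bigr => l Tl; rewrite chev_coef_lie (bigID transverse) /=.
  rewrite [X in _ + X]big1 ?addr0 // => k; apply: contraNeq.
  by rewrite mulf_eq0 negb_or => /andP[/(st _ _ Tl)].
have hx k l : transverse l -> chev_coef D k (lie x (chev D l)) != 0 -> transverse k.
  exact: transverse_stable aR ai.
have hy k l : transverse l -> chev_coef D k (lie y (chev D l)) != 0 -> transverse k.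
  exact: transverse_stable naR nai.
have : \sum_(l | transverse l) (chev_coef D l (lie x (lie y (chev D l)))
         - chev_coef D l (lie y (lie x (chev D l)))) = 0.
  rewrite sumrB !half // exchange_big /=.
  apply/eqP; rewrite subr_eq0; apply/eqP; apply: eq_bigr => l _.
  by apply: eq_bigr => k _; rewrite mulrC.
move=> s0; rewrite -[RHS]s0; apply: eq_bigr => l _.
rewrite -chev_coefN -chev_coefD -lie_lie xr_lie //.
by rewrite (chev_root_vec gs l (scoroot D i)) chev_coefZ chev_coefE eqxx mulr1.
Qed.

Definition positive_root (k : 'I_(size (roots D))) : bool := `[< in_Qplus (nth_root D k) >].

(** This is 2 rho (coroot alpha_i). The positive roots not proportional to alpha_i
    contribute 0 by [transverse_sum0]; a positive root c alpha_i contributes 2 c, and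
    alpha_i is one of them. *)
Lemma rho_gt0 : 0 < \sum_(k | positive_root k) ev (nth_root D k) (scoroot D i).
Proof.
pose tr k := transverse (lshift (rank D) k).
have EwL k : chev_wt D (lshift (rank D) k) = nth_root D k by rewrite /chev_wt (unsplitK (inl k)).
rewrite (bigID tr) /=.
have -> : \sum_(k | positive_root k && tr k) ev (nth_root D k) (scoroot D i) = 0.
  rewrite -[RHS]transverse_sum0 big_split_ord /= [X in _ + X]big_pred0 ?addr0.
    apply: eq_big => k; last by rewrite EwL.
    apply: andb_idl => /asboolP[]; rewrite EwL => kQ _; exact/asboolP.
  move=> k; apply/asboolP => -[_ [j _]].
  by rewrite /chev_wt (unsplitK (inr k)) root_coord0 eqxx.
rewrite add0r; have [k kE] := nth_rootP (alpha_root i).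
have aij (a : W) : (forall j, j != i -> root_coord j a = 0) ->
    ev a (scoroot D i) = root_coord i a * 2%:R.
  move=> a0; rewrite {1}[a]root_coord_expand (bigD1 i) //= big1 ?addr0.
    by rewrite /ev scale_lfunE [_ (scoroot D i)](coroot_norm (alpha_root i)).
  by move=> j ji; rewrite a0 ?scale0r.
have prop l : ~~ tr l -> positive_root l -> forall j, j != i -> root_coord j (nth_root D l) = 0.
  move=> ntr /asboolP lQ j ji; apply: contraNeq ntr => lj; apply/asboolP.
  by rewrite EwL; split=> //; exists j.
rewrite (bigD1 k) /=; last first.
  rewrite /positive_root kE asboolT; last exact: Qplus_alpha.
  apply/asboolPn => -[_ [j /negPf ji]]; rewrite EwL kE.
  by rewrite root_coord_alpha [i == j]eq_sym ji eqxx.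
apply: ltr_wpDr; last by rewrite kE [ev _ _](coroot_norm (alpha_root i)) ltr0n.
apply: sumr_ge0 => l /andP[/andP[lp lt] _]; rewrite aij; last exact: prop.
by rewrite mulr_ge0 ?ler0n // Qplus_root_coord //; apply/asboolP.
Qed.

End Rho.

Section CasimirScalar.
Context {K : numClosedFieldType} {g : finLieAlgType K} (gs : is_simple g) (D : chevalley g).
Notation W := (weight D).
Implicit Types (mu nu a : W).

(** The value (mu, mu + 2 rho) of the Casimir element on a highest weight vector. *)
Definition casimir_scalar mu : K :=
  weight_form mu mu + \sum_(k | positive_root k) weight_form mu (nth_root D k).

Lemma uact_suml (V : lieMod g) (I : Type) (r : seq I) (F : I -> envel g) (v : V) :
  uact (\sum_(i <- r) F i) v = \sum_(i <- r) uact (F i) v.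
Proof. by apply: (big_morph (fun u => uact u v)) => [s t|]; rewrite ?uactDl ?uact0l. Qed.

(** For a positive root a, x_a x_-a v = [x_a, x_-a] v as x_a v = 0; for a negative one
    x_-a v = 0. *)
Lemma casimir_hw (V : lieMod g) mu (v : V) : wt_vec mu v ->
    (forall a, pos_root a -> lact (xr D a) v = 0) ->
  uact (casimir D) v = casimir_scalar mu *: v.
Proof.
move=> vm vp; rewrite uact_suml big_split_ord /= addrC /casimir_scalar scalerDl.
congr (_ + _).
  rewrite /weight_form scaler_suml; apply: eq_bigr => j _.
  rewrite uactM !uact_gen /chev /chev_dual !(unsplitK (inr j)).
  by rewrite (vm (scoroot_dual j)) lactZr (vm (scoroot D j)) scalerA mulrC.
rewrite scaler_suml [RHS]big_mkcond; apply: eq_bigr => k _.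
rewrite uactM !uact_gen /chev /chev_dual !(unsplitK (inl k)) lactZl lactZr.
have kR := nth_root_mem k; have nkR := opp_root gs kR.
rewrite /positive_root; case: asboolP => [kQ|kQ].
  have xv : lact (xr D (nth_root D k)) v = 0 by apply: vp.
  have := lact_lie (xr D (nth_root D k)) (xr D (- nth_root D k)) v; rewrite xv lact0r subr0 => <-.
  by rewrite xr_lie // (vm (coroot D (nth_root D k))) scalerA weight_form_rootr // mulrC.
have nkQ : in_Qplus (- nth_root D k : W) by case: (root_pm kR).
by rewrite vp ?lact0r ?scaler0 //; split.
Qed.

Lemma weight_form_Qplus (k : 'I_(rank D) -> nat) nu (b := \sum_i alpha D i *+ k i) :
  (weight_form b nu = \sum_i (k i)%:R / killing_root (alpha D i) * ev nu (scoroot D i)) /\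
  (weight_form nu b = \sum_i (k i)%:R / killing_root (alpha D i) * ev nu (scoroot D i)).
Proof.
have Ml m a : weight_form (a *+ m) nu = weight_form a nu *+ m.
  by elim: m => [|m IH]; rewrite ?weight_form0l // !mulrS weight_formDl IH.
have Mr m a : weight_form nu (a *+ m) = weight_form nu a *+ m.
  by elim: m => [|m IH]; rewrite ?weight_form0r // !mulrS weight_formDr IH.
split.
  rewrite (big_morph (fun x => weight_form x nu) (id1 := 0) (op1 := +%R)) => [|x y|];
    rewrite ?weight_formDl ?weight_form0l //.
  apply: eq_bigr => i _; rewrite Ml weight_form_rootl ?alpha_root //.
  by rewrite -mulrA mulr_natl [_^-1 * _]mulrC.
rewrite (big_morph (fun x => weight_form nu x) (id1 := 0) (op1 := +%R)) => [|x y|];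
  rewrite ?weight_formDr ?weight_form0r //.
apply: eq_bigr => i _; rewrite Mr weight_form_rootr ?alpha_root //.
by rewrite -mulrA mulr_natl [_^-1 * _]mulrC.
Qed.

(** With b = nu - mu, the difference of the scalars is (b, mu) + (nu, b) + (b, 2 rho). The
    first two terms are nonnegative by dominance and the last one is positive
    by [rho_gt0]. *)
Lemma casimir_scalar_neq mu nu : wle mu nu -> mu != nu ->
    (forall i, 0 <= ev mu (scoroot D i)) -> (forall i, 0 <= ev nu (scoroot D i)) ->
  casimir_scalar mu != casimir_scalar nu.
Proof.
move=> [k bE] mn m0 n0; set b := nu - mu in bE.
have nuE : nu = mu + b by rewrite addrC subrK.
have kk i : 0 < killing_root (alpha D i) by apply: killing_root_gt0 => //; apply: alpha_root.
have kd i : 0 <= (k i)%:R / killing_root (alpha D i).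
  by rewrite mulr_ge0 ?ler0n // invr_ge0 ltW.
pose S tau := \sum_(l | positive_root l) weight_form tau (nth_root D l).
have dE : casimir_scalar nu - casimir_scalar mu = weight_form b mu + weight_form nu b + S b.
  rewrite /casimir_scalar -/(S mu) -/(S nu); have -> : S nu = S mu + S b.
    by rewrite /S -big_split; apply: eq_bigr => l _; rewrite nuE weight_formDl.
  have -> : weight_form nu nu = weight_form mu mu + weight_form b mu + weight_form nu b.
    by rewrite {2}nuE weight_formDr {1}nuE weight_formDl.
  by ring.
rewrite -subr_eq0 -oppr_eq0 opprB dE gt_eqF //.
apply: ltr_wpDl.
  rewrite bE (weight_form_Qplus k mu).1 (weight_form_Qplus k nu).2.
  by rewrite addr_ge0 //; apply: sumr_ge0 => i _; rewrite mulr_ge0.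
rewrite /S bE (eq_bigr _ (fun l _ => (weight_form_Qplus k (nth_root D l)).1)).
rewrite exchange_big /=.
have [i ki] : exists i, k i != 0%N.
  apply: contrapT => /forallNP k0; move/eqP: mn; apply; rewrite nuE bE big1 ?addr0 //.
  by move=> i _; have /negP := k0 i; rewrite negbK => /eqP ->.
have rho (j : 'I_(rank D)) := rho_gt0 gs j.
rewrite (bigD1 i) //= -mulr_sumr; apply: ltr_wpDr.
  by apply: sumr_ge0 => j _; rewrite -mulr_sumr mulr_ge0 //; apply/ltW/rho.
by apply: mulr_gt0 (rho i); apply: divr_gt0 (kk i); rewrite ltr0n lt0n.
Qed.

End CasimirScalar.

(** * Homomorphisms and weight components *)

Section Homs.
Context {K : fieldType} {L : lieAlgType K}.
Implicit Types V W : lieMod L.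

Lemma lmhD V W (f : lmHom V W) u v : f (u + v) = f u + f v.
Proof. by have := lmh_lin f 1 u v; rewrite !scale1r. Qed.
Lemma lmh0 V W (f : lmHom V W) : f 0 = 0.
Proof. by apply: (@addrI _ (f 0)); rewrite -lmhD !addr0. Qed.
Lemma lmhZ V W (f : lmHom V W) c u : f (c *: u) = c *: f u.
Proof. by have := lmh_lin f c u 0; rewrite lmh0 !addr0. Qed.
Lemma lmhN V W (f : lmHom V W) u : f (- u) = - f u.
Proof. by rewrite -scaleN1r lmhZ scaleN1r. Qed.

Lemma lmh_inj V W (f : lmHom V W) : (forall v, f v = 0 -> v = 0) -> injective f.
Proof.
by move=> f0 u v uv; apply/eqP; rewrite -subr_eq0; apply/eqP/f0; rewrite lmhD lmhN uv subrr.
Qed.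

Definition lmh_comp V W U (f : lmHom W U) (h : lmHom V W) : lmHom V U.
Proof.
exists (fun v => f (h v)) => [c u v|x v]; first by rewrite !lmh_lin.
by rewrite !lmh_act.
Defined.

Lemma lmh_inverse V W (f : lmHom V W) : bijective f ->
  exists2 h : lmHom W V, cancel f h & cancel h f.
Proof.
case=> h fK hK.
have hL c u v : h (c *: u + v) = c *: h u + h v by apply: (can_inj fK); rewrite lmh_lin !hK.
have hA x v : h (lact x v) = lact x (h v) by apply: (can_inj fK); rewrite lmh_act !hK.
by exists (LmHom hL hA).
Qed.

Definition lmh_im V W (f : lmHom V W) : lieSub W.
Proof.
exists (fun w => exists v, f v = w); first by exists 0; apply: lmh0.
- by move=> c _ _ [u <-] [v <-]; exists (c *: u + v); rewrite lmh_lin.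
- by move=> x _ [v <-]; exists (lact x v); rewrite lmh_act.
Defined.

Definition lmh_ker V W (f : lmHom V W) : lieSub V.
Proof.
exists (fun v => f v = 0); first exact: lmh0.
- by move=> c u v u0 v0; rewrite lmh_lin u0 v0 scaler0 addr0.
- by move=> x v v0; rewrite lmh_act v0 lact0r.
Defined.

End Homs.

Section Components.
Context {K : numClosedFieldType} {g : finLieAlgType K} {D : chevalley g}.
Notation W := (weight D).
Notation H := (cartan_lie D).
Implicit Types (mu nu : W) (V : lieMod g).

Lemma wt_vec0 V mu : wt_vec mu (0 : V).
Proof. by move=> x; rewrite lact0r scaler0. Qed.
Lemma wt_vecD V mu (u v : V) : wt_vec mu u -> wt_vec mu v -> wt_vec mu (u + v).
Proof. by move=> hu hv x; rewrite lactDr hu hv scalerDr. Qed.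
Lemma wt_vecZ V mu c (v : V) : wt_vec mu v -> wt_vec mu (c *: v).
Proof. by move=> hv x; rewrite lactZr hv !scalerA mulrC. Qed.
Lemma wt_vecN V mu (v : V) : wt_vec mu v -> wt_vec mu (- v).
Proof. by rewrite -scaleN1r; apply: wt_vecZ. Qed.

Lemma wt_neq mu nu : mu != nu -> exists h : H, ev mu h != ev nu h.
Proof.
move=> mn; apply: contrapT => /forallNP e; move/eqP: mn; apply; apply: ev_inj => h.
by apply/eqP; have /negP := e h; rewrite negbK.
Qed.

(** A polynomial u in the Cartan subalgebra separating the weight nu from the
   finitely many other weights occurring in v. *)
Lemma wt_separate V nu (v : V) :
    sums (fun y => exists2 mu, mu != nu & wt_vec mu y) v ->
  exists (u : envel g) (chi : W -> K), [/\ uact u v = 0, chi nu != 0,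
    (forall (V' : lieMod g) mu (y : V'), wt_vec mu y -> uact u y = chi mu *: y)
    & forall (V' : lieMod g) (N : V' -> Prop),
       (forall c x y, N x -> N y -> N (c *: x + y)) ->
       (forall (h : H) x, N x -> N (lact (sub_val h) x)) -> forall x, N x -> N (uact u x)].
Proof.
elim=> [|y b [mu mn ym] _ [u [chi [ub c0 uE uN]]]].
  exists 1, (fun=> 1); split.
  - exact: uact0r.
  - exact: oner_neq0.
  - by move=> V' mu y _; rewrite uact1 scale1r.
  - by move=> V' N _ _ x; rewrite uact1.
have [h hmn] := wt_neq mn.
exists ((ugen (sub_val h) - (ev mu h)%:A) * u), (fun tau => (ev tau h - ev mu h) * chi tau).
split.
- rewrite uactM uactDr ub addr0 (uE _ _ _ ym) uact_linear uact_gen lactZr (ym h) !scalerA.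
  by rewrite mulrC subrr.
- by rewrite mulf_neq0 // subr_eq0 eq_sym.
- move=> V' tau z zt; rewrite uactM (uE _ _ _ zt) uact_linear uact_gen lactZr (zt h).
  by rewrite !scalerA -scalerBl mulrBl [chi tau * _]mulrC.
- move=> V' N NL Nh x Nx; rewrite uactM uact_linear uact_gen addrC -scaleNr.
  by have Nu := uN V' N NL Nh x Nx; apply: NL => //; apply: Nh.
Qed.

Lemma wt_indep V nu (v : V) :
  sums (fun y => exists2 mu, mu != nu & wt_vec mu y) v -> wt_vec nu v -> v = 0.
Proof.
move=> Sv vn; have [u [chi [uv c0 uE _]]] := wt_separate Sv.
move/eqP: (uE _ _ _ vn); rewrite uv eq_sym scaler_eq0 (negPf c0) => /eqP //.
Qed.

Lemma wt_split V (Q : W -> V -> Prop) nu (v : V) :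
    sums (fun y => exists2 mu, wt_vec mu y & Q mu y) v ->
  exists a b, [/\ v = a + b, sums (fun y => wt_vec nu y /\ Q nu y) a
    & sums (fun y => exists2 mu, mu != nu & wt_vec mu y) b].
Proof.
elim=> [|y z [mu ym Qy] _ [a [b [-> Sa Sb]]]].
  by exists 0, 0; split; rewrite ?addr0 //; apply: sums0.
have [mn|mn] := eqVneq mu nu.
  exists (y + a), b; split; rewrite ?addrA //.
  by apply: sums_cons => //; rewrite -mn.
exists a, (y + b); split; rewrite 1?addrCA //.
by apply: sums_cons => //; exists mu.
Qed.

Lemma sums_wt V nu (Q : V -> Prop) (v : V) : sums (fun y => wt_vec nu y /\ Q y) v -> wt_vec nu v.
Proof.
by elim=> [|x y [xn _] _ yn]; [apply: wt_vec0|apply: wt_vecD].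
Qed.

(** Weight spaces are independent: a weight vector written as a sum of weight vectors is
    the sum of those of its own weight. *)
Lemma wt_component V (Q : W -> V -> Prop) nu (v : V) :
    sums (fun y => exists2 mu, wt_vec mu y & Q mu y) v -> wt_vec nu v ->
  sums (fun y => wt_vec nu y /\ Q nu y) v.
Proof.
move=> /(wt_split nu)[a [b [vE Sa Sb]]] vn; have an := sums_wt Sa.
suff -> : v = a by [].
rewrite vE (wt_indep Sb) ?addr0 //.
by have -> : b = v - a; [rewrite vE addrAC subrr add0r|apply: wt_vecD => //; apply: wt_vecN].
Qed.

Lemma sums_seq (Z : zmodType) (P : Z -> Prop) (x : Z) : sums P x ->
  exists2 s : seq Z, (forall y, y \in s -> P y) & x = \sum_(y <- s) y.
Proof.
elim=> [|a b Pa _ [s sP ->]]; first by exists [::]; rewrite ?big_nil.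
by exists (a :: s); rewrite ?big_cons // => y; rewrite inE => /orP[/eqP->|/sP].
Qed.

(** A subspace stable under the Cartan subalgebra contains the weight components of its
    elements, as these are obtained by applying polynomials in the Cartan subalgebra
    ([wt_separate]). So it contains nonzero weight vectors, unless it is 0. *)
Lemma wt_subspace V (N : V -> Prop) (v : V) :
    N 0 -> (forall c x y, N x -> N y -> N (c *: x + y)) ->
    (forall (h : H) x, N x -> N (lact (sub_val h) x)) ->
    (forall mu y, wt_vec mu y -> N y -> y = 0) ->
  sums (fun y => exists mu : W, wt_vec mu y) v -> N v -> v = 0.
Proof.
move=> N0 NL Nh Nwt; pose P (p : W * V) := wt_vec p.1 p.2.
suff H m (s : seq (W * V)) : (size s <= m)%N -> (forall p, p \in s -> P p) ->
    N (\sum_(p <- s) p.2) -> \sum_(p <- s) p.2 = 0.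
  case/sums_seq => s sP ->.
  have [wt wtP] : exists wt : V -> W, forall y, y \in s -> wt_vec (wt y) y.
    have : forall y : V, exists mu : W, y \in s -> wt_vec mu y.
      by move=> y; have [/sP[mu]|] := boolP (y \in s); [exists mu|exists 0].
    by case/choice => wt wtP; exists wt.
  have -> : \sum_(y <- s) y = \sum_(p <- [seq (wt y, y) | y <- s]) p.2 by rewrite big_map.
  by apply: (H _ _ (leqnn _)) => p /mapP[y ys ->]; apply: wtP.
elim: m s => [|m IH] [|p s] //=; rewrite ?big_nil // ltnS => sm sP Nv.
pose nu := p.1; move: Nv; rewrite (bigID (fun q : W * V => q.1 == nu)) /=.
set a := (X in N (X + _)); set b := (X in N (_ + X)) => Nab.
have an : wt_vec nu a.
  rewrite /a big_seq_cond; apply: (big_ind (wt_vec nu)) => [|x y|q /andP[qs /eqP <-]].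
  - exact: wt_vec0.
  - exact: wt_vecD.
  - exact: sP.
have Sb : sums (fun y => exists2 mu, mu != nu & wt_vec mu y) b.
  rewrite /b big_seq_cond; apply: big_ind => [|x y|q /andP[qs qn]].
  - exact: sums0.
  - exact: sumsD.
  - by apply: sums1; exists q.1 => //; apply: sP.
have [u [chi [ub c0 uE uN]]] := wt_separate Sb.
have := uN _ N NL Nh _ Nab; rewrite uactDr ub addr0 (uE _ _ _ an) => Na.
have a0 : a = 0.
  have NZ c x : N x -> N (c *: x) by move=> Nx; rewrite -[_ *: _]addr0; apply: NL.
  by apply: Nwt an _; rewrite -[a](scalerK c0); apply: NZ.
move: Nab; rewrite -/a a0 !add0r /b -big_filter => Nb; apply: IH Nb.
  by rewrite /= eqxx /=; apply: leq_trans sm; rewrite size_filter count_size.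
by move=> q; rewrite mem_filter => /andP[_ /sP].
Qed.

Lemma lmh_wt V X (h : lmHom V X) mu (v : V) : wt_vec mu v -> wt_vec mu (h v).
Proof. by move=> vm x; rewrite -lmh_act vm lmhZ. Qed.

End Components.

Lemma lact_wt (K : fieldType) (g : finLieAlgType K) (D : chevalley g) (L : lieAlgType K)
    (f : lieHom g L) (V : lieMod L) (mu a : weight D) (x : L) (v : V) :
    (forall h : cartan_lie D, lie (f (sub_val h)) x = ev a h *: x) ->
  wt_vec (V := restr f V) mu v -> wt_vec (V := restr f V) (mu + a : weight D) (lact x v).
Proof.
move=> xa vm h; have := lact_lie (f (sub_val h)) x v; rewrite xa lactZl => /eqP.
rewrite eq_sym subr_eq => /eqP /= ->; rewrite [lact (f _) v](vm h) lactZr.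
by rewrite -scalerDl /ev add_lfunE addrC.
Qed.

(** * Uniqueness of highest weight modules *)

Section Generation.
Context {K : fieldType} {L : lieAlgType K} {V : lieMod L}.
Variables (X : L -> Prop) (T : V -> Prop).

Inductive generated : V -> Prop :=
  | gen_base t : T t -> generated t
  | gen_add u v : generated u -> generated v -> generated (u + v)
  | gen_act x v : X x -> generated v -> generated (lact x v).

Hypothesis TZ : forall c t, T t -> T (c *: t).
Hypothesis TL : forall y t, T t -> generated (lact y t).

Lemma generatedZ c v : generated v -> generated (c *: v).
Proof.
elim=> [t Tt|u w _ IHu _ IHw|x w Xx _ IHw].
- exact/gen_base/TZ.
- by rewrite scalerDr; apply: gen_add.
- by rewrite -lactZr; apply: gen_act.
Qed.

(** The easy half of the Poincare-Birkhoff-Witt theorem: to know that products of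
    elements of X applied to T span a submodule, it is enough to move any y past the
    elements of X, at the cost of brackets [y, x], which are again arbitrary elements. *)
Lemma generated_lact y v : generated v -> generated (lact y v).
Proof.
move=> Sv; elim: Sv y => [t Tt|u w _ IHu _ IHw|x w Xx _ IHw] y.
- exact: TL.
- by rewrite lactDr; apply: gen_add.
- have -> : lact y (lact x w) = lact x (lact y w) + lact (lie y x) w.
    by rewrite lact_lie addrC subrK.
  by apply: gen_add => //; apply: gen_act.
Qed.

Lemma generated_uact u v : generated v -> generated (uact u v).
Proof.
elim/(@envel_ind K L): u v => [c|x|s t IHs IHt|s t IHs IHt] v Sv.
- by rewrite uact_cst; apply: generatedZ.
- by rewrite uact_gen; apply: generated_lact.
- by rewrite uactDl; apply: gen_add; [apply: IHs|apply: IHt].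
- by rewrite uactM; apply/IHs/IHt.
Qed.
End Generation.

Section GenerationWeights.
Context {K : numClosedFieldType} {g : finLieAlgType K} {D : chevalley g}.
Context {L : lieAlgType K} (f : lieHom g L) (V : lieMod L).
Notation W := (weight D).
Variables (lam : W) (T : V -> Prop).

(** Needed for L = g and for L = g (x) A, in which the elements x_-b (x) a with b a positive
    root are lowering. *)
Definition lowering (x : L) : Prop :=
  exists2 a : W, a != 0 /\ in_Qplus (- a : W)
  & forall h : cartan_lie D, lie (f (sub_val h)) x = ev a h *: x.

Hypothesis T0 : T 0.
Hypothesis TD : forall t t', T t -> T t' -> T (t + t').
Hypothesis Twt : forall t, T t -> wt_vec (V := restr f V) lam t.

Definition low_or_top (mu : W) (y : V) : Prop := wle mu lam /\ (mu = lam -> T y).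

Lemma generated_weights (v : V) : generated lowering T v ->
  sums (fun y : restr f V => exists2 mu : W, wt_vec mu y & low_or_top mu y) v.
Proof.
elim=> [t Tt|u w _ IHu _ IHw|x w [a [a0 aQ] xa] _ IHw].
- apply: sums1; exists lam; first exact: Twt.
  by split; first exact: wle_refl.
- exact: sumsD.
apply: (@sums_bind _ _ _ _ (lact x)) IHw => [u u'|y [mu ym [ml _]]]; first exact: lactDr.
apply: sums1; exists (mu + a); first exact: lact_wt xa ym.
have la : wle (mu + a) mu by rewrite /wle opprD addrA subrr add0r.
split; first exact: wle_trans ml.
move=> mal; case/eqP: a0; apply: (addrI mu); rewrite addr0; apply: wle_anti => //.
by rewrite mal.
Qed.

Lemma generated_weight_vec (v : V) mu : generated lowering T v -> wt_vec (V := restr f V) mu v ->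
  (mu = lam -> T v) /\ (~ wle mu lam -> v = 0).
Proof.
move=> /generated_weights Sv vm; have := wt_component Sv vm.
elim=> [|x y [_ [ml xT]] _ [yT y0]]; first by split.
split=> mE; last by case: (mE ml).
by apply: TD; [apply: xT|apply: yT].
Qed.

End GenerationWeights.

Definition idHom (K : fieldType) (L : lieAlgType K) : lieHom L L :=
  @LieHom K L L id (fun _ _ _ => erefl) (fun _ _ => erefl).

Lemma uact_dsum (K : fieldType) (L : lieAlgType K) (V V' : lieMod L) u (p : dsum V V') :
  uact u p = (uact u p.1, uact u p.2).
Proof.
elim/(@envel_ind K L): u p => [c|x|s t IHs IHt|s t IHs IHt] p.
- by rewrite !uact_cst.
- by rewrite !uact_gen.
- by rewrite !uactDl IHs IHt.
- by rewrite !uactM IHt IHs.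
Qed.

(** The submodule U(g) z of M + V generated by z = (hw_vec M, v) is the graph of the map
    from M to V to be constructed. [N] is the part of it lying over 0, which is to be
    shown to vanish. *)
Section HighestWeight.
Context {K : numClosedFieldType} {g : finLieAlgType K} (gs : is_simple g) {D : chevalley g}.
Notation W := (weight D).
Context {lam : W} (lamP : in_Pplus lam) (M : hw_module lam).
Context {V : lieMod g} (V_lf : locally_fin_dim V).
Variable v : V.
Hypothesis vl : wt_vec lam v.
Hypothesis vp : forall a, pos_root a -> lact (xr D a) v = 0.

Let S : lieMod g := dsum M V.
Let z : S := (hw_vec M, v).
Let T (t : S) := exists c, t = c *: z.
Let G := generated (lowering (D := D) (idHom g)) T.

Lemma graph_wt : wt_vec lam z.
Proof.
move=> h; have := hw_vec_wt M h; have := vl h => e1 e2.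
by apply/pair_equal_spec; split.
Qed.

Lemma graph_pos a : pos_root a -> lact (xr D a) z = 0.
Proof.
move=> ap; have := vp ap; have := hw_vec_pos M ap => e1 e2.
by apply/pair_equal_spec; split.
Qed.

Lemma lowering_xr a : a \in roots D -> ~ in_Qplus a -> lowering (D := D) (idHom g) (xr D a).
Proof.
move=> aR na; exists a; last exact: xr_root.
by split; [apply: root_neq0|case: (root_pm aR)].
Qed.

Let TZ c t : T t -> T (c *: t).
Proof. by move=> [d ->]; exists (c * d); rewrite scalerA. Qed.
Let TD t t' : T t -> T t' -> T (t + t').
Proof. by move=> [d ->] [e ->]; exists (d + e); rewrite scalerDl. Qed.
Let T0 : T 0.
Proof. by exists 0; rewrite scale0r. Qed.
Let Twt t : T t -> wt_vec (V := restr (idHom g) S) lam t.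
Proof. by move=> [c ->]; apply: (@wt_vecZ _ _ _ S); apply: graph_wt. Qed.

Let TL y t : T t -> G (lact y t).
Proof.
move=> [c ->] {t}; rewrite lactZr; apply: generatedZ => //.
apply: (@g_ind K g D (fun y => G (lact y z))) => [d y1 y2 G1 G2|a aR|h].
- by rewrite lact_linl; apply: gen_add => //; apply: generatedZ.
- have [aQ|aQ] := pselect (in_Qplus a); first by rewrite graph_pos //; apply: gen_base.
  apply: gen_act; first exact: lowering_xr.
  by apply: gen_base; exists 1; rewrite scale1r.
- by rewrite graph_wt; apply: gen_base; exists (ev lam h).
Qed.

Let N (k : S) := k.1 = 0 /\ exists u, k = uact u z.

Let NG k : N k -> G k.
Proof.
move=> [_ [u ->]]; apply: generated_uact => //.
by apply: gen_base; exists 1; rewrite scale1r.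
Qed.

Let N_lact y k : N k -> N (lact y k).
Proof.
move=> [k1 [u ku]]; split; first by rewrite /= k1 lact0r.
by exists (ugen y * u); rewrite uactM -ku uact_gen.
Qed.

Let N_lin c k l : N k -> N l -> N (c *: k + l).
Proof.
move=> [k1 [u ku]] [l1 [w lw]]; split; first by rewrite /= k1 l1 scaler0 addr0.
by exists (c *: u + w); rewrite uactDl uactZl -ku -lw.
Qed.

Let lam_dominant i : 0 <= ev lam (scoroot D i).
Proof.
have [k ->] := lamP; rewrite ev_suml sumr_ge0 // => j _.
by rewrite evMn [ev _ _]omega_coroot mulrn_wge0 // ler0n.
Qed.

Lemma graph_top y : N y -> wt_vec lam y -> y = 0.
Proof.
move=> Ny yl; have [/(_ erefl)[c yE] _] := generated_weight_vec T0 TD Twt (NG Ny) yl.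
have [y1 _] := Ny; rewrite yE in y1 *; move/eqP: y1.
rewrite [(_ *: _).1]/= scaler_eq0 (negPf (hw_vec_neq0 M)) orbF.
by move/eqP => ->; rewrite scale0r.
Qed.

(** Induction on the height of the difference of lam and the weight of y. By induction the
    positive root vectors kill y, so y is a highest weight vector. As the Casimir element is
    central it acts on y as on z, which contradicts [casimir_scalar_neq]. *)
Lemma graph_no_wt m (k : 'I_(rank D) -> nat) y : (\sum_i k i <= m)%N -> N y ->
  wt_vec (lam - \sum_i alpha D i *+ k i : W) y -> y = 0.
Proof.
elim: m k y => [|m IH] k y km Ny; set b := \sum_i _ => yb.
  suff b0 : b = 0 by rewrite b0 subr0 in yb; apply: graph_top.
  rewrite /b big1 // => i _; move: km; rewrite leqn0 sum_nat_eq0.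
  by move=> /forallP/(_ i)/eqP ->.
have [b0|b0] := eqVneq b 0; first by rewrite b0 subr0 in yb; apply: graph_top.
apply: contrapT => /eqP y0.
have yp a : pos_root a -> lact (xr D a) y = 0.
  move=> [aR [ka aE]]; have yab := lact_wt (f := idHom g) (xr_root aR) yb.
  have Nay := N_lact (xr D a) Ny.
  have [_ na] := generated_weight_vec T0 TD Twt (NG Nay) yab.
  have [[l lE]|] := pselect (wle (lam - b + a) lam); last exact: na.
  have bE : b = \sum_i alpha D i *+ (l i + ka i)%N.
    rewrite (eq_bigr _ (fun i _ => mulrnDr _ _ _)) big_split /= -lE -aE.
    by rewrite opprD opprB addrA subrK addrC subrK.
  have kE i : k i = (l i + ka i)%N.
    apply/eqP; rewrite -(eqr_nat K) -(root_coord_sum i k) -/b bE.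
    by rewrite (root_coord_sum i (fun i => l i + ka i)%N).
  apply: (IH l) => //; last by rewrite -lE opprB addrCA subrr addr0.
  have [i kai] : exists i, (0 < ka i)%N.
    apply: contrapT => /forallNP ka0; move: (root_neq0 aR); rewrite aE big1 ?eqxx // => i _.
    by have /negP := ka0 i; rewrite -eqn0Ngt => /eqP ->.
  rewrite -ltnS; apply: leq_trans km; rewrite (eq_bigr _ (fun i _ => kE i)) big_split /=.
  by rewrite -addn1 leq_add2l (bigD1 i) //= addn_gt0 kai.
have [y1 [u yu]] := Ny.
have y2E : y = (0, y.2) :> S by rewrite -y1 -surjective_pairing.
have y2wt : wt_vec (lam - b : W) y.2 by move=> h; have := congr1 snd (yb h).
have y2p a : pos_root a -> lact (xr D a) y.2 = 0.
  by move=> ap; have := congr1 snd (yp a ap).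
have y20 : y.2 != 0 by apply: contra y0 => /eqP y20; rewrite y2E y20.
have bl : wle (lam - b) lam by exists k; rewrite opprB addrCA subrr addr0.
have := casimir_scalar_neq gs bl; case/(_ _ _ _)/negP.
- by rewrite -subr_eq0 addrAC subrr add0r oppr_eq0.
- move=> i; apply: (dominant gs V_lf (alpha_root i) y2wt y20); apply: y2p.
  by split; [apply: alpha_root|apply: Qplus_alpha].
- exact: lam_dominant.
have e1 := casimir_hw gs yb yp.
have e2 : uact (casimir D) y = casimir_scalar lam *: y.
  by rewrite yu -uactM casimirC // uactM (casimir_hw gs graph_wt graph_pos) uactZr.
by move/eqP: e1; rewrite e2 -subr_eq0 -scalerBl scaler_eq0 (negPf y0) orbF subr_eq0 eq_sym.
Qed.

(** [N] contains the weight components of its elements ([wt_subspace]), and has no nonzero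
    weight vector. *)
Lemma hw_univ u : uact u (hw_vec M) = 0 -> uact u v = 0.
Proof.
move=> um; have uE w := uact_dsum w z.
have Nu : N (uact u z) by split; [rewrite uE /= um|exists u].
suff : uact u z = 0 by rewrite uE => -[].
apply: (wt_subspace (N := N) _ N_lin _ _ _ Nu).
- by split=> //; exists 0; rewrite uact0l.
- by move=> h x; apply: N_lact.
- move=> mu y ym Ny; have [_ n0] := generated_weight_vec T0 TD Twt (NG Ny) ym.
  have [[k kE]|/n0//] := pselect (wle mu lam).
  by apply: (graph_no_wt (leqnn (\sum_i k i)) Ny); rewrite -kE opprB addrCA subrr addr0.
apply: sums_sub (generated_weights Twt (NG Nu)) => y [mu ym _]; by exists mu.
Qed.
End HighestWeight.

(** * Cyclic, induced and sub modules *)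

Section Generators.
Context {K : fieldType} {L : lieAlgType K}.
Implicit Types V W : lieMod L.

Lemma cyclic_hom V W (v : V) (w : W) : (forall v', exists u, uact u v = v') ->
    (forall u, uact u v = 0 -> uact u w = 0) ->
  exists f : lmHom V W, forall u, f (uact u v) = uact u w.
Proof.
move=> /choice[r rE] ann; have fE u : uact (r (uact u v)) w = uact u w.
  by apply/uact_eq/ann/uact_eq.
pose f v' := uact (r v') w.
have fL c x y : f (c *: x + y) = c *: f x + f y.
  rewrite -(rE x) -(rE y) -uactZl -uactDl /f !fE.
  by rewrite uactDl uactZl.
have fA x y : f (lact x y) = lact x (f y).
  by rewrite -(rE y) -uact_gen -uactM /f !fE uactM uact_gen.
by exists (LmHom fL fA).
Qed.

Lemma uact_restr (L' : lieAlgType K) (i : lieHom L L') (V : lieMod L') u (v : V) :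
  uact (V := restr i V) u v = uact (umap i u) v.
Proof.
elim/(@envel_ind K L): u v => [c|x|s t IHs IHt|s t IHs IHt] v.
- by rewrite umap_cst !uact_cst.
- by rewrite umap_gen !uact_gen.
- by rewrite umapD !uactDl IHs IHt.
- by rewrite umapM !uactM IHt IHs.
Qed.

Definition restr_hom (L' : lieAlgType K) (i : lieHom L' L) V W (f : lmHom V W) :
  lmHom (restr i V) (restr i W).
Proof.
refine (@LmHom _ _ (restr i V) (restr i W) (fun v => f v) _ _).
- by move=> c u v; apply: (lmh_lin f).
- by move=> x v; apply: (lmh_act f).
Defined.

Lemma bimod_tensor_hom (S : pzRingType) (B : bimod L S) (N : lmodType S) (X : lieMod L)
    (b : B -> N -> X) :
    (forall m m' n, b (m + m') n = b m n + b m' n) ->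
    (forall m n n', b m (n + n') = b m n + b m n') ->
    (forall m s n, b (ract (bm_right B) m s) n = b m (s *: n)) ->
    (forall c m n, b (c *: m) n = c *: b m n) ->
    (forall x m n, b (lact x m) n = lact x (b m n)) ->
  exists F : lmHom (bimod_tensor B N) X, forall m n, F (pure (bm_right B) m n) = b m n.
Proof.
move=> bDl bDr bB bZ bA; pose F : tensor (bm_right B) N -> X := tlift b.
have FD x y : F (x + y) = F x + F y by apply: tliftD.
have FN x : F (- x) = - F x by apply: tliftN.
have F0 : F 0 = 0 by apply: tlift0.
have FP m n : F (pure (bm_right B) m n) = b m n by apply: tlift_pure.
have FL c (x y : bimod_tensor B N) : F (c *: x + y) = c *: F x + F y.
  rewrite FD; congr (_ + _).
  elim/(@tensor_ind K S B (bm_right B) N): x => [|x IH|x z IHx IHz|m n].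
  - by rewrite scaler0 F0 scaler0.
  - by rewrite scalerN !FN IH scalerN.
  - by rewrite scalerDr !FD IHx IHz scalerDr.
  - by rewrite -pureZl !FP bZ.
have FA x (y : bimod_tensor B N) : F (lact x y) = lact x (F y).
  elim/(@tensor_ind K S B (bm_right B) N): y => [|y IH|y z IHy IHz|m n].
  - by rewrite lact0r F0 lact0r.
  - by rewrite lactNr !FN IH lactNr.
  - by rewrite lactDr !FD IHy IHz lactDr.
  - have -> : lact x (pure (bm_right B) m n : bimod_tensor B N) = pure _ (lact x m) n.
      exact: bt_act_pure.
    by rewrite !FP bA.
by exists (LmHom FL FA) => m n; apply: FP.
Qed.

End Generators.

Section FrobeniusReciprocity.
Context {K : fieldType} {L L' : lieAlgType K} (i : lieHom L L').

Definition ind_unit (V : lieMod L) : lmHom V (restr i (induced i V)).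
Proof.
refine (@LmHom _ _ V (restr i (induced i V)) (fun v => ind_pure i 1 v) _ _).
- move=> c u v; rewrite /ind_pure.
  have -> : pure (env_right i) 1 (c *: u + v : umodule V)
      = pure (env_right i) 1 (c *: u : umodule V) + pure (env_right i) 1 (v : umodule V).
    exact: pureDr.
  have -> : pure (env_right i) 1 (c *: u : umodule V) = pure (env_right i) c%:A (u : umodule V).
    have := pure_bal (env_right i) 1 c%:A (u : umodule V).
    by rewrite /= umap_cst mul1r => ->; congr (pure _ _ _); exact/esym/uact_cst.
  by rewrite pureZl.
- move=> x v; rewrite [RHS](_ : _ = ind_pure i (ugen (i x) * 1) v); last exact: bt_act_pure.
  have := pure_bal (env_right i) 1 (ugen x) (v : umodule V).
  rewrite /= umap_gen mul1r mulr1 /ind_pure => ->; congr (pure _ _ _).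
  exact/esym/uact_gen.
Defined.

Lemma induced_hom (V : lieMod L) (X : lieMod L') (f : lmHom V (restr i X)) :
  exists F : lmHom (induced i V) X, forall u v, F (ind_pure i u v) = uact u (f v : X).
Proof.
apply: (@bimod_tensor_hom _ _ _ (env_bimod i) (umodule V) X (fun u v => uact u (f v : X))).
- by move=> m m' n; apply: uactDl.
- by move=> m n n'; rewrite -uactDr; congr (uact _ _); exact: (lmhD f n n').
- move=> m s n; rewrite /= uactM; congr (uact _ _).
  by rewrite -uact_restr -lmh_uact.
- by move=> c m n; apply: uactZl.
- by move=> x m n; rewrite /= uactM uact_gen.
Qed.

End FrobeniusReciprocity.

Section Submodule.
Context {K : fieldType} {L : lieAlgType K} {V : lieMod L} (N : lieSub V).

Definition sub_pred : {pred V} := fun v => `[< N v >].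

Lemma sub_predP v : reflect (N v) (v \in sub_pred).
Proof. exact: asboolP. Qed.

Lemma sub_pred_closed : submod_closed sub_pred.
Proof.
split=> [|c u v /sub_predP Nu /sub_predP Nv]; apply/sub_predP; first exact: ls_0.
exact: ls_lin.
Qed.
HB.instance Definition _ := GRing.isSubmodClosed.Build K V sub_pred sub_pred_closed.

Record sub_car := SubCar { sc_val : V; sc_valP : sc_val \in sub_pred }.
HB.instance Definition _ := [isSub for sc_val].
HB.instance Definition _ := [Choice of sub_car by <:].
HB.instance Definition _ := [SubChoice_isSubLmodule of sub_car by <:].

Lemma sub_act_subproof x (v : sub_car) : lact x (sc_val v) \in sub_pred.
Proof. by apply/sub_predP/ls_act/sub_predP/sc_valP. Qed.

Definition subMod : lieMod L.
Proof.
exists sub_car (fun x v => SubCar (sub_act_subproof x v)) => [c x y v|c x u v|x y v];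
  apply: val_inj => /=.
- by rewrite lact_linl.
- by rewrite lact_linr.
- by rewrite lact_lie.
Defined.

Definition subIncl : lmHom subMod V.
Proof. by exists sc_val. Defined.

Lemma subIncl_inj : injective subIncl.
Proof. exact: val_inj. Qed.

Lemma subInclP v : N v <-> exists w, subIncl w = v.
Proof.
split=> [/sub_predP Nv|[w <-]]; first by exists (SubCar Nv).
exact/sub_predP/sc_valP.
Qed.

End Submodule.

(** * Local finiteness *)

Section LocallyFinite.
Context {K : fieldType} {g : lieAlgType K}.
Implicit Types V W : lieMod g.

Definition lfin V (v : V) := exists n (b : 'I_n -> V), in_span b v /\ stable_span b.

Lemma lfin0 V : lfin (0 : V).
Proof.
by exists 0, (fun=> 0); split=> [|x []//]; apply: in_span0.
Qed.

Lemma span_cat V m n (b : 'I_m -> V) (c : 'I_n -> V)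
    (d := fun i => match split i with inl i => b i | inr j => c j end) :
  (forall v, in_span b v -> in_span d v) /\ (forall v, in_span c v -> in_span d v).
Proof.
have dl i : in_span d (b i).
  by have := in_span_gen d (lshift n i); rewrite {2}/d (unsplitK (inl i)).
have dr i : in_span d (c i).
  by have := in_span_gen d (rshift m i); rewrite {2}/d (unsplitK (inr i)).
split=> v; apply: in_span_min => //; try exact: in_span0; exact: in_span_lin.
Qed.

Lemma lfinD V (u v : V) : lfin u -> lfin v -> lfin (u + v).
Proof.
move=> [m [b [bu sb]]] [n [c [cv sc]]]; have [db dc] := span_cat b c.
exists (m + n)%N, (fun i => match split i with inl i => b i | inr j => c j end).
split=> [|x i]; first by apply: in_spanD; [apply: db|apply: dc].
by case: (split i) => j; [apply/db/sb|apply/dc/sc].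
Qed.

Lemma lfin_hom V W (f : lmHom V W) v : lfin v -> lfin (f v).
Proof.
move=> [n [b [bv sb]]]; have fb u : in_span b u -> in_span (f \o b) (f u).
  apply: (@in_span_min _ _ _ _ _ (fun u => in_span (f \o b) (f u))) => [|c x y|i].
  - by rewrite lmh0; apply: in_span0.
  - by rewrite lmh_lin; apply: in_span_lin.
  - exact: in_span_gen.
exists n, (f \o b); split=> [|x i]; first exact: fb.
by rewrite /= -lmh_act; apply/fb/sb.
Qed.

Lemma lfin_hom_inj V W (f : lmHom V W) v : injective f -> lfin (f v) -> lfin v.
Proof.
move=> fI [n [b [bv sb]]].
pose P w := (exists u, f u = w) /\ in_span b w.
have P0 : P 0 by split; [exists 0; rewrite lmh0|apply: in_span0].
have PL (c : K) (x y : W) : P x -> P y -> P (c *: x + y).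
  move=> [[x' <-] bx] [[y' <-] by_]; split; last exact: in_span_lin.
  by exists (c *: x' + y'); rewrite lmh_lin.
have [m [b' [b'P b'S]]] := in_span_sub b P0 PL.
have /choice[b'' b''E] i : exists u, f u = b' i by have [] := b'P i.
have bb u : in_span b (f u) -> in_span b'' u.
  move=> bu; have [|c cE] := b'S _ _ bu; first by split=> //; exists u.
  exists c; apply: fI; rewrite cE (big_morph f (id1 := 0) (op1 := +%R)) ?lmh0 //.
    by apply: eq_bigr => i _; rewrite lmhZ b''E.
  exact: lmhD.
exists m, b''; split=> [|x i]; first exact: bb.
by apply: bb; rewrite lmh_act b''E; apply: stable_lact sb _; have [] := b'P i.
Qed.

Lemma lfin_fin_dim V n (b : 'I_n -> V) : (forall v, in_span b v) -> forall v : V, lfin v.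
Proof. by move=> bS v; exists n, b; split=> // x i. Qed.

End LocallyFinite.

Section CurrentFinite.
Context {K : numClosedFieldType} {g : finLieAlgType K} (A : comAlgType K).
Context {V : lieMod (lieTensor g A)}.
Notation RV := (restr (cur_emb g A) V).

(** If F is a finite-dimensional g-submodule, then so is (g (x) a) F + F. *)
Lemma lfin_cur_ltens (x : g) (a : A) (v : V) : lfin (v : RV) -> lfin (lact (ltens x a) v : RV).
Proof.
move=> [n [b [bv sb]]]; pose m := \dim (fullv : {vspace g}).
pose e : 'I_m -> g := fun i => (vbasis fullv)`_i.
have ltL (y : g) : exists c : 'I_m -> K, ltens y a = \sum_i c i *: ltens (e i) a.
  exists (fun i => coord (vbasis fullv) i y).
  rewrite {1}(coord_vbasis (memvf y)).
  elim: (index_enum _) => [|i s IH]; first by rewrite !big_nil /ltens pure0l.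
  by rewrite !big_cons -IH /ltens pureDl pureZl.
pose d (p : 'I_m * 'I_n) : RV := lact (ltens (e p.1) a) (b p.2).
pose c (i : 'I_#|{: 'I_m * 'I_n}|) : RV := d (enum_val i).
have cS (y : g) (w : RV) : in_span b w -> in_span c (lact (ltens y a) w).
  apply: (@in_span_min _ _ _ _ _ (fun w => in_span c (lact (ltens y a) w))) => [|k u u'|j].
  - by rewrite lact0r; apply: in_span0.
  - by move=> cu cu'; rewrite lact_linr; apply: in_span_lin.
  have [k ->] := ltL y.
  elim/big_rec: _ => [|i t _ IH]; first by rewrite lact0l; apply: in_span0.
  rewrite lact_linl; apply: in_span_lin => //.
  by have := in_span_gen c (enum_rank (i, j)); rewrite {2}/c enum_rankK.
have [dc db] := span_cat c b.
exists _, (fun i => match split i with inl i => c i | inr j => b j end).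
split=> [|y i]; first by apply/dc/cS.
case: (split i) => j; last by apply/db/sb.
rewrite /c /d; case: (enum_val j) => k l /=.
have -> : lact (ltens y 1) (lact (ltens (e k) a) (b l))
    = lact (ltens (lie y (e k)) a) (b l) + lact (ltens (e k) a) (lact (ltens y 1) (b l)) :> V.
  have := lact_lie (ltens y 1) (ltens (e k) a) (b l : V).
  by rewrite [lie (ltens y 1) _]tlie_pure mul1r => ->; rewrite subrK.
apply: (@in_spanD _ _ RV); apply/dc/cS; first exact: in_span_gen.
exact: sb.
Qed.

Lemma lfin_cur_uact u (v : V) : lfin (v : RV) -> lfin (uact u v : RV).
Proof.
have lfZ c (w : RV) : lfin w -> lfin (c *: w).
  by move=> [n [b [bw sb]]]; exists n, b; split=> //; apply: in_spanZ.
elim/(@envel_ind K (lieTensor g A)): u v => [c|x|s t IHs IHt|s t IHs IHt] v vf.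
- by rewrite uact_cst; apply: lfZ.
- rewrite uact_gen; elim/(@ltens_ind K g A): x => [|y IH|y z IHy IHz|y a].
  + by rewrite lact0l; apply: lfin0.
  + by rewrite lactNl -scaleN1r; apply: lfZ.
  + by rewrite lactDl; apply: (@lfinD _ _ RV).
  + exact: lfin_cur_ltens.
- by rewrite uactDl; apply: (@lfinD _ _ RV); [apply: IHs|apply: IHt].
- by rewrite uactM; apply/IHs/IHt.
Qed.

End CurrentFinite.

(** * The categories of the current algebra *)

Section CategoryI.
Context {K : numClosedFieldType} {g : finLieAlgType K} (gs : is_simple g) {D : chevalley g}.
Context {A : comAlgType K}.
Notation W := (weight D).
Notation L := (lieTensor g A).
Implicit Types (mu nu : W) (V X : lieMod L).

Lemma in_I_wt nu V : in_I nu V <->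
  in_IA V /\ forall mu (v : V), ~ wle mu nu -> cwt_vec mu v -> v = 0.
Proof.
split=> -[VA Vt]; split=> //.
  move=> mu v nm vm; apply: Vt; exists [:: (1, v)]; last by rewrite big_seq1 uact1.
  by move=> p; rewrite inE => /eqP ->; exists mu.
move=> v [s sP ->]; rewrite big_seq big1 // => p /sP[mu nm pm].
by rewrite (Vt _ _ nm pm) uact0r.
Qed.

Lemma lmh_cwt V X (f : lmHom V X) mu (v : V) : cwt_vec mu v -> cwt_vec mu (f v).
Proof. exact: (lmh_wt (restr_hom (cur_emb g A) f)). Qed.

Lemma cwt_inj V X (f : lmHom V X) mu (v : V) : injective f ->
  cwt_vec mu (f v) -> cwt_vec mu v.
Proof.
move=> fI fm h; apply: fI; rewrite [RHS]lmhZ; apply: etrans (fm h).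
exact: (lmh_act f _ v).
Qed.

Lemma lmh_trunc V X (f : lmHom V X) nu (v : V) : trunc_sub nu V v -> trunc_sub nu X (f v).
Proof.
move=> [s sP ->]; exists [seq (p.1, f p.2) | p <- s].
  by move=> p /mapP[q /sP[mu nm qm] ->]; exists mu => //; apply: lmh_cwt.
rewrite big_map (big_morph f (id1 := 0) (op1 := +%R)) ?lmh0 //; last exact: lmhD.
by apply: eq_bigr => p _; rewrite lmh_uact.
Qed.

Lemma cwt_decomp V : in_IA V -> forall v : V,
  sums (fun y : restr (cur_emb g A) V => exists mu : W, wt_vec mu y) v.
Proof. exact: weight_decomp gs D _. Qed.

(** Take the component of weight mu of any preimage; this requires V to be the sum of its
    weight spaces. *)
Lemma cwt_lift V X (f : lmHom V X) mu (x : X) : in_IA V ->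
  (forall y, exists v, f v = y) -> cwt_vec mu x -> exists2 v, cwt_vec mu v & f v = x.
Proof.
move=> VA fS xm; have [v vx] := fS x.
pose Q (nu : W) (y : restr (cur_emb g A) X) := exists2 w : V, cwt_vec nu w & f w = y.
have S : sums (fun y => exists2 nu, wt_vec nu y & Q nu y) (x : restr (cur_emb g A) X).
  rewrite -vx; apply: (@sums_bind V X _ _ f) (cwt_decomp VA v) => [u w|y [nu yn]].
    exact: lmhD.
  apply: sums1; exists nu; first exact: lmh_cwt.
  by exists y.
have := wt_component S xm.
elim=> [|y z [_ [w wm wy]] _ [w' w'm w'z]].
  by exists 0; [apply: (wt_vec0 (restr (cur_emb g A) V))|apply: lmh0].
exists (w + w'); last by rewrite lmhD wy w'z.
exact: (@wt_vecD _ _ _ (restr (cur_emb g A) V)).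
Qed.

Lemma in_IA_surj V X (f : lmHom V X) : (forall y, exists v, f v = y) -> in_IA V -> in_IA X.
Proof.
move=> fS VA x; have [v <-] := fS x.
exact: (lfin_hom (restr_hom (cur_emb g A) f) (VA v)).
Qed.

Lemma in_I_surj nu V X (f : lmHom V X) : (forall y, exists v, f v = y) -> in_I nu V -> in_I nu X.
Proof.
move=> fS /in_I_wt[VA Vt]; apply/in_I_wt; split; first exact: in_IA_surj fS VA.
by move=> mu x nm xm; have [v vm <-] := cwt_lift VA fS xm; rewrite (Vt _ _ nm vm) lmh0.
Qed.

Lemma in_I_inj nu V X (f : lmHom V X) : injective f -> in_I nu X -> in_I nu V.
Proof.
move=> fI [XA Xt]; split=> [v|v vt].
  exact: (lfin_hom_inj (f := restr_hom (cur_emb g A) f) fI (XA (f v))).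
by apply: fI; rewrite lmh0; apply/Xt/lmh_trunc.
Qed.

Lemma trunc_in_I nu V : in_IA V -> in_I nu (trunc nu V).
Proof.
move=> VA; have qS y : exists v, qproj (trunc_sub nu V) v = y by exists (repr y); apply: qclsK.
apply/in_I_wt; split; first exact: in_IA_surj qS VA.
move=> mu x nm xm; have [v vm <-] := cwt_lift VA qS xm.
apply/(qclsP _ v 0); rewrite subr0; exists [:: (1, v)]; last by rewrite big_seq1 uact1.
by move=> p; rewrite inE => /eqP ->; exists mu.
Qed.

Lemma cwt_lact V mu (a : W) (b : A) (x : g) (v : V) :
  root_vec a x -> cwt_vec mu v -> cwt_vec (mu + a : W) (lact (ltens x b) v).
Proof.
move=> xa; apply: (lact_wt (f := cur_emb g A)) => h.
by rewrite [LHS]tlie_pure mul1r xa ltensZ.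
Qed.

Lemma top_kill (lam : W) V (v : V) a (b : A) : in_I lam V -> cwt_vec lam v ->
  pos_root (a : W) -> lact (ltens (xr D a) b) v = 0.
Proof.
move=> /in_I_wt[_ Vt] vl [aR aQ]; apply: (Vt (lam + a)); last exact: cwt_lact (xr_root aR) vl.
rewrite /wle opprD addrA subrr add0r => naQ.
by move: (root_neq0 aR); rewrite (Qplus_anti aQ naQ) eqxx.
Qed.

End CategoryI.

(** * The global Weyl module *)

Section Weyl.
Context {K : numClosedFieldType} {g : finLieAlgType K} (gs : is_simple g) {D : chevalley g}.
Context {lam : weight D} (lamP : in_Pplus lam) (M : hw_module lam) (A : comAlgType K).
Notation W := (weight D).
Notation L := (lieTensor g A).
Notation w_ := (weyl_vec M A).
Implicit Types (X : lieMod L).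

Lemma hw_cyclic (m : M) : exists u, uact u (hw_vec M) = m.
Proof.
pose P (m : M) := exists u, uact u (hw_vec M) = m.
have P0 : P 0 by exists 0; rewrite uact0l.
have PL c u v : P u -> P v -> P (c *: u + v).
  by move=> [s <-] [t <-]; exists (c *: s + t); rewrite uactDl uactZl.
have PA x v : P v -> P (lact x v).
  by move=> [s <-]; exists (ugen x * s); rewrite uactM uact_gen.
have [_ /(_ (LieSub P0 PL PA))[/(_ (hw_vec M)) H|H]] := hw_irr M; last exact: H.
have : hw_vec M = 0 by apply: H; exists 1; rewrite uact1.
by move/eqP; rewrite (negPf (hw_vec_neq0 M)).
Qed.

Lemma PA_in_IA : in_IA (PA M A).
Proof.
have [n [b bS]] := hw_fd M.
have fM (m : M) : lfin (m : M) by apply: lfin_fin_dim bS m.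
pose h : lmHom M (restr (cur_emb g A) (PA M A)) := ind_unit (cur_emb g A) M.
elim/(@tensor_ind K _ _ (env_right (cur_emb g A)) (umodule M)) => [|x IH|x y IHx IHy|u m].
- exact: lfin0.
- have [k [c [cx sc]]] := IH; exists k, c; split=> //.
  by rewrite -scaleN1r; apply: in_spanZ.
- exact: lfinD.
- have -> : pure (env_right (cur_emb g A)) u (m : umodule M) = uact u (h m : PA M A).
    by rewrite uact_ind_pure mulr1.
  by apply: lfin_cur_uact; apply: lfin_hom (fM m).
Qed.

Lemma weyl_in_I : in_I lam (weyl_mod M A).
Proof. exact/trunc_in_I/PA_in_IA. Qed.

(** The map from M to X given by [hw_univ] extends to the induced module by Frobenius
    reciprocity, and maps the submodule divided out by the truncation to that of X, which
    is 0. *)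
Lemma weyl_univ X (x : X) u : in_I lam X -> cwt_vec lam x ->
  uact u w_ = 0 -> uact u x = 0.
Proof.
move=> XI xl; have [XA Xt] := XI.
have xp a : pos_root a -> lact (l := restr (cur_emb g A) X) (xr D a) x = 0.
  exact: top_kill XI xl.
have [f fE] := cyclic_hom hw_cyclic (hw_univ gs lamP (M := M) XA xl xp).
have [F FE] := induced_hom f.
have Fx : F (PA_vec M A) = x.
  by rewrite FE uact1; have := fE 1; rewrite !uact1.
rewrite /weyl_vec -lmh_uact => /(qclsP _ _ 0); rewrite subr0 => ut.
by have /Xt := lmh_trunc F ut; rewrite lmh_uact Fx.
Qed.

Lemma weyl_vec_wt : cwt_vec lam w_.
Proof.
apply: (lmh_cwt (qproj _)).
exact: (lmh_wt (ind_unit (cur_emb g A) M) (hw_vec_wt M)).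
Qed.

(** Universal property applied to W itself and the vector p w_lam, which has weight lam. *)
Lemma weyl_ract_wd : right_action_wd M A.
Proof.
move=> u p uw; rewrite uactM; apply: weyl_univ uw; first exact: weyl_in_I.
exact/hact_wt/weyl_vec_wt.
Qed.

Lemma weyl_ann_kills X : in_I lam X -> ann_kills M X.
Proof. by move=> XI p v pw vl; apply: weyl_univ pw. Qed.

(** By the triangular decomposition, W is generated from U(h (x) A) w_lam by the elements
    x (x) a with x a negative root vector, and these strictly lower weights. *)
Lemma weyl_top (m : weyl_mod M A) : cwt_vec lam m ->
  exists p : envel (lieTensor (cartan_lie D) A), m = hact p w_.
Proof.
pose T (t : weyl_mod M A) := exists p : envel (lieTensor (cartan_lie D) A), t = hact p w_.
have T0 : T 0 by exists 0; rewrite /hact /env_incl umap0 uact0l.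
have TD t t' : T t -> T t' -> T (t + t').
  by move=> [p ->] [q ->]; exists (p + q); rewrite hactDl.
have TZ c t : T t -> T (c *: t).
  move=> [p ->]; exists (c%:A * p); rewrite hactM.
  by rewrite [RHS]/hact /env_incl umap_cst uact_cst.
have Tl t : T t -> cwt_vec lam t.
  by move=> [p ->]; apply/hact_wt/weyl_vec_wt.
pose G := generated (lowering (D := D) (cur_emb g A)) T.
have GZ c (v : weyl_mod M A) : G v -> G (c *: v) by apply: generatedZ.
have G0 : G 0 by apply: gen_base.
have TL (y : L) t : T t -> G (lact y t).
  move=> Tt; elim/(@ltens_ind K g A): y => [|y IH|y z IHy IHz|x a].
  - by rewrite lact0l.
  - by rewrite lactNl -scaleN1r; apply: GZ.
  - by rewrite lactDl; apply: gen_add.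
  apply: (@g_ind K g D (fun x => G (lact (ltens x a) t))) => [c x1 x2 G1 G2|b bR|h].
  - rewrite /ltens pureDl pureZl lact_linl; apply: gen_add => //; exact: GZ.
  - have [bQ|bQ] := pselect (in_Qplus b).
      by rewrite (top_kill _ weyl_in_I (Tl _ Tt)).
    apply: gen_act; last exact: gen_base.
    exists b; first by split; [apply: root_neq0|case: (root_pm bR)].
    by move=> h; rewrite [LHS]tlie_pure mul1r xr_root // ltensZ.
  - have [p ->] := Tt; apply: gen_base; exists (ugen (ltens h a) * p).
    by rewrite hactM [RHS]/hact /env_incl umap_gen uact_gen [cur_map _ _ _]cur_pure.
have [u <-] := weyl_cyclic m => ml.
have Gu : G (uact u w_).
  by apply: generated_uact => //; apply: gen_base; exists 1; rewrite /hact /env_incl umap1 uact1.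
by have [/(_ erefl)] := generated_weight_vec T0 TD Tl Gu ml.
Qed.

End Weyl.

(** * The Weyl functor *)

Section Functor.
Context {K : numClosedFieldType} {g : finLieAlgType K} (gs : is_simple g) {D : chevalley g}.
Context {lam : weight D} (lamP : in_Pplus lam) {M : hw_module lam} {A : comAlgType K}.
Variable Hw : right_action_wd M A.
Notation L := (lieTensor g A).
Notation Al := (Alam gs M A).
Notation W := (weyl_mod M A).
Notation w_ := (weyl_vec M A).
Variable N : lmodType Al.
Notation FN := (weyl_functor gs Hw N).
Implicit Types (X U : lieMod L).

Definition wpure (m : W) (n : N) : FN := pure (weyl_right gs Hw) m n.

Definition wpure_hom (n : N) : lmHom W FN.
Proof.
refine (@LmHom _ _ W FN (fun m => wpure m n) _ _).
- by move=> c u v; rewrite /wpure pureDl pureZl.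
- by move=> x v; symmetry; apply: bt_act_pure.
Defined.

Lemma wpure_uact u n : wpure (uact u w_) n = uact u (wpure w_ n).
Proof. exact: (lmh_uact (wpure_hom n)). Qed.

Lemma wpure_hact p n : wpure (hact p w_) n = wpure w_ (acls gs M p *: n).
Proof.
rewrite /wpure -pure_bal; congr (pure _ _ _).
rewrite -{2}[w_](uact1 w_) [RHS](weyl_ractE gs Hw).
by rewrite mul1r.
Qed.

Lemma weyl_functor_ind (P : FN -> Prop) : P 0 -> (forall x, P x -> P (- x)) ->
    (forall x y, P x -> P y -> P (x + y)) -> (forall u n, P (uact u (wpure w_ n))) ->
  forall x, P x.
Proof.
move=> P0 PN PD PP; elim/(@tensor_ind K Al W (weyl_right gs Hw) N) => // m n.
by have [u <-] := weyl_cyclic m; rewrite -[pure _ _ _]/(wpure _ _) wpure_uact.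
Qed.

Lemma weyl_functor_in_IA : in_IA FN.
Proof.
have [WA _] := weyl_in_I gs M A.
elim/(@tensor_ind K Al W (weyl_right gs Hw) N) => [|x [k [c [cx sc]]]|x y IHx IHy|m n].
- exact: lfin0.
- by exists k, c; split=> //; rewrite -scaleN1r; apply: in_spanZ.
- exact: lfinD.
- exact: (lfin_hom (restr_hom (cur_emb g A) (wpure_hom n)) (WA m)).
Qed.

Definition functor_low_or_top (mu : weight D) (y : restr (cur_emb g A) FN) : Prop :=
  wle mu lam /\ (mu = lam -> exists n, y = wpure w_ n).

Lemma weyl_functor_decomp (x : FN) :
  sums (fun y : restr (cur_emb g A) FN =>
    exists2 mu : weight D, wt_vec mu y & functor_low_or_top mu y) x.
Proof.
have WI := weyl_in_I gs M A; have [WA _] := WI; have [_ Wt] := (in_I_wt _ _).1 WI.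
elim/(@tensor_ind K Al W (weyl_right gs Hw) N): x => [|x IH|x y IHx IHy|m n].
- exact: sums0.
- apply: (@sums_bind FN FN _ _ -%R) IH => [u v|y [mu ym [ml yE]]]; first exact: opprD.
  apply: sums1; exists mu; first exact: wt_vecN ym.
  split=> // /yE[n yn]; exists (- n).
  have : wpure w_ n + wpure w_ (- n) = 0 by rewrite /wpure -pureDr subrr pure0r.
  by move/eqP; rewrite addrC addr_eq0 => /eqP ->; rewrite yn.
- exact: sumsD.
apply: (@sums_bind W FN _ _ (fun m => wpure m n)) (cwt_decomp gs WA m) => [u v|y [mu ym]].
  exact: pureDl.
have [ml|ml] := pselect (wle mu lam); last first.
  by rewrite (Wt _ _ ml ym) /wpure pure0l; apply: sums0.
apply: sums1; exists mu; first exact: lmh_cwt (wpure_hom n) _ _ ym.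
split=> // mE; rewrite mE in ym; have [p ->] := weyl_top gs ym.
by exists (acls gs M p *: n); apply: wpure_hact.
Qed.

Lemma weyl_functor_top (x : FN) : cwt_vec lam x -> exists n, x = wpure w_ n.
Proof.
move=> xl; have := wt_component (weyl_functor_decomp x) xl.
elim=> [|y z [_ [_ /(_ erefl)[n ->]]] _ [n' ->]].
  by exists 0; rewrite /wpure pure0r.
by exists (n + n'); rewrite /wpure pureDr.
Qed.

Lemma weyl_functor_in_I : in_I lam FN.
Proof.
apply/in_I_wt; split; first exact: weyl_functor_in_IA.
move=> mu x nm xm; have := wt_component (weyl_functor_decomp x) xm.
by elim=> [//|y z [_ [ml _]]]; case: (nm ml).
Qed.

Lemma wpure_wt n : cwt_vec lam (wpure w_ n).
Proof. exact: (lmh_cwt (wpure_hom n) (weyl_vec_wt M A)). Qed.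

(** The universal property of the Weyl functor. For a fixed n, a map from W to X with value
    t n at w_lam exists by [weyl_univ]; A_lam-linearity of t is exactly what makes the
    family of these maps balanced. *)
Lemma weyl_functor_lift X (t : N -> X) : in_I lam X -> (forall n, cwt_vec lam (t n)) ->
    (forall n n', t (n + n') = t n + t n') ->
    (forall p n, t (acls gs M p *: n) = hact p (t n)) ->
  exists f : lmHom FN X, forall n, f (wpure w_ n) = t n.
Proof.
move=> XI tl tD tA.
have /choice[r rE] (n : N) : exists f : lmHom W X, forall u, f (uact u w_) = uact u (t n).
  apply: cyclic_hom => [m|u]; first exact: weyl_cyclic.
  by apply: weyl_univ.
pose b (m : W) (n : N) : X := r n m.
have bE u n : b (uact u w_) n = uact u (t n) by apply: rE.
have [|||||f fE] := @bimod_tensor_hom _ _ _ (weyl_bimod gs Hw) N X b.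
- by move=> m m' n; apply: lmhD.
- by move=> m n n'; have [u <-] := weyl_cyclic m; rewrite !bE tD uactDr.
- move=> m s n; have [u <-] := weyl_cyclic m; rewrite -(aclsK s).
  by rewrite [ract _ _ _](weyl_ractE gs Hw) !bE tA uactM.
- by move=> c m n; apply: lmhZ.
- by move=> x m n; apply: lmh_act.
exists f => n; apply: etrans (fE _ _) _.
by rewrite -[w_](uact1 w_) bE uact1.
Qed.

Lemma weyl_functor_hom_eq X (f h : lmHom FN X) :
  (forall n, f (wpure w_ n) = h (wpure w_ n)) -> forall x, f x = h x.
Proof.
move=> fh; apply: weyl_functor_ind => [|x IH|x y IHx IHy|u n].
- by rewrite !lmh0.
- by rewrite !lmhN IH.
- by rewrite !lmhD IHx IHy.
- by rewrite !lmh_uact fh.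
Qed.

Lemma weyl_functor_hom_zero U : (forall u : U, cwt_vec lam u -> u = 0) -> hom_zero FN U.
Proof.
move=> U0 f; apply: weyl_functor_ind => [|x IH|x y IHx IHy|u n].
- exact: lmh0.
- by rewrite lmhN IH oppr0.
- by rewrite lmhD IHx IHy addr0.
- by rewrite lmh_uact (U0 (f _)) ?uact0r //; apply/lmh_cwt/wpure_wt.
Qed.

End Functor.

Arguments wpure {K g gs D lam M A} Hw {N} m n.

(** * Extensions *)

Section Extensions.
Context {K : fieldType} {L : lieAlgType K} {V U : lieMod L}.
Implicit Types X Y Z : extension V U.

Lemma ext_equiv_bij X Y (f : lmHom (ext_mod X) (ext_mod Y)) :
    (forall u, f (ext_in X u) = ext_in Y u) ->
    (forall e, ext_out Y (f e) = ext_out X e) ->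
  exists2 h : lmHom (ext_mod Y) (ext_mod X), cancel f h & cancel h f.
Proof.
move=> fin fout.
have fI : injective f.
  apply: lmh_inj => e fe; have /ext_exact[u ue] : ext_out X e = 0.
    by rewrite -fout fe lmh0.
  move: fe; rewrite -ue fin -(lmh0 (ext_in Y)) => /(@ext_inj _ _ _ _ Y) ->.
  exact: lmh0.
have fS y : exists x, f x = y.
  have [x xE] := ext_surj X (ext_out Y y).
  have /ext_exact[u uE] : ext_out Y (y - f x) = 0.
    by rewrite lmhD lmhN fout xE subrr.
  by exists (ext_in X u + x); rewrite lmhD fin uE subrK.
have [h hE] := choice fS.
by apply: lmh_inverse; exists h => // x; apply: fI.
Qed.

Lemma ext_equiv_sym X Y : ext_equiv X Y -> ext_equiv Y X.
Proof.
move=> [f [fin fout]]; have [h fK hK] := ext_equiv_bij fin fout.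
by exists h; split=> [u|e]; [rewrite -fin fK|rewrite -fout hK].
Qed.

Lemma ext_equiv_trans X Y Z : ext_equiv X Y -> ext_equiv Y Z -> ext_equiv X Z.
Proof.
move=> [f [fin fout]] [h [hin hout]]; exists (lmh_comp h f).
by split=> [u|e] /=; [rewrite fin hin|rewrite hout fout].
Qed.

(** Write e in X as its U-component plus s (ext_out e), and replace s by t. *)
Lemma ext_split_equiv X Y (s : lmHom V (ext_mod X)) (t : lmHom V (ext_mod Y)) :
    (forall v, ext_out X (s v) = v) -> (forall v, ext_out Y (t v) = v) ->
  ext_equiv X Y.
Proof.
move=> sK tK; have oN e : ext_out X (e - s (ext_out X e)) = 0.
  by rewrite lmhD lmhN sK subrr.
have /choice[r rE] e : exists u, ext_in X u = e - s (ext_out X e).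
  exact/ext_exact/oN.
have rL c x y : r (c *: x + y) = c *: r x + r y.
  apply: (@ext_inj _ _ _ _ X); rewrite rE !lmh_lin !rE scalerBr.
  by rewrite opprD addrACA.
have rA x e : r (lact x e) = lact x (r e).
  apply: (@ext_inj _ _ _ _ X); rewrite rE !lmh_act !rE.
  by rewrite lactDr lactNr.
pose f e := ext_in Y (r e) + t (ext_out X e).
have fL c x y : f (c *: x + y) = c *: f x + f y.
  by rewrite /f rL !lmh_lin scalerDr addrACA.
have fA x e : f (lact x e) = lact x (f e).
  by rewrite /f rA !lmh_act lactDr.
have oin u : ext_out X (ext_in X u) = 0 by apply/ext_exact; exists u.
exists (LmHom fL fA); split=> [u|e] /=.
  rewrite /f oin lmh0 addr0; congr (ext_in Y _); apply: (@ext_inj _ _ _ _ X).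
  by rewrite rE oin lmh0 subr0.
rewrite /f lmhD tK (_ : ext_out Y _ = 0) ?add0r //.
by apply/ext_exact; exists (r e).
Qed.

Definition dsum_in : lmHom U (dsum U V).
Proof.
refine (@LmHom _ _ U (dsum U V) (fun u => (u, 0)) _ _).
- move=> c u v; change ((c *: u + v, 0) = (c *: u + v, c *: 0 + 0) :> U * V).
  by rewrite scaler0 addr0.
- move=> x u; change ((lact x u, 0) = (lact x u, lact x 0) :> U * V).
  by rewrite lact0r.
Defined.

Definition dsum_fst : lmHom (dsum U V) U.
Proof. by refine (@LmHom _ _ (dsum U V) U fst _ _). Defined.

Definition dsum_snd : lmHom (dsum U V) V.
Proof. by refine (@LmHom _ _ (dsum U V) V snd _ _). Defined.

Definition dsum_ext : extension V U.
Proof.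
exists (dsum U V) dsum_in dsum_snd.
- by move=> u v [].
- by move=> v; exists (0, v).
- by move=> [u v] /=; split=> [->|[u' [_ <-]] //]; exists u.
Defined.

End Extensions.

Section ExtensionFinite.
Context {K : fieldType} {g : finLieAlgType K}.

Lemma lfin_seq (U : lieMod g) (s : seq U) : (forall u : U, lfin u) ->
  exists n (b : 'I_n -> U), stable_span b /\ {in s, forall u, in_span b u}.
Proof.
move=> Uf; elim: s => [|u s [n [b [sb bs]]]].
  by exists 0, (fun=> 0); split=> // x [].
have [m [c [cu sc]]] := Uf u; have [dc db] := span_cat c b.
exists (m + n)%N, (fun i => match split i with inl i => c i | inr j => b j end).
split=> [x i|v]; first by case: (split i) => j; [apply/dc/sc|apply/db/sb].
by rewrite inE => /orP[/eqP->|/bs]; [apply: dc|apply: db].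
Qed.

(** Lift a spanning family b of a finite-dimensional submodule containing o e. The actions
    of a basis of g on the lifts agree with combinations of lifts up to finitely many
    elements of U, which lie in a finite-dimensional submodule of U. *)
Lemma lfin_extension (U Z V : lieMod g) (i : lmHom U Z) (o : lmHom Z V) :
    (forall v, exists e, o e = v) -> (forall e, o e = 0 -> exists u, i u = e) ->
    (forall u : U, lfin u) -> (forall v : V, lfin v) ->
  forall e : Z, lfin e.
Proof.
move=> oS ex Uf Vf e; have [n [b [[k kE] sb]]] := Vf (o e).
have /choice[t tE] j : exists x, o x = b j by apply: oS.
have oT (c : 'I_n -> K) : o (\sum_j c j *: t j) = \sum_j c j *: b j.
  rewrite (big_morph o (id1 := 0) (op1 := +%R)) ?lmh0 //; last exact: lmhD.
  by apply: eq_bigr => j _; rewrite lmhZ tE.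
have [u0 u0E] : exists u, i u = e - \sum_j k j *: t j.
  by apply: ex; rewrite lmhD lmhN oT kE subrr.
pose y (m : 'I_(\dim (fullv : {vspace g}))) : g := (vbasis fullv)`_m.
have /choice[w wE] (p : 'I_(\dim (fullv : {vspace g})) * 'I_n) :
    exists u, exists c : 'I_n -> K, lact (y p.1) (t p.2) = i u + \sum_j c j *: t j.
  have [c cE] := sb (y p.1) p.2.
  have [u uE] : exists u, i u = lact (y p.1) (t p.2) - \sum_j c j *: t j.
    by apply: ex; rewrite lmhD lmhN oT lmh_act tE cE subrr.
  by exists u, c; rewrite uE subrK.
have [m [b' [sb' b's]]] := lfin_seq (u0 :: [seq w p | p : _ * _]) Uf.
have [dt db] := span_cat t (i \o b').
have ib u : in_span b' u -> in_span (i \o b') (i u).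
  apply: (@in_span_min _ _ _ _ _ (fun u => in_span (i \o b') (i u))) => [|c x z|j].
  - by rewrite lmh0; apply: in_span0.
  - by rewrite lmh_lin; apply: in_span_lin.
  - exact: in_span_gen.
exists _, (fun j => match split j with inl j => t j | inr j => (i \o b') j end); split.
  rewrite -(subrK (\sum_j k j *: t j) e) -u0E; apply: in_spanD.
    by apply/db/ib/b's; rewrite inE eqxx.
  by apply: dt; exists k.
move=> x j; case: (split j) => l; last first.
  by apply: db; rewrite /= -lmh_act; apply/ib/sb'.
rewrite [x](coord_vbasis (memvf x)).
elim/big_rec: _ => [|a z _ IH]; first by rewrite lact0l; apply: in_span0.
rewrite lact_linl; apply: in_span_lin IH.
have [c ->] := wE (a, l); apply: in_spanD; last by apply: dt; exists c.
by apply/db/ib/b's; rewrite inE map_f ?orbT // mem_enum.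
Qed.

End ExtensionFinite.

Section ExtensionI.
Context {K : numClosedFieldType} {g : finLieAlgType K} (gs : is_simple g) {D : chevalley g}.
Context {A : comAlgType K}.

Lemma ext_in_I (lam : weight D) (V U : lieMod (lieTensor g A)) (X : extension V U) :
  in_I lam V -> in_I lam U -> in_I lam (ext_mod X).
Proof.
move=> /in_I_wt[VA Vt] /in_I_wt[UA Ut]; apply/in_I_wt; split.
  apply: (lfin_extension (i := restr_hom (cur_emb g A) (ext_in X))
    (o := restr_hom (cur_emb g A) (ext_out X)) _ _ UA VA).
    exact: (ext_surj X).
  by move=> e e0; have /ext_exact[u uE] : ext_out X e = 0 := e0; exists u.
move=> mu e nm em; have : ext_out X e = 0 by apply: (Vt _ _ nm); apply: lmh_cwt.
move=> /ext_exact[u uE]; suff u0 : u = 0 by rewrite -uE u0 lmh0.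
by apply: (Ut mu _ nm); apply: (cwt_inj (@ext_inj _ _ _ _ X)); rewrite uE.
Qed.

End ExtensionI.

(** * The criterion *)

Section Main.
Context {K : numClosedFieldType} {g : finLieAlgType K} (gs : is_simple g) {D : chevalley g}.
Context {lam : weight D} (lamP : in_Pplus lam) {M : hw_module lam} {A : comAlgType K}.
Variable Hw : right_action_wd M A.
Notation L := (lieTensor g A).
Notation w_ := (weyl_vec M A).
Implicit Types (X U V : lieMod L).

Let trivial_top U := forall u : U, cwt_vec lam u -> u = 0.

(** As U has no weight lam, the lam-weight spaces of X and V agree. So the map from N to V
    that corresponds to the inverse of e lifts uniquely to X, hence linearly. *)
Lemma weyl_functor_ext_section (N : lmodType (Alam gs M A)) V U (X : extension V U)
    (e : lmHom V (weyl_functor gs Hw N)) : bijective e ->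
    in_I lam V -> in_I lam U -> trivial_top U ->
  exists s : lmHom V (ext_mod X), forall v, ext_out X (s v) = v.
Proof.
move=> /lmh_inverse[h eK hK] VI UI U0; have XI := ext_in_I X VI UI.
have [XA _] := XI.
have topI (x y : ext_mod X) : cwt_vec lam x -> cwt_vec lam y ->
    ext_out X x = ext_out X y -> x = y.
  move=> xl yl xy; apply/eqP; rewrite -subr_eq0; apply/eqP.
  have dl : cwt_vec lam (x - y).
    exact: (@wt_vecD _ _ _ (restr (cur_emb g A) (ext_mod X)) _ _ _ xl (wt_vecN yl)).
  have /ext_exact[u uE] : ext_out X (x - y) = 0 by rewrite lmhD lmhN xy subrr.
  suff u0 : u = 0 by rewrite -uE u0 lmh0.
  by apply: U0; apply: (cwt_inj (@ext_inj _ _ _ _ X)); rewrite uE.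
pose a n := h (wpure Hw w_ n).
have al n : cwt_vec lam (a n) by apply/lmh_cwt/wpure_wt.
have /choice[t tE] n : exists x, cwt_vec lam x /\ ext_out X x = a n.
  by have [x xl xE] := cwt_lift gs XA (ext_surj X) (al n); exists x.
have tl n := (tE n).1; have to n := (tE n).2.
have tD n n' : t (n + n') = t n + t n'.
  apply: topI; first exact: tl.
    exact: (@wt_vecD _ _ _ (restr (cur_emb g A) (ext_mod X)) _ _ _ (tl n) (tl n')).
  by rewrite lmhD !to /a -lmhD /wpure pureDr.
have tA p n : t (acls gs M p *: n) = hact p (t n).
  apply: topI; [exact: tl|exact/hact_wt/tl|].
  by rewrite /hact lmh_uact !to /a -lmh_uact -wpure_uact wpure_hact.
have [s sE] := weyl_functor_lift lamP Hw XI tl tD tA.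
exists (lmh_comp s e) => v /=; rewrite -[RHS]eK.
by apply: (weyl_functor_hom_eq (f := lmh_comp (ext_out X) s)) => n /=; rewrite sE to.
Qed.

(** In one direction any isomorphism of V with some F N serves to split the extensions; in the
    other one the isomorphism obtained is the inverse of the counit. *)
Theorem weyl_iso_hom_ext V (HV : ann_kills M V) : in_I lam V ->
  lm_iso V (weyl_functor gs Hw (res_functor HV)) <->
    (forall U, in_I lam U -> trivial_top U ->
       hom_zero V U /\ ext1_zero (in_I (A := A) lam) V U).
Proof.
move=> VI; split=> [[e eB] U UI U0|HE].
  split=> [f v|X _].
    have [h eK hK] := lmh_inverse eB.
    by rewrite -[v]eK; apply: (weyl_functor_hom_zero U0 (lmh_comp f h)).
  have [s sK] := weyl_functor_ext_section X eB VI UI U0.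
  (* split_ext V U lies in I^lam as well, and is compared with X through sections of
     both *)
  have [t tK] := weyl_functor_ext_section (split_ext V U) eB VI UI U0.
  exact: ext_split_equiv sK tK.
set RV := res_functor HV; set FN := weyl_functor gs Hw RV.
have [eps epsE] : exists f : lmHom FN V, forall n : RV, f (wpure Hw w_ n) = ws_val n.
  apply: (weyl_functor_lift lamP Hw VI) => [n|//|p n].
    exact: asboolW (ws_valP n).
  exact: rscaleE.
have epsS v : exists x, eps x = v.
  have qS y : exists v, qproj (lmh_im eps) v = y by exists (repr y); apply: qclsK.
  have [VA _] := VI.
  have [|q0 _] := HE (quotMod (lmh_im eps)) (in_I_surj gs qS VI).
    move=> q ql; have [u ul <-] := cwt_lift gs VA qS ql.
    apply/(qclsP _ u 0); rewrite subr0.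
    by exists (wpure Hw w_ (WSpace (asboolT ul) : RV)); rewrite epsE.
  by have := q0 (qproj (lmh_im eps)) v => /(qclsP _ v 0); rewrite subr0.
pose N := lmh_ker eps.
have FI : in_I lam FN by apply: weyl_functor_in_I.
have NI : in_I lam (subMod N) := in_I_inj (@subIncl_inj _ _ _ N) FI.
have N0 : trivial_top (subMod N).
  move=> u ul; apply: (@subIncl_inj _ _ _ N); rewrite lmh0.
  have [n nE] := weyl_functor_top (lmh_cwt (subIncl N) ul).
  have : N (subIncl N u) by apply/subInclP; exists u.
  rewrite nE /= epsE => n0; have -> : n = 0 by apply: ws_val_inj.
  by rewrite /wpure pure0r.
have ex x : eps x = 0 <-> exists u, subIncl N u = x.
  exact: (subInclP N x).
pose X := Extension (@subIncl_inj _ _ _ N) epsS ex.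
have [_ E0] := HE _ NI N0.
(* by hypothesis, both X and the direct sum are equivalent to split_ext *)
have XD : ext_equiv X dsum_ext.
  apply: ext_equiv_trans (E0 X FI) (ext_equiv_sym (E0 dsum_ext _)).
  exact: ext_in_I.
have [f [fin _]] := XD.
(* the retraction of F (R V) onto the kernel vanishes, and so does the kernel *)
pose r : lmHom FN (subMod N) := lmh_comp (dsum_fst (V := V)) f.
have u0 (u : subMod N) : u = 0.
  have := weyl_functor_hom_zero N0 r (subIncl N u).
  have /= -> : r (subIncl N u) = (f (ext_in X u)).1 by [].
  by rewrite fin.
have epsI : injective eps.
  by apply: lmh_inj => x /ex[u <-]; rewrite (u0 u) lmh0.
have [h hE] := choice epsS.
have epsB : bijective eps by exists h => // x; apply: epsI.
have [k ek ke] := lmh_inverse epsB.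
by exists k; exists eps.
Qed.

End Main.

Theorem theorem3p7 (R : realType) (g : finLieAlgType R[i]) (gs : is_simple g)
    (D : chevalley g) (A : comAlgType R[i])
    (lam : weight D) (lamP : in_Pplus lam) (M : hw_module lam)
    (V : lieMod (lieTensor g A)) (VI : in_I lam V) :
  exists (Hw : right_action_wd M A) (HV : ann_kills M V),
    lm_iso V (weyl_functor gs Hw (res_functor HV)) <->
    (forall U : lieMod (lieTensor g A), in_I lam U ->
       (forall u : U, cwt_vec lam u -> u = 0) ->
       hom_zero V U /\ ext1_zero (in_I (A := A) lam) V U).
Proof.
have Hw : right_action_wd M A by exact: weyl_ract_wd.
have HV : ann_kills M V by exact: weyl_ann_kills.
exists Hw, HV; exact: weyl_iso_hom_ext.
Qed.
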